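(* Let $0<\beta<1$, let $J$ be a function satisfying (A1)–(A3) of the context (with constant $a_0>0$), and let $\theta\in\Theta$, $\theta\ne0$, be such that $a_0I(\mu(\theta))\le1$. Consider the test of $H_0:\epsilon_n=0$ versus $H_1:\epsilon_n=n^{-\beta}$, where the sample sizes $K_{in}$, $1\le i\le n$, are i.i.d. with rate function $J$ (i.e. satisfying (A3)) and, conditionally on the sample sizes, the $Y_{in}$ are independent with $$Y_{in}\sim(1-\epsilon_n)F_0^{K_{in}}+\epsilon_nF_\theta^{K_{in}},\qquad 1\le i\le n.$$ The Bonferroni test (based on $p_{(1)}$) is asymptotically powerless when $\beta>b_B(\theta)$ and asymptotically powerful when $\beta<b_B(\theta)$. The rank-adjustment test (based on $R_n$) is asymptotically powerless when $\beta>b_R(\theta)$ and asymptotically powerful when $\beta<b_R(\theta)$.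
   Context: Exponential family: $\{F_\theta\}_{\theta\in\Theta}$ are distributions on $\mathbb{R}$ with $dF_\theta(x)=e^{\theta x-\psi(\theta)}dF_0(x)$, where $e^{\psi(\theta)}=E_0e^{\theta X}$ ($X\sim F_0$) and $\Theta=\{\theta:\psi(\theta)<\infty\}$. $\mu(\theta)=\psi'(\theta)$ and $I(\nu)=\sup_{\theta\in\Theta}[\theta\nu-\psi(\theta)]$. $F^k$ denotes the $k$-fold convolution of $F$. Sample sizes: for each $n$, $K_{1n},\dots,K_{nn}$ are i.i.d. positive-integer-valued and observed, and $J$ is a function on $[0,\infty)$ such that: (A1) there exists $a_0>0$ such that $J(a)=0$ for $0\le a\le a_0$; (A2) $J'(a)$ is continuous and strictly increasing on $[a_0,\infty)$, with $J'(a_0)=0$ and $\lim_{a\to\infty}J'(a)=\infty$; (A3) $P(K_{in}=k)=\alpha_{kn}n^{-J(k/\log n)}$ with $\sup_{k\ge\lambda_n}\tfrac{|\log\alpha_{kn}|}{k}\to0$ as $n\to\infty$, where $\lambda_n=a_0\log n$. Phase transition curves: let $$g(\nu,a)=aI(\nu)+J(a),\qquad f_\theta(\nu,a)=a[\theta\nu-\psi(\theta)]+\tfrac12[1-g(\nu,a)],$$ $$g_H(\nu,a)=aI(\nu)+2J(a),\qquad f_{H\theta}(\nu,a)=a[\theta\nu-\psi(\theta)]+\tfrac12[1-g_H(\nu,a)].$$ For $\theta$ with $a_0I(\mu(\theta))\le1$, $$b_B(\theta)=\max_{(\nu,a):\,aI(\nu)=1}f_{H\theta}(\nu,a),\qquad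 b_R(\theta)=\max_{(\nu,a):\,g(\nu,a)=1}f_\theta(\nu,a),$$ the maxima being over $\nu\in\mathbb{R}$, $a>0$. P-values: conditionally on $K_{in}$, $p_i$ is the two-sided p-value of $Y_{in}$, that is, two times the upper or lower tail probability of $Y_{in}$ under $F_0^{K_{in}}$, whichever is smaller. When $F_0$ is discrete the p-values are randomized so that $p_i\sim{\rm Uniform}(0,1)$ under the $i$th null; concretely, $p_i=2\min(T_i,1-T_i)$ with $T_i=P_0(Y>Y_{in})+V_iP_0(Y=Y_{in})$ where $Y\sim F_0^{K_{in}}$ is taken independent of $Y_{in}$ given $K_{in}$ and $V_i$ are independent auxiliary Uniform$(0,1)$ variables. Test statistics: the Bonferroni test statistic is the smallest p-value $p_{(1)}=\min_{1\le i\le n}p_i$. With $r_i=\#\{j:K_{jn}\ge K_{in}\}$, the rank-adjustment test statistic is $$R_n=\min_{1\le i\le n}r_ip_i=\min_{k\ge1}n_kp_{(1)k},$$ where $n_k=\#\{i:K_{in}\ge k\}$ and $p_{(1)k}$ is the smallest p-value among $\{p_i:K_{in}\ge k\}$ (over $k$ with $n_k\ge1$). Risk: $P_0,P_1$ denote probability under $H_0,H_1$. For a test statistic $T$, ${\rm Risk}(T)=\inf_c[P_0(T\ge c)+P_1(T<c)]$; if $T$ is stochastically smaller under $H_1$ than under $H_0$ (as for $p_{(1)}$ and $R_n$), the inequalities are reversed. A sequence $T_n$ is asymptotically powerful if ${\rm Risk}(T_n)\to0$ and asymptotically powerless if ${\rm Risk}(T_n)\to1$ as $n\to\infty$.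
   Formalization: Bonferroni powerlessness for β>b_B(θ) is proved assuming some (ν,a) with aI(ν)=1 and θ(ν−μ(θ))≥0 has J'(a)≤θν−ψ(θ); without this it can fail when F_0 has a large atom at an end of its support, e.g. Bernoulli(1/2), a_0=1, J(a)=C(a−1)_+^2, C and θ large. *)

(* Defs.v *)
From HB Require Import structures.
From mathcomp Require Import all_boot all_order all_algebra.
From mathcomp Require Import all_classical all_reals all_analysis.

Set Implicit Arguments.
Unset Strict Implicit.
Unset Printing Implicit Defensive.

Import Order.TTheory GRing.Theory Num.Theory.
Import numFieldNormedType.Exports.

Local Open Scope classical_set_scope.
Local Open Scope ring_scope.

Section exponential_family.
Context {R : realType} (F0 : probability (measurableTypeR R) R).

Definition mgf (theta : R) : \bar R :=
  mmt_gen_fun F0 (idfun : measurableTypeR R -> R) theta.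

Definition Theta : set R := [set theta | (mgf theta < +oo)%E].

(* Meaningful on Theta only. *)
Definition psi (theta : R) : R := ln (fine (mgf theta)).

Definition Fexp (theta : R) (A : set (measurableTypeR R)) : \bar R :=
  (\int[F0]_(x in A) (expR (theta * x - psi theta))%:E)%E.

(* psi is finite on Theta only, so its derivative at theta is taken relative to
   Theta: the ordinary derivative in the interior of Theta, and the one-sided
   derivative at an endpoint that belongs to Theta. *)
Definition psi_quotient (theta eta : R) : R :=
  (psi eta - psi theta) / (eta - theta).

Definition psi_derivable (theta : R) : Prop :=
  cvg (psi_quotient theta eta @[eta --> within Theta theta^']).

Definition mean (theta : R) : R :=
  lim (psi_quotient theta eta @[eta --> within Theta theta^']).

Definition rate (nu : R) : \bar R :=
  ereal_sup [set (theta * nu - psi theta)%:E | theta in Theta].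

Section curves.
Variable J : R -> R.
Local Open Scope ereal_scope.

(* The value of gR may be +oo, in which case that of fR is -oo; likewise for gH and fH. *)
Definition gR (nu a : R) : \bar R := a%:E * rate nu + (J a)%:E.

Definition fR (theta nu a : R) : \bar R :=
  (a * (theta * nu - psi theta))%:E + (2^-1)%:E * (1 - gR nu a).

Definition gH (nu a : R) : \bar R := a%:E * rate nu + (2 * J a)%:E.

Definition fH (theta nu a : R) : \bar R :=
  (a * (theta * nu - psi theta))%:E + (2^-1)%:E * (1 - gH nu a).

(* The two curves are suprema in \bar R, hence the maxima whenever these are
   attained, and defined also when they are not. *)
Definition bB (theta : R) : \bar R :=
  ereal_sup [set fH theta z.1 z.2 |
             z in [set z : R * R | (0 < z.2)%R /\ z.2%:E * rate z.1 = 1]].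

Definition bR (theta : R) : \bar R :=
  ereal_sup [set fR theta z.1 z.2 |
             z in [set z : R * R | (0 < z.2)%R /\ gR z.1 z.2 = 1]].

(* If F0 has an atom at the end x of its support lying on the side of theta,
   then rate jumps from rate x < +oo to +oo and the curve a * rate nu = 1 stops
   at a = (rate x)^-1, whereas randomized p-values of order 1/n occur there also
   for smaller a. Such a are irrelevant for the Bonferroni test as long as
   a |-> a * (theta * x - psi theta) - J a has not passed its maximum at the
   point where the curve stops. This is expressed by the following condition. It
   holds in particular if a0 * rate nu = 1 for some nu on that side of
   mean theta, as derive1 J a0 = 0 (for instance when F0 has no atom at that end). *)
Definition curve_reaches_peak (theta : R) : Prop :=
  exists nu a : R, [/\ (0 < a)%R, a%:E * rate nu = 1,
    (0 <= theta * (nu - mean theta))%R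
    & (derive1 J a <= theta * nu - psi theta)%R].

End curves.

End exponential_family.

Section sample_sizes.
Context {R : realType} (a0 : R) (J : R -> R).

(* J is a function on [0, +oo[: its values at negative arguments play no role,
   and as a0 > 0 the derivatives below do not involve them. *)
Definition J_flat : Prop :=
  0 < a0 /\ {in `[0, a0], forall a, J a = 0}.

Definition J_convex : Prop :=
  [/\ {in `[a0, +oo[, forall a, derivable J a 1},
      {within `[a0, +oo[, continuous (derive1 J)},
      {in `[a0, +oo[ &, {homo derive1 J : a b / a < b}},
      derive1 J a0 = 0
    & derive1 J a @[a --> +oo] --> +oo].

(* alpha n k stands for alpha_kn. *)
Definition size_pmf (alpha : nat -> nat -> R) (n k : nat) : R :=
  alpha n k * n%:R `^ (- J (k%:R / ln n%:R)).

(* lne x = -oo for x <= 0, so that the convergence to 0 forces alpha_kn > 0 for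
   all k >= lambda_n when n is large. *)
Definition alpha_subexponential (alpha : nat -> nat -> R) : Prop :=
  (fun n => ereal_sup [set (`|lne (alpha n k)%:E| * (k%:R^-1)%:E)%E |
      k in [set k : nat | (0 < k)%N /\ a0 * ln n%:R <= k%:R]])
    @ \oo --> 0%E.

End sample_sizes.

Section convolution.
Context {R : realType}.
Local Open Scope ereal_scope.

Definition convolution (m1 m2 : set (measurableTypeR R) -> \bar R) :
    set (measurableTypeR R) -> \bar R :=
  pushforward (m1 \x m2)
    (fun z : measurableTypeR R * measurableTypeR R =>
       (z.1 + z.2)%R : measurableTypeR R).

Fixpoint convolution_pow (m : set (measurableTypeR R) -> \bar R) (k : nat) :
    set (measurableTypeR R) -> \bar R :=
  if k is k'.+1 then convolution m (convolution_pow m k')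
  else \d_(0%R : measurableTypeR R).

End convolution.

Section model.
Context {R : realType} (F0 : probability (measurableTypeR R) R) (theta : R).

Definition mixture (eps : R) (k : nat) (A : set (measurableTypeR R)) : \bar R :=
  ((1 - eps)%:E * convolution_pow F0 k A
   + eps%:E * convolution_pow (Fexp F0 theta) k A)%E.

(* The triples (K i, Y i, V i) are i.i.d., K i has mass function pmf, Y i has
   law mixture eps k given K i = k, and V i is uniform on [0, 1] and independent
   of (K i, Y i). The sets A i and B i range over a pi-system generating the
   Borel sets, so the product formula determines the joint law. *)
Definition sample (pmf : nat -> R) (eps : R) (n : nat) (d : measure_display)
    (Om : measurableType d) (P : probability Om R)
    (K : 'I_n -> Om -> nat) (Y V : 'I_n -> Om -> measurableTypeR R) : Prop :=
  [/\ forall i, measurable_fun [set: Om] (K i),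
      forall i, measurable_fun [set: Om] (Y i),
      forall i, measurable_fun [set: Om] (V i),
      forall i w, (0 < K i w)%N
    & forall (k : 'I_n -> nat) (A B : 'I_n -> set (measurableTypeR R)),
        (forall i, 0 < k i)%N ->
        (forall i, measurable (A i)) -> (forall i, measurable (B i)) ->
        P [set w | forall i, [/\ K i w = k i, A i (Y i w) & B i (V i w)]] =
        (\prod_(i < n) ((pmf (k i))%:E * mixture eps (k i) (A i)
                        * uniform_prob (@ltr01 R) (B i)))%E].

End model.

Section tests.
Context {R : realType} (F0 : probability (measurableTypeR R) R).

Definition upper_tail (k : nat) (y v : R) : R :=
  fine (convolution_pow F0 k `]y, +oo[) + v * fine (convolution_pow F0 k [set y]).

Definition pvalue (k : nat) (y v : R) : R :=
  2 * Num.min (upper_tail k y v) (1 - upper_tail k y v).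

Section statistics.
Variables (n : nat) (Om : Type) (K : 'I_n -> Om -> nat) (Y V : 'I_n -> Om -> R).

Definition pval (i : 'I_n) (w : Om) : R := pvalue (K i w) (Y i w) (V i w).

Definition size_rank (i : 'I_n) (w : Om) : nat := #|[set j | (K i w <= K j w)%N]%SET|.

Definition bonferroni (w : Om) : \bar R :=
  \big[Order.min/+oo%E]_(i < n) (pval i w)%:E.

Definition rank_adjusted (w : Om) : \bar R :=
  \big[Order.min/+oo%E]_(i < n) ((size_rank i w)%:R * pval i w)%:E.

End statistics.
End tests.

(* Risk of the tests that reject H0 for small values of the statistic T. *)
Definition risk {R : realType} (d : measure_display) (Om : measurableType d)
    (P0 P1 : probability Om R) (T : Om -> \bar R) : \bar R :=
  ereal_inf [set (P0 [set w | T w <= c%:E] + P1 [set w | c%:E < T w])%E |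
             c in [set: R]].

Section asymptotics.
Context {R : realType} (d : nat -> measure_display)
  (Om : forall n, measurableType (d n)) (P0 P1 : forall n, probability (Om n) R)
  (T : forall n, Om n -> \bar R).

Definition asymptotically_powerful : Prop :=
  (fun n => risk (P0 n) (P1 n) (@T n)) @ \oo --> 0%E.

Definition asymptotically_powerless : Prop :=
  (fun n => risk (P0 n) (P1 n) (@T n)) @ \oo --> 1%E.

End asymptotics.

(* Submission.v *)
Require Import Defs.
From HB Require Import structures.
From mathcomp Require Import all_boot all_order all_algebra.
From mathcomp Require Import all_classical all_reals all_analysis.
From mathcomp Require Import measurable_realfun ring lra.

(** Write L = ln n and a = k / L for a sample size k, and let I be the rate of
    F0 at nu. Sizes k occur n ^ (1 - J a) times, a fraction n ^ (- beta) of them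
    under the alternative. Both tests reject when the minimum of
    W i * p i is small, where the weight W i is a function of the sizes only: 1
    for the smallest p-value, the rank of K i for the rank adjustment. Given the
    sizes the observations are independent, so acceptance has probability a
    product over i, and everything is reduced to the probability that one
    p-value of a sample of size k falls below a threshold t. It lies between
    t / 2 and t under the null (lemmas null_pvalue_le and null_pvalue_ge).

    Lower side, for powerful tests. By Cramer's theorem (cramer) and a change of
    measure, the sum of an alternative sample of size k is close to k nu with
    probability about exp (- k (I - (theta nu - psi theta))), and its p-value is
    then at most about exp (- k I) (alt_pvalue_ge). When beta is below a
    transition curve there are nu and a for which such samples exist among the
    n observations and beat the threshold of the test (power_point_bonferroni,
    power_point_rank, near_hit). The null rejects rarely by a union bound; for
    the rank adjustment this costs the sum of the inverse ranks, which is
    harmonic and thus only logarithmic (rank_harmonic).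

    Upper side, for powerless tests. Holder's inequality (alt_pvalue_le) bounds
    the probability of a small p-value under the alternative by
    t ^ (1 - l) exp (k (l psi (theta / l) - psi theta)) for each l in ]0, 1].
    Minimizing over l is dual to the constraint that defines the transition
    curve: rate_dual turns a rate level s into a point nu beyond the mean, and
    bonferroni_exponent and rank_exponent conclude that, when beta is above the
    curve, for every a some l makes the expected number of detections of size
    a L smaller than a negative power of n. The acceptance probabilities under
    the two hypotheses then differ by o(1) (accept_compare) as long as the
    threshold is at most some c0, whereas a threshold above c0 rejects a true
    null with probability 1 - o(1) (risk_ge).

    For the rank adjustment the random ranks intervene. For power they are
    bounded above by Markov's inequality on the number of sizes at least k; for
    the converse they are bounded below by the number M of observations of the
    same size, whose power M ^ l is majorized by an affine function of M, so
    that only first moments are needed. *)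

Set Implicit Arguments.
Unset Strict Implicit.
Unset Printing Implicit Defensive.

Import Order.TTheory GRing.Theory Num.Theory.
Import numFieldNormedType.Exports.

Local Open Scope classical_set_scope.
Local Open Scope ring_scope.

(** * Convolution powers and densities *)

Lemma measurable_near (R : realType) (c r : R) :
  measurable [set x : measurableTypeR R | `|x - c| <= r].
Proof.
have -> : [set x : measurableTypeR R | (`|x - c| <= r)%R] =
    `[(c - r)%R, (c + r)%R]%classic.
  by apply/seteqP; split => x /=; rewrite in_itv/= ler_distl.
exact: measurable_itv.
Qed.

Section convolution_powers.
Context {R : realType}.
Local Notation mR := (measurableTypeR R).
Local Open Scope ereal_scope.

Lemma measurable_addR :
  measurable_fun setT (fun z : mR * mR => (z.1 + z.2)%R : mR).
Proof.
apply: (@measurable_realfun.measurable_funD _ (mR * mR)%type R).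
  exact: measurable_fst.
exact: measurable_snd.
Qed.

Section conv.
Variables m1 m2 : {finite_measure set mR -> \bar R}.

Let mconv0 : convolution m1 m2 set0 = 0.
Proof. by rewrite /convolution /pushforward preimage_set0 measure0. Qed.

Let mconv_ge0 A : 0 <= convolution m1 m2 A.
Proof. by rewrite /convolution /pushforward; exact: (measure_ge0 (m1 \x m2)). Qed.

Let mconv_sigma_additive : semi_sigma_additive (convolution m1 m2).
Proof.
move=> F mF tF mUF.
rewrite /convolution /pushforward preimage_bigcup.
apply: measure_semi_sigma_additive.
- move=> n; rewrite -[X in measurable X]setTI; exact: measurable_addR.
- apply/trivIsetP => /= i j _ _ ij; rewrite -preimage_setI.
  by move/trivIsetP : tF => /(_ _ _ _ _ ij) ->//; rewrite preimage_set0.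
- by rewrite -preimage_bigcup -[X in measurable X]setTI; exact: measurable_addR.
Qed.

HB.instance Definition _ := isMeasure.Build _ _ _ (convolution m1 m2)
  mconv0 mconv_ge0 mconv_sigma_additive.

Lemma convolution_setT : convolution m1 m2 setT = m1 setT * m2 setT.
Proof.
by rewrite /convolution /pushforward preimage_setT -setXTT product_measure1E.
Qed.

Let mconv_fin : fin_num_fun (convolution m1 m2).
Proof.
move=> A mA; rewrite ge0_fin_numE ?measure_ge0//.
apply: (@le_lt_trans _ _ (convolution m1 m2 setT)).
  by apply: le_measure; rewrite ?inE.
rewrite convolution_setT ltey_eq fin_numM//; exact: fin_num_measure.
Qed.

HB.instance Definition _ := Measure_isFinite.Build _ _ _ (convolution m1 m2)
  mconv_fin.

Lemma ge0_integral_convolution (f : mR -> \bar R) :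
  measurable_fun setT f -> (forall x, 0 <= f x) ->
  \int[convolution m1 m2]_z f z = \int[m1]_x \int[m2]_y f (x + y)%R.
Proof.
move=> mf f0.
rewrite (@ge0_integral_pushforward _ _ _ _ _ _ measurable_addR (m1 \x m2))//.
rewrite preimage_setT fubini_tonelli1//=.
by apply: measurableT_comp => //; exact: measurable_addR.
Qed.

End conv.

Let dirac0_fin : fin_num_fun (\d_(0%R : mR) : set mR -> \bar R).
Proof. by move=> A mA; rewrite diracE. Qed.

HB.instance Definition _ := Measure_isFinite.Build _ _ _
  (\d_(0%R : mR) : set mR -> \bar R) dirac0_fin.

(** The convolution powers as finite measures, and thus with an integral. *)
Fixpoint cpow (m : {finite_measure set mR -> \bar R}) (k : nat) :
    {finite_measure set mR -> \bar R} :=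
  if k is k'.+1 then convolution m (cpow m k')
  else (\d_(0%R : mR) : set mR -> \bar R).

Lemma cpowE (m : {finite_measure set mR -> \bar R}) k :
  convolution_pow m k = cpow m k.
Proof. by elim: k => [//|k IH] /=; rewrite IH. Qed.

Lemma measurable_expM (t c : R) :
  measurable_fun setT (fun x : mR => (expR (t * x - c))%:E).
Proof.
apply/measurable_EFinP; apply: measurableT_comp => //.
by apply: measurable_realfun.measurable_funD => //; exact: mulrl_measurable.
Qed.

(** Tonelli: the exponential of a sum is a product. *)
Lemma integral_expR_cpow (m : {finite_measure set mR -> \bar R}) (t z : R) k :
  \int[m]_x (expR (t * x))%:E = z%:E ->
  \int[cpow m k]_x (expR (t * x))%:E = (z ^+ k)%:E.
Proof.
move=> mz.
have mexp : measurable_fun setT (fun x : mR => (expR (t * x))%:E).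
  by have := @measurable_expM t 0%R; under eq_fun do rewrite subr0.
have z0 : (0 <= z)%R.
  by rewrite -lee_fin -mz; apply: integral_ge0 => x _; rewrite lee_fin expR_ge0.
elim: k => [|k IH] /=.
  by rewrite integral_dirac// diracT mul1e mulr0 expR0.
rewrite ge0_integral_convolution//.
under eq_integral => x _.
  under eq_integral do rewrite mulrDr expRD EFinM.
  rewrite ge0_integralZl// ?lee_fin ?expR_ge0//.
  rewrite IH; over.
rewrite ge0_integralZr// ?lee_fin ?exprn_ge0//.
by rewrite mz -EFinM exprS.
Qed.

Lemma le_cpow (m m' : {finite_measure set mR -> \bar R}) k :
  (forall A, measurable A -> m A <= m' A) ->
  forall A, measurable A -> cpow m k A <= cpow m' k A.
Proof.
move=> mm'; elim: k => [//|k IH] A mA /=.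
rewrite /convolution /pushforward.
set B := _ @^-1` A.
have mB : measurable B.
  by rewrite -[X in measurable X]setTI; exact: measurable_addR.
apply: (@le_trans _ _ ((m \x cpow m' k) B)).
  apply: ge0_le_integral => //=.
  - exact: measurable_fun_xsection.
  - exact: measurable_fun_xsection.
  - by move=> x _; apply: IH; exact: measurable_xsection.
apply: ge0_le_measure_integral => //=.
exact: measurable_fun_xsection.
Qed.

(** A sum of k terms that all lie within d of nu lies within k d of k nu. *)
Lemma cpow_near (m : {finite_measure set mR -> \bar R}) (nu d : R) k :
  (m [set x : mR | `|x - nu| <= d]%R) ^+ k <=
  cpow m k [set x : mR | `|x - k%:R * nu| <= k%:R * d]%R.
Proof.
have mnear := @measurable_near R.
elim: k => [|k IH].
  by rewrite /= diracE mem_set//= sub0r mul0r oppr0 normr0 mul0r.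
rewrite expeS /= /convolution /pushforward.
set B := _ @^-1` _.
have mB : measurable B.
  by rewrite -[X in measurable X]setTI; exact: measurable_addR.
apply: (@le_trans _ _ ((m \x cpow m k) ([set x : mR | (`|x - nu| <= d)%R] `*`
    [set x : mR | (`|x - k%:R * nu| <= k%:R * d)%R]))).
  by rewrite product_measure1E//; apply: lee_pmul => //; exact: expe_ge0.
apply: le_measure; rewrite ?inE//.
  exact: measurableX.
move=> [x y] [/= hx hy]; rewrite /B/=.
rewrite (_ : (x + y - k.+1%:R * nu = (x - nu) + (y - k%:R * nu))%R); last first.
  by rewrite -[k.+1%:R]natr1; ring.
apply: (le_trans (ler_normD _ _)).
by rewrite -[k.+1%:R]natr1 mulrDl mul1r addrC lerD.
Qed.

End convolution_powers.

Section density.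
Context {R : realType}.
Local Notation mR := (measurableTypeR R).
Local Open Scope ereal_scope.
Variables (m : {measure set mR -> \bar R}) (g : mR -> R).
Hypotheses (mg : measurable_fun setT g) (g0 : forall x, (0 <= g x)%R).

Definition weighted (A : set mR) : \bar R := \int[m]_(x in A) (g x)%:E.

Let mgE A : measurable_fun A (fun x => (g x)%:E).
Proof. by apply/measurable_EFinP; exact: measurable_funTS. Qed.

Let weighted0 : weighted set0 = 0.
Proof. by rewrite /weighted integral_set0. Qed.

Let weighted_ge0 A : 0 <= weighted A.
Proof. by apply: integral_ge0 => x _; rewrite lee_fin. Qed.

Let weighted_sigma_additive : semi_sigma_additive weighted.
Proof.
move=> /= F mF tF mUF; rewrite /weighted; apply: cvg_toP.
  apply: ereal_nondecreasing_is_cvgn => i j ij.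
  by apply: lee_sum_nneg_natr => // k _ _; exact: weighted_ge0.
by rewrite ge0_integral_bigcup//= => x _; rewrite lee_fin.
Qed.

HB.instance Definition _ := isMeasure.Build _ _ _ weighted
  weighted0 weighted_ge0 weighted_sigma_additive.

Definition weighted_measure : {measure set mR -> \bar R} := weighted.

Import HBNNSimple.

Let integral_weighted_nnsfun (f : {nnsfun mR >-> R}) :
  \int[weighted]_x (f x)%:E = \int[m]_x ((f x)%:E * (g x)%:E).
Proof.
under [LHS]eq_integral do rewrite fimfunE -fsumEFin//.
rewrite [LHS]ge0_integral_fsum//; last 2 first.
  - by move=> r; exact/measurable_EFinP/measurableT_comp.
  - by move=> n x _; rewrite EFinM nnfun_muleindic_ge0.
under [RHS]eq_integral.
  move=> x xD; rewrite fimfunE -fsumEFin// ge0_mule_fsuml; last first.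
    by move=> r; rewrite EFinM nnfun_muleindic_ge0.
  over.
rewrite [RHS]ge0_integral_fsum//; last 2 first.
  - move=> r; apply: emeasurable_funM => //.
    by apply/measurable_EFinP; do 2 apply/measurableT_comp => //.
  - move=> n x _; rewrite EFinM mule_ge0//; last by rewrite lee_fin.
    by rewrite nnfun_muleindic_ge0.
apply: eq_fsbigr => r _.
rewrite integralZl_indic_nnsfun//= integral_indic//= setIT /weighted.
rewrite [in LHS]integral_mkcond/=.
have [rf|rf] := boolP (r \in range f); last first.
  have -> : f @^-1` [set r] = set0.
    rewrite -subset0 => x /= fx; apply: (negP rf); rewrite inE/=.
    by exists x.
  rewrite integral0_eq; last by move=> x _; rewrite patchE in_set0.
  rewrite mule0 integral0_eq// => x _.
  by rewrite indicE in_set0 mulr0 mul0e.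
have r0 : (0 <= r)%R by move: rf; rewrite inE => -[x _ <-].
rewrite -ge0_integralZl//.
- apply: eq_integral => x _; rewrite patchE indicE; case: ifPn => _.
    by rewrite mulr1.
  by rewrite mulr0 mul0e mule0.
- by apply/(measurable_restrictT _ _).1 => //; exact: mgE.
- by move=> x _; rewrite patchE; case: ifP => //; rewrite lee_fin.
Qed.

(** Simple functions first, then monotone convergence along their approximations. *)
Lemma integral_weighted (f : mR -> \bar R) :
  measurable_fun setT f -> (forall x, 0 <= f x) ->
  \int[weighted]_x f x = \int[m]_x (f x * (g x)%:E).
Proof.
move=> mf f0.
pose f_ := nnsfun_approx measurableT mf.
transitivity (lim (\int[weighted]_x (f_ n x)%:E @[n --> \oo])).
  rewrite -monotone_convergence//=.
  - apply: eq_integral => ? /[!inE] xD; apply/esym/cvg_lim => //=.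
    exact: cvg_nnsfun_approx.
  - by move=> n; exact/measurable_EFinP/measurable_funTS.
  - by move=> n ? _; rewrite lee_fin.
  - by move=> ? _ ? ? mn; rewrite lee_fin; exact/lefP/nd_nnsfun_approx.
transitivity (lim (\int[m]_x ((f_ n x)%:E * (g x)%:E) @[n --> \oo])).
  by apply: congr_lim; apply/funext => n /=; exact: integral_weighted_nnsfun.
rewrite -monotone_convergence//=.
- apply: eq_integral => x _; apply/cvg_lim => //.
  apply: cvgeZr => //; exact: cvg_nnsfun_approx.
- move=> n; apply: emeasurable_funM => //.
  exact/measurable_EFinP/measurable_funTS.
- by move=> n ? _; rewrite mule_ge0// lee_fin.
- move=> x _ ? ? mn; apply: lee_wpmul2r; rewrite ?lee_fin//.
  exact/lefP/nd_nnsfun_approx.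
Qed.

End density.

(** * The cumulant function and exponential tilting *)

(** The tangent line of the exponential at the intermediate point lies below
    its graph at both end points. *)
Lemma expR_conv (R : realType) (l u v : R) : 0 <= l <= 1 ->
  expR (l * u + (1 - l) * v) <= l * expR u + (1 - l) * expR v.
Proof.
move=> /andP[l0 l1]; set c := l * u + _.
have tangent x : expR c * (1 + (x - c)) <= expR x.
  rewrite -[leRHS](_ : expR c * expR (x - c) = _).
    by rewrite ler_pM2l ?expR_gt0// expR_ge1Dx.
  by rewrite -expRD addrC subrK.
apply: (@le_trans _ _
    (l * (expR c * (1 + (u - c))) + (1 - l) * (expR c * (1 + (v - c))))).
  by rewrite le_eqVlt; apply/orP; left; apply/eqP; rewrite /c; ring.
by apply: lerD; apply: ler_wpM2l => //; rewrite subr_ge0.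
Qed.

Section cumulant.
Context {R : realType} (F0 : probability (measurableTypeR R) R).
Local Notation mR := (measurableTypeR R).
Local Notation psi := (psi F0).
Local Notation Theta := (Theta F0).

Lemma mgfE t : mgf F0 t = (\int[F0]_x (expR (t * x))%:E)%E.
Proof.
rewrite /mgf /mmt_gen_fun unlock; apply: eq_integral => x _ /=.
by rewrite mulrC.
Qed.

Let mexp t : measurable_fun setT (fun x : mR => (expR (t * x))%:E).
Proof. by have := @measurable_expM R t 0; under eq_fun do rewrite subr0. Qed.

Lemma integral_expR_gt0 (m : {measure set mR -> \bar R}) t :
  (0 < m setT)%E -> (0 < \int[m]_x (expR (t * x))%:E)%E.
Proof.
move=> m0; rewrite lt0e; apply/andP; split; last first.
  by apply: integral_ge0 => x _; rewrite lee_fin expR_ge0.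
apply/eqP => I0; move: m0; rewrite lt_neqAle => /andP[/eqP + _]; apply.
have : (\int[m]_x `|(expR (t * x))%:E| = 0)%E.
  by rewrite -I0; apply: eq_integral => x _; rewrite gee0_abs// lee_fin expR_ge0.
move/(ae_eq_integral_abs _ measurableT (mexp t)).1 => [N [mN N0 sN]].
apply/esym/eqP; rewrite -measure_le0 -N0 le_measure ?inE//.
apply: subset_trans sN => x _ /=; apply/not_implyP; split => //.
by move=> /eqP; rewrite eqe gt_eqF// expR_gt0.
Qed.

Lemma integral_expR t : Theta t ->
  (\int[F0]_x (expR (t * x))%:E = (expR (psi t))%:E)%E.
Proof.
rewrite /Defs.Theta /Defs.psi/= mgfE => fi.
have I0 : (0 < \int[F0]_x (expR (t * x))%:E)%E.
  apply: integral_expR_gt0; rewrite [X in (_ < X)%E](@probability_setT _ _ _ F0).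
  by [].
have fin : (\int[F0]_x (expR (t * x))%:E)%E \is a fin_num.
  by rewrite ge0_fin_numE// ltW.
by rewrite lnK ?fineK// posrE fine_gt0// I0 fi.
Qed.

(** Used for integrals that are not known to be finite beforehand: one upper
    bound places the parameter in Theta and controls psi there. *)
Lemma Theta_psi_le t c : (\int[F0]_x (expR (t * x))%:E <= (expR c)%:E)%E ->
  Theta t /\ psi t <= c.
Proof.
move=> le_c; have Tt : Theta t by rewrite /Defs.Theta/= mgfE (le_lt_trans le_c)// ltry.
by split => //; move: le_c; rewrite integral_expR// lee_fin ler_expR.
Qed.

Lemma integral_expR0 : (\int[F0]_x (expR (0 * x))%:E = 1)%E.
Proof.
under eq_integral do rewrite mul0r expR0.
rewrite integral_cst// mul1e; exact: probability_setT.
Qed.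

Lemma Theta0 : Theta 0.
Proof.
by have [] := @Theta_psi_le 0 0; rewrite ?integral_expR0 ?expR0.
Qed.

Lemma psi0 : psi 0 = 0.
Proof. by rewrite /Defs.psi mgfE integral_expR0 ln1. Qed.

(** Pointwise convexity of the exponential, applied to the densities normalized
    by psi and then integrated; this is the proof of the inequality of Holder in
    the case at hand. *)
Lemma psi_convex l s t : 0 <= l <= 1 -> Theta s -> Theta t ->
  Theta (l * s + (1 - l) * t) /\
  psi (l * s + (1 - l) * t) <= l * psi s + (1 - l) * psi t.
Proof.
move=> l01 Ts Tt; apply: Theta_psi_le.
set c := l * psi s + (1 - l) * psi t.
pose h (x : mR) := (l * expR (s * x - psi s) + (1 - l) * expR (t * x - psi t)).
have [l0 l1] := andP l01.
have Texp u : Theta u -> (\int[F0]_x (expR (u * x - psi u))%:E = 1)%E.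
  move=> Tu; under eq_integral do rewrite expRB mulrC EFinM.
  rewrite ge0_integralZl//= ?lee_fin ?invr_ge0 ?expR_ge0//.
  by rewrite integral_expR// -EFinM mulVf// gt_eqF// expR_gt0.
have intE a u : 0 <= a -> Theta u ->
    (\int[F0]_x (a * expR (u * x - psi u))%:E = a%:E)%E.
  move=> a_ge0 Tu; under eq_integral do rewrite EFinM.
  by rewrite ge0_integralZl ?lee_fin//; [rewrite Texp// mule1|exact: measurable_expM].
have ml a u : measurable_fun setT (fun x : mR => (a * expR (u * x - psi u))%:E).
  apply/measurable_EFinP; apply: measurable_realfun.measurable_funM => //.
  by apply/measurable_EFinP; exact: measurable_expM.
have mh : measurable_fun setT (fun x : mR => (h x)%:E).
  by apply/measurable_EFinP; apply: measurable_realfun.measurable_funD;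
    apply/measurable_EFinP; exact: ml.
have h0 x : (0 <= (h x)%:E)%E.
  by rewrite lee_fin addr_ge0// mulr_ge0// ?expR_ge0// subr_ge0.
apply: (@le_trans _ _ (\int[F0]_x ((expR c)%:E * (h x)%:E))%E).
  apply: ge0_le_integral => //=.
  - by apply: emeasurable_funM.
  - move=> x _; rewrite -EFinM lee_fin.
    rewrite [leLHS](_ : _ = expR c * expR (l * (s * x - psi s) +
        (1 - l) * (t * x - psi t))); last by rewrite -expRD /c; congr expR; ring.
    by rewrite ler_pM2l ?expR_gt0// expR_conv.
rewrite ge0_integralZl ?lee_fin ?expR_ge0//.
under [X in (_ * X)%E]eq_integral do rewrite EFinD.
rewrite ge0_integralD//=; try by move=> *; rewrite lee_fin mulr_ge0// ?expR_ge0// subr_ge0.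
have total (x y : \bar R) : x = l%:E -> y = (1 - l)%:E -> ((expR c)%:E * (x + y) <= (expR c)%:E)%E.
  by move=> -> ->; rewrite -EFinD addrC subrK mule1.
by apply: total; apply: intE; rewrite ?subr_ge0.
Qed.

Lemma integral_expR_cpowF0 t k : Theta t ->
  (\int[cpow F0 k]_x (expR (t * x))%:E = (expR (k%:R * psi t))%:E)%E.
Proof.
move=> Tt; rewrite (integral_expR_cpow _ (integral_expR Tt)).
by rewrite -expRM_natl mulr_natl.
Qed.

Section tilted.
Variable theta : R.
Hypothesis Ttheta : Theta theta.

Let g (x : mR) := expR (theta * x - psi theta).

Let mg : measurable_fun setT g.
Proof. by apply/measurable_EFinP; exact: measurable_expM. Qed.

Let g_ge0 x : 0 <= g x. Proof. exact: expR_ge0. Qed.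

Let Fm := weighted_measure F0 mg g_ge0.

Let Fm1 : Fm setT = 1%E.
Proof.
rewrite /Fm /weighted_measure /= /weighted /g.
under eq_integral do rewrite expRB mulrC EFinM.
rewrite ge0_integralZl//= ?lee_fin ?invr_ge0 ?expR_ge0//.
by rewrite integral_expR// -EFinM mulVf// gt_eqF// expR_gt0.
Qed.

Let Fm_prob := Measure_isProbability.Build _ _ _ Fm Fm1.

Definition Fexp_prob : probability mR R :=
  HB.pack (Measure.sort Fm) (Measure.class Fm) Fm_prob.

Lemma Fexp_probE : Fexp F0 theta = Fexp_prob.
Proof. by []. Qed.

(** The tilting density is multiplicative along sums, hence tilting commutes
    with convolution. *)
Lemma cpow_Fexp k (A : set mR) : measurable A ->
  (cpow Fexp_prob k A =
   \int[cpow F0 k]_(s in A) (expR (theta * s - k%:R * psi theta))%:E)%E.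
Proof.
elim: k A => [|k IH] A mA.
  rewrite [RHS]integral_mkcond /= integral_dirac//=; last first.
    by apply/(measurable_restrictT _ _).1 => //; apply: measurable_funTS; exact: measurable_expM.
  rewrite diracT mul1e patchE diracE; case: ifPn => // _.
  by rewrite mulr0 mul0r subr0 expR0.
have mgk : measurable_fun setT
    ((fun s : mR => (expR (theta * s - k.+1%:R * psi theta))%:E) \_ A).
  by apply/(measurable_restrictT _ _).1 => //; apply: measurable_funTS; exact: measurable_expM.
rewrite [RHS]integral_mkcond /= ge0_integral_convolution//; last first.
  by move=> x; rewrite patchE; case: ifP => //; rewrite lee_fin expR_ge0.
rewrite /convolution /pushforward.
set B := _ @^-1` A.
have mB : measurable B.
  by rewrite -[X in measurable X]setTI; exact: measurable_addR.
rewrite [LHS]/product_measure1 [LHS]integral_weighted//=; last first.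
  exact: measurable_fun_xsection.
apply: eq_integral => x _.
have mBx : measurable (xsection B x : set mR) by exact: measurable_xsection.
have mexpB : measurable_fun (xsection B x : set mR)
    (fun s : mR => (expR (theta * s - k%:R * psi theta))%:E).
  by apply: measurable_funTS; exact: measurable_expM.
rewrite IH// muleC -ge0_integralZl ?lee_fin ?expR_ge0//=.
rewrite integral_mkcond; apply: eq_integral => y _.
rewrite !patchE mem_xsection (_ : ((x, y) \in B) = (x + y \in A)); last first.
  by apply/idP/idP; rewrite !inE.
case: ifP => // _; rewrite -EFinM /g -expRD; congr (expR _)%:E.
by rewrite -[k.+1%:R]natr1; ring.
Qed.

End tilted.
End cumulant.

(** * Cramer's lower bound *)

Lemma integral_mrestr (R : realType) (m : {measure set (measurableTypeR R) -> \bar R})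
    (D : set (measurableTypeR R)) (mD : measurable D)
    (f : measurableTypeR R -> \bar R) :
  measurable_fun setT f -> (forall x, 0 <= f x)%E ->
  (\int[mrestr m mD]_x f x = \int[m]_(x in D) f x)%E.
Proof.
move=> mf f0.
have mI : measurable_fun setT (\1_D : measurableTypeR R -> R).
  exact: measurable_indic.
have I0 x : 0 <= (\1_D : measurableTypeR R -> R) x by rewrite indicE.
rewrite (@eq_measure_integral _ _ _ setT (weighted_measure m mI I0)); last first.
  move=> A mA _ /=; rewrite /weighted integral_indic// /mrestr.
  by rewrite setIC.
rewrite integral_weighted// [RHS]integral_mkcond; apply: eq_integral => x _.
by rewrite patchE indicE; case: ifP => _; rewrite ?mule1 ?mule0.
Qed.

Section cramer.
Context {R : realType}.
Local Notation mR := (measurableTypeR R).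

(** Off the window around k nu, exp (t x) is dominated by the sum of
    exp ((t + h) x) and exp ((t - h) x), both damped by exp (- h k d) relative to
    their size at k nu. Integrating this leaves a lower bound on the mass of the
    window. The function z is the moment generating function recentred at nu. *)
Lemma cpow_near_ge (m : {finite_measure set mR -> \bar R}) (z : R -> R)
    (nu t h d : R) k :
  (forall s, \int[m]_x (expR (s * x))%:E = (expR (s * nu) * z s)%:E)%E ->
  0 <= h ->
  ((expR (- (k%:R * (`|t| * d))) *
    (z t ^+ k - expR (- (h * d)) ^+ k * (z (t + h) ^+ k + z (t - h) ^+ k)))%:E
   <= cpow m k [set x : mR | (`|x - k%:R * nu| <= k%:R * d)%R])%E.
Proof.
move=> zE h0; set B := [set x : mR | _].
have mB : measurable B by exact: measurable_near.
have fB : cpow m k B \is a fin_num by exact: fin_num_measure.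
have mexp s : measurable_fun setT (fun x : mR => (expR (s * x))%:E).
  by have := @measurable_expM R s 0; under eq_fun do rewrite subr0.
(* c1 is the maximum of exp (t x) on the window; c2 and c3 normalize the two
   dominating exponentials at the ends of the window *)
pose c1 := expR (k%:R * (t * nu) + k%:R * (`|t| * d)).
pose c2 := expR (- (k%:R * (h * d) + k%:R * (h * nu))).
pose c3 := expR (- (k%:R * (h * d) - k%:R * (h * nu))).
have pw (x : mR) : expR (t * x) <=
    c1 * \1_B x + (c2 * expR ((t + h) * x) + c3 * expR ((t - h) * x)).
  have c2e : c2 * expR ((t + h) * x) = expR (t * x) *
      expR (h * (x - k%:R * nu - k%:R * d)).
    by rewrite /c2 -!expRD; congr expR; ring.
  have c3e : c3 * expR ((t - h) * x) = expR (t * x) *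
      expR (h * (- (x - k%:R * nu) - k%:R * d)).
    by rewrite /c3 -!expRD; congr expR; ring.
  rewrite c2e c3e; have [xB|xB] := boolP (x \in B).
    rewrite indicE xB mulr1 -[leLHS]addr0; apply: lerD; last first.
      by rewrite addr_ge0// mulr_ge0 ?expR_ge0.
    rewrite ler_expR -[leLHS](subrK (t * (k%:R * nu))) [leRHS]addrC.
    apply: lerD; last by rewrite mulrCA.
    rewrite -mulrBr (le_trans (ler_norm _))// normrM mulrCA ler_wpM2l//.
    by move: xB; rewrite inE.
  rewrite indicE (negbTE xB) mulr0 add0r -mulrDr ler_peMr ?expR_ge0//.
  move: xB; rewrite notin_setE/= => /negP; rewrite -ltNge => xB.
  have [yd|yd] := lerP (k%:R * d) (x - k%:R * nu).
    rewrite -[leLHS]addr0 lerD ?expR_ge0//.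
    by rewrite (le_trans _ (expR_ge1Dx _))// lerDl mulr_ge0// subr_ge0.
  rewrite -[leLHS]add0r lerD ?expR_ge0//.
  rewrite (le_trans _ (expR_ge1Dx _))// lerDl mulr_ge0// subr_ge0.
  move: xB; rewrite ltr_normr => /orP[xB|/ltW//].
  by have := lt_trans xB yd; rewrite ltxx.
have key : ((expR (k%:R * (t * nu)) * z t ^+ k)%:E <= c1%:E * cpow m k B +
    (c2%:E * (expR (k%:R * ((t + h) * nu)) * z (t + h) ^+ k)%:E +
     c3%:E * (expR (k%:R * ((t - h) * nu)) * z (t - h) ^+ k)%:E))%E.
  have intE s : (\int[cpow m k]_x (expR (s * x))%:E =
      (expR (k%:R * (s * nu)) * z s ^+ k)%:E)%E.
    rewrite (integral_expR_cpow _ (zE s)) exprMn -expRM_natl mulr_natl.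
    by congr (expR _ * _)%:E; rewrite mulr_natl.
  rewrite -!intE -(setIT B) -(integral_indic (cpow m k) measurableT mB).
  rewrite -!ge0_integralZl ?lee_fin ?expR_ge0//; last first.
    by apply/measurable_EFinP; exact: measurable_indic.
  rewrite -ge0_integralD//; last 4 first.
  all: try by move=> x _; rewrite -EFinM lee_fin mulr_ge0 ?expR_ge0.
  all: try by apply: emeasurable_funM.
  rewrite -ge0_integralD//; last 4 first.
  all: try by move=> x _; rewrite -?EFinM -?EFinD lee_fin ?addr_ge0// mulr_ge0 ?expR_ge0 ?indicE.
  all: try by do ?apply: emeasurable_funD; apply: emeasurable_funM => //;
    apply/measurable_EFinP; exact: measurable_indic.
  apply: ge0_le_integral => //=.
  - by apply: emeasurable_funD; [apply: emeasurable_funM => //;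
    apply/measurable_EFinP; exact: measurable_indic|
    apply: emeasurable_funD; apply: emeasurable_funM].
  - by move=> x _; rewrite -!EFinM -!EFinD lee_fin.
rewrite -(fineK fB) in key *; move: key; rewrite -!EFinM -!EFinD !lee_fin.
set p := fine _ => key.
rewrite [expR (- (k%:R * _))]expRN [leLHS]mulrC ler_pdivrMr ?expR_gt0// [leRHS]mulrC.
rewrite -(@ler_pM2l _ (expR (k%:R * (t * nu)))) ?expR_gt0//.
rewrite [leRHS]mulrA -expRD -/c1 mulrBr lerBlDr (le_trans key)// lerD2l.
rewrite le_eqVlt; apply/orP; left; apply/eqP.
have ek x : expR x ^+ k = expR (k%:R * x) by rewrite -expRM_natl mulr_natl.
have e1 : c2 * (expR (k%:R * ((t + h) * nu)) * z (t + h) ^+ k) =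
  expR (k%:R * (t * nu)) * (expR (- (h * d)) ^+ k * z (t + h) ^+ k).
  by rewrite ek mulrA -expRD [RHS]mulrA -expRD; congr (expR _ * _); ring.
have e2 : c3 * (expR (k%:R * ((t - h) * nu)) * z (t - h) ^+ k) =
  expR (k%:R * (t * nu)) * (expR (- (h * d)) ^+ k * z (t - h) ^+ k).
  by rewrite ek mulrA -expRD [RHS]mulrA -expRD; congr (expR _ * _); ring.
by rewrite e1 e2; ring.
Qed.

End cramer.

Section rate_function.
Context {R : realType} (F0 : probability (measurableTypeR R) R).

Lemma rate_ge (s nu : R) : Theta F0 s ->
  ((s * nu - psi F0 s)%:E <= rate F0 nu)%E.
Proof. by move=> Ts; apply: ereal_sup_ubound; exists s. Qed.

Lemma rate_ge0 (nu : R) : (0 <= rate F0 nu)%E.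
Proof.
by apply: le_trans (rate_ge nu (Theta0 F0)); rewrite psi0 mul0r subr0.
Qed.

Lemma rate_le (nu c : R) : (forall s, Theta F0 s -> s * nu - psi F0 s <= c) ->
  (rate F0 nu <= c%:E)%E.
Proof. by move=> H; apply: ge_ereal_sup => _ [s Ts <-]; rewrite lee_fin H. Qed.

Lemma rate_gt (nu c : R) : (c%:E < rate F0 nu)%E ->
  exists2 s, Theta F0 s & c < s * nu - psi F0 s.
Proof. by move=> /ereal_sup_gt[_ [s Ts <-]]; rewrite lte_fin; exists s. Qed.

End rate_function.

Section truncated_mgf.
Context {R : realType} (F0 : probability (measurableTypeR R) R) (nu : R).
Local Notation mR := (measurableTypeR R).
Local Notation B M := [set x : mR | `|x - nu| <= M].

(** Moment generating function about nu of the restriction of F0 to a ball. It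
    is finite for every s, whatever Theta is. *)
Definition tmgf (M s : R) : R :=
  fine (\int[F0]_(x in B M) (expR (s * (x - nu)))%:E).

Let mB (M : R) : measurable (B M). Proof. exact: measurable_near. Qed.

Let mexp D s : measurable_fun D (fun x : mR => (expR (s * (x - nu)))%:E).
Proof.
apply: measurable_funTS; have := @measurable_expM R s (s * nu).
by under eq_fun do rewrite -mulrBr.
Qed.

Let expR_bound (M s : R) (x : mR) : B M x -> s * (x - nu) <= `|s| * M.
Proof. by move=> /= xM; rewrite (le_trans (ler_norm _))// normrM ler_wpM2l. Qed.

Lemma tmgfE M s :
  (\int[F0]_(x in B M) (expR (s * (x - nu)))%:E = (tmgf M s)%:E)%E.
Proof.
rewrite /tmgf fineK// ge0_fin_numE; last first.
  by apply: integral_ge0 => x _; rewrite lee_fin expR_ge0.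
apply: (@le_lt_trans _ _ (\int[F0]_(x in B M) (cst (expR (`|s| * M))%:E) x)%E).
  apply: ge0_le_integral => //.
  by move=> x xM; rewrite lee_fin ler_expR; exact: expR_bound.
rewrite integral_cst// lte_mul_pinfty ?lee_fin ?expR_ge0//.
by rewrite -ge0_fin_numE// fin_num_measure.
Qed.

Lemma tmgf_trunc M s :
  (\int[mrestr F0 (mB M)]_x (expR (s * x))%:E = (expR (s * nu) * tmgf M s)%:E)%E.
Proof.
have m0 : measurable_fun setT (fun x : mR => (expR (s * x))%:E).
  by have := @measurable_expM R s 0; under eq_fun do rewrite subr0.
rewrite integral_mrestr// EFinM -tmgfE -ge0_integralZl ?lee_fin ?expR_ge0//.
apply: eq_integral => x _; rewrite -EFinM -expRD; congr (expR _)%:E.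
by rewrite mulrBr addrC subrK.
Qed.

Lemma tmgf_ge0 M s : 0 <= tmgf M s.
Proof. by apply: fine_ge0; apply: integral_ge0 => x _; rewrite lee_fin expR_ge0. Qed.

Lemma tmgf_le1 M : tmgf M 0 <= 1.
Proof.
rewrite -lee_fin -tmgfE; under eq_integral do rewrite mul0r expR0.
rewrite integral_cst// mul1e; exact: probability_le1.
Qed.

(** On the ball of radius M the exponents s (x - nu) and s' (x - nu) differ by
    at most M times the distance from s to s'. *)
Lemma tmgf_lip M s s' : expR (- (`|s - s'| * M)) * tmgf M s' <= tmgf M s.
Proof.
rewrite -lee_fin EFinM -!tmgfE -ge0_integralZl ?lee_fin ?expR_ge0//.
apply: ge0_le_integral => //.
- by apply: emeasurable_funM.
- move=> x xM; rewrite -EFinM -expRD lee_fin ler_expR.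
  rewrite -[leRHS](subrK (s' * (x - nu))) lerD2r -mulrBl lerNl -mulNr.
  by rewrite -[`|s - s'|]normrN; exact: expR_bound.
Qed.

Lemma le_tmgf M M' s : M <= M' -> tmgf M s <= tmgf M' s.
Proof.
move=> MM'; rewrite -lee_fin -!tmgfE; apply: ge0_subset_integral => //.
by move=> x /= /le_trans; apply.
Qed.

(** It makes tmgf grow at both ends of the line as soon as F0 charges both sides
    of nu. *)
Lemma tmgf_mass (M s c : R) (D : set mR) : measurable D -> D `<=` B M ->
  (forall x, D x -> c <= s * (x - nu)) -> fine (F0 D) * expR c <= tmgf M s.
Proof.
move=> mD DM cD; rewrite -lee_fin EFinM fineK ?fin_num_measure// muleC.
rewrite -tmgfE -integral_cst//.
apply: (@le_trans _ _ (\int[F0]_(x in D) (expR (s * (x - nu)))%:E)%E).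
  apply: ge0_le_integral => //.
  - by move=> x _; rewrite lee_fin expR_ge0.
  - by move=> x Dx; rewrite lee_fin ler_expR cD.
by apply: ge0_subset_integral.
Qed.

(** The bound cosh u <= 1 + 2 u ^ 2 for small u, with u = h (x - nu). Near a
    minimizer of tmgf it forces the values at s + h and s - h to be close to the
    minimum. *)
Lemma tmgf_second_difference (M s h : R) : (h * M) ^+ 2 <= 2^-1 ->
  tmgf M (s + h) + tmgf M (s - h) <= (2 + 4 * (h * M) ^+ 2) * tmgf M s.
Proof.
move=> hM; have h2 : 0 <= 2 + 4 * (h * M) ^+ 2.
  by rewrite addr_ge0// mulr_ge0// sqr_ge0.
rewrite -lee_fin EFinD EFinM -!tmgfE -ge0_integralD//.
rewrite -ge0_integralZl//.
apply: ge0_le_integral => //.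
all: try by do ?[apply: emeasurable_funD|apply: emeasurable_funM].
- by move=> x _; rewrite adde_ge0// lee_fin expR_ge0.
- move=> x xM; rewrite -EFinM -EFinD lee_fin.
  set y := x - nu; set u := h * y.
  rewrite (_ : (s + h) * y = s * y + u); last by rewrite /u; ring.
  rewrite (_ : (s - h) * y = s * y - u); last by rewrite /u; ring.
  rewrite !expRD -mulrDr mulrC ler_pM2r ?expR_gt0//.
  have u2 : u ^+ 2 <= (h * M) ^+ 2.
    rewrite !exprMn ler_wpM2l ?sqr_ge0// -[y ^+ 2]real_normK ?num_real//.
    by rewrite lerXn2r// nnegrE//; apply: le_trans xM.
  have u2' := le_trans u2 hM.
  have [u1 u1'] : u < 1 /\ -1 < u.
    by split; rewrite ltNge; apply/negP => u1; move: u2'; nra.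
  have e1 : expR u <= (1 - u)^-1.
    rewrite -[leLHS]invrK -expRN lef_pV2 ?posrE ?expR_gt0 ?subr_gt0//.
    exact: expR_ge1Dx.
  have e2 : expR (- u) <= (1 + u)^-1.
    rewrite expRN lef_pV2 ?posrE ?expR_gt0//; last by lra.
    exact: expR_ge1Dx.
  apply: le_trans (lerD e1 e2) _.
  apply: (@le_trans _ _ (2 + 4 * u ^+ 2)); last by lra.
  have u3 : 0 < (1 - u) * (1 + u) by apply: mulr_gt0; lra.
  rewrite (_ : _^-1 + _^-1 = 2 / ((1 - u) * (1 + u))); last first.
    by field; apply/andP; split; rewrite gt_eqF//; lra.
  by rewrite ler_pdivrMr//; nra.
Qed.

(** Monotone convergence along growing balls. *)
Lemma tmgf_lim s c : (forall n, tmgf n%:R s <= c) ->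
  (\int[F0]_x (expR (s * (x - nu)))%:E <= c%:E)%E.
Proof.
move=> H; have BT : \bigcup_n B n%:R = setT.
  apply/seteqP; split => // x _.
  exists (Num.bound `|x - nu|) => //=; exact/ltW/archi_boundP.
have ndB : nondecreasing_seq (fun n => B n%:R : set mR).
  apply/nondecreasing_seqP => n; apply/subsetPset => x /= /le_trans; apply.
  by rewrite ler_nat.
have /cvg_lim := @ge0_nondecreasing_set_cvg_integral _ _ R
  (fun n => B n%:R : set mR) (fun x : mR => (expR (s * (x - nu)))%:E) F0 ndB
  (fun n => mB n%:R) (fun n => mexp s) (fun n x _ => expR_ge0 _).
rewrite BT => <-//.
apply: lime_le; last by near=> n; rewrite tmgfE lee_fin.
apply: ereal_nondecreasing_is_cvgn.
apply: ge0_nondecreasing_set_nondecreasing_integral => //.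
Unshelve. all: by end_near. Qed.

End truncated_mgf.

Lemma near_expr_le (R : realType) (q e : R) : 0 <= q < 1 -> 0 < e ->
  \forall k \near \oo, q ^+ k <= e.
Proof.
move=> /andP[q0 q1] e0.
have /cvgrPdist_le/(_ _ e0) : q ^+ k @[k --> \oo] --> (0 : R).
  by apply: cvg_expr; rewrite ger0_norm.
by apply: filterS => k; rewrite sub0r normrN ger0_norm// exprn_ge0.
Qed.

Section cramer_theorem.
Context {R : realType} (F0 : probability (measurableTypeR R) R) (nu : R).
Local Notation mR := (measurableTypeR R).
Local Notation tmgf := (tmgf F0 nu).

(** At an approximate minimizer t of tmgf, tmgf_second_difference controls tmgf at
    t + h and t - h, and cpow_near_ge then leaves at least half of tmgf M t ^+ k
    for the window. The bound H on t makes the cost exp (- k |t| d') of tilting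
    back smaller than exp (- k e / 2) once d' is small. *)
Lemma cramer_truncated (M H c e d : R) : 0 < M -> 0 < c -> 0 < e -> 0 < d ->
  (forall s, c <= tmgf M s) -> (forall s, tmgf M s <= 2 -> `|s| <= H) ->
  \forall k \near \oo, ((c ^+ k * expR (- (k%:R * e)))%:E <=
    cpow F0 k [set x : mR | (`|x - k%:R * nu| <= k%:R * d)%R])%E.
Proof.
move=> M0 c0 e0 d0 cZ ZH.
have H0 : 0 <= H by apply: le_trans (ZH 0 _) => //; apply: le_trans (tmgf_le1 _ _ _) _; lra.
pose d' := Num.min (Num.min d M) (e / (2 * (H + 1))).
have H1 : 0 < 2 * (H + 1) by lra.
have d'0 : 0 < d' by rewrite /d' !lt_min d0 M0/= divr_gt0.
have d'd : d' <= d by rewrite /d' !ge_min lexx.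
have d'M : d' <= M by rewrite /d' !ge_min lexx orbT.
have d'e : H * d' <= e / 2.
  have : d' <= e / (2 * (H + 1)) by rewrite /d' !ge_min lexx !orbT.
  by rewrite ler_pdivlMr//; nra.
(* h is of order d' / M ^ 2, so that the gain exp (- h d') beats the second
   order loss (h M) ^ 2 *)
pose h := d' / (16 * M ^+ 2).
have M20 : 0 < 16 * M ^+ 2 by rewrite mulr_gt0// exprn_gt0.
have h0 : 0 < h by rewrite divr_gt0.
have hM : (h * M) ^+ 2 = h * d' / 16.
  by rewrite /h; field; rewrite gt_eqF.
have hd1 : h * d' <= 16^-1.
  rewrite /h mulrAC ler_pdivrMr// mulrA mulVf// mul1r -expr2.
  by rewrite lerXn2r// nnegrE ltW.
pose K := h * d' / 4.
have hd0 : 0 < h * d' by rewrite mulr_gt0.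
have [t Zt] : exists t, forall s, (1 - K) * tmgf M t <= tmgf M s.
  have hi : has_inf (range (tmgf M)).
    by split; [exists (tmgf M 0); exists 0|exists c => _ [s _ <-]].
  have i0 : c <= inf (range (tmgf M)).
    by apply: lb_le_inf => [|_ [s _ <-]//]; case: hi.
  have e1 : 0 < (1 - K)^-1 * inf (range (tmgf M)) - inf (range (tmgf M)).
    rewrite subr_gt0 ltr_pMl; last exact: lt_le_trans i0.
    by rewrite invf_gt1; rewrite /K; lra.
  have [_ [t _ <-]] := inf_adherent e1 hi.
  rewrite [ltRHS]addrC subrK => tlt; exists t => s.
  apply: (@le_trans _ _ (inf (range (tmgf M)))).
    rewrite -ler_pdivlMl; last by rewrite /K; lra.
    exact: ltW.
  by apply: ge_inf; [case: hi|exists s].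
have Ztp : 0 < tmgf M t by exact: lt_le_trans (cZ t).
have tH : `|t| <= H.
  apply: ZH; have := Zt 0; have := tmgf_le1 F0 nu M; rewrite /K; nra.
have sd := @tmgf_second_difference _ F0 nu M t h.
have {}sd : tmgf M (t + h) + tmgf M (t - h) <= (2 + h * d' / 4) * tmgf M t.
  apply: le_trans (sd _) _; first by rewrite hM; move: hd1; clear; lra.
  by rewrite hM ler_pM2r// lerD2l; move: hd0; clear; lra.
have Z1 : tmgf M (t + h) <= (1 + h * d' / 2) * tmgf M t.
  move: sd (Zt (t - h)); rewrite /K.
  by move: (tmgf M (t + h)) (tmgf M (t - h)) (tmgf M t); clear => *; lra.
have Z2 : tmgf M (t - h) <= (1 + h * d' / 2) * tmgf M t.
  move: sd (Zt (t + h)); rewrite /K.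
  by move: (tmgf M (t + h)) (tmgf M (t - h)) (tmgf M t); clear => *; lra.
pose q := expR (- (h * d')) * (1 + h * d' / 2).
have q01 : 0 <= q < 1.
  rewrite /q mulr_ge0 ?expR_ge0//=; last by move: hd0; clear; lra.
  rewrite expRN mulrC ltr_pdivrMr ?expR_gt0// mul1r.
  by apply: lt_le_trans (expR_ge1Dx _); move: hd0; clear; lra.
have r01 : 0 <= expR (- (e / 2)) < 1.
  by rewrite expR_ge0/= expR_lt1 oppr_lt0 divr_gt0.
have q4 : 0 < 4^-1 :> R by [].
have q2 : 0 < 2^-1 :> R by [].
near=> k.
have qk : q ^+ k <= 4^-1 by near: k; exact: near_expr_le.
have rk : expR (- (e / 2)) ^+ k <= 2^-1 by near: k; exact: near_expr_le.
have mM : measurable ([set x : mR | `|x - nu| <= M]) by exact: measurable_near.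
have := @cpow_near_ge _ (mrestr F0 mM) (tmgf M) nu t h d' k
  (tmgf_trunc F0 nu M) (ltW h0).
move/le_trans => /(_ (cpow F0 k [set x : mR | (`|x - k%:R * nu| <= k%:R * d)%R])).
have step : (cpow (mrestr F0 mM) k
    [set x : mR | (`|x - k%:R * nu| <= k%:R * d')%R] <=
    cpow F0 k [set x : mR | (`|x - k%:R * nu| <= k%:R * d)%R])%E.
  apply: (@le_trans _ _ (cpow F0 k [set x : mR | (`|x - k%:R * nu| <= k%:R * d')%R])).
    apply: le_cpow; last exact: measurable_near.
    by move=> A mA; apply: measureIl.
  apply: le_measure; rewrite ?inE; try exact: measurable_near.
  by move=> x /= /le_trans; apply; rewrite ler_wpM2l.
move=> /(_ step); apply: le_trans; rewrite lee_fin.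
have ck0 : 0 <= c ^+ k by rewrite exprn_ge0// ltW.
have main : 2^-1 * c ^+ k <= tmgf M t ^+ k -
    expR (- (h * d')) ^+ k * (tmgf M (t + h) ^+ k + tmgf M (t - h) ^+ k).
  have le1 s : tmgf M s <= (1 + h * d' / 2) * tmgf M t ->
      expR (- (h * d')) ^+ k * tmgf M s ^+ k <= 4^-1 * tmgf M t ^+ k.
    move=> sle; apply: (@le_trans _ _ (q ^+ k * tmgf M t ^+ k)).
      have hh : 0 <= 1 + h * d' / 2 by move: hd0; clear; lra.
      rewrite -!exprMn; apply: lerXn2r; rewrite ?nnegrE.
      - by rewrite mulr_ge0 ?expR_ge0 ?tmgf_ge0.
      - by rewrite !mulr_ge0 ?expR_ge0 ?tmgf_ge0.
      - by rewrite /q -[leRHS]mulrA ler_pM2l ?expR_gt0.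
    by rewrite ler_wpM2r// exprn_ge0// tmgf_ge0.
  have := le1 _ Z1; have := le1 _ Z2.
  have : c ^+ k <= tmgf M t ^+ k by rewrite lerXn2r// ?nnegrE ?tmgf_ge0// ltW.
  rewrite mulrDr; move: (c ^+ k) (tmgf M t ^+ k).
  move: (_ * tmgf M (t + h) ^+ k) (_ * tmgf M (t - h) ^+ k); clear => *; lra.
apply: (@le_trans _ _ (expR (- (k%:R * (`|t| * d'))) * (2^-1 * c ^+ k))); last first.
  by rewrite ler_wpM2l ?expR_ge0.
rewrite [leLHS]mulrC [leRHS]mulrA ler_wpM2r//.
apply: (@le_trans _ _ (expR (- (k%:R * (e / 2))) * 2^-1)); last first.
  rewrite ler_wpM2r// ler_expR lerN2 ler_wpM2l//.
  by apply: le_trans d'e; rewrite ler_wpM2r// ltW.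
apply: (@le_trans _ _ (expR (- (k%:R * (e / 2))) * expR (- (e / 2)) ^+ k)).
  rewrite -expRM_natl mulr_natl -expRD ler_expR.
  by rewrite le_eqVlt; apply/orP; left; apply/eqP; field.
by rewrite ler_wpM2l ?expR_ge0.
Unshelve. all: by end_near. Qed.
End cramer_theorem.

Section cramer_lower_bound.
Context {R : realType} (F0 : probability (measurableTypeR R) R) (nu : R).
Local Notation mR := (measurableTypeR R).
Local Notation tmgf := (tmgf F0 nu).

(** Bolzano-Weierstrass, phrased with cluster points. *)
Lemma cvg_subseq_near (u : nat -> R) (H : R) : (forall n, `|u n| <= H) ->
  exists x : R, forall (N : nat) (e : R), 0 < e ->
    exists2 n, (N <= n)%N & `|u n - x| < e.
Proof.
move=> uH; have := @segment_compact R (- H) H (u @ \oo) _.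
case.
  by exists 0 => // n _; rewrite /= in_itv/= -ler_norml.
move=> x [_ xcl]; exists x => N e e0.
have [] := xcl (u @` [set n | (N <= n)%N]) (ball x e).
- by exists N => // n Nn; exists n.
- exact: nbhsx_ballx.
move=> _ [[n /= Nn <-]]; rewrite -ball_normE/= distrC => xe.
by exists n.
Qed.

(** Compactness in s: near-minimizers for growing truncation levels stay in a
    bounded interval, and at a cluster point x of them every tmgf j x is at most c
    because tmgf increases with the level and is continuous in s, uniformly enough
    by tmgf_lip. *)
Lemma tmgf_uniform_bound (H c : R) (n0 : nat) : 0 <= c ->
  (forall (n : nat) s, (n0 <= n)%N -> tmgf n%:R s <= 2 -> `|s| <= H) -> c <= 2 ->
  (forall n, (n0 <= n)%N -> exists s, tmgf n%:R s < c) ->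
  exists s, (\int[F0]_x (expR (s * (x - nu)))%:E <= c%:E)%E.
Proof.
move=> c0 ZH c2 Zc.
have /choice[u uc] : forall n, exists s, tmgf (n0 + n)%:R s < c.
  by move=> n; apply: Zc; exact: leq_addr.
have [n|x xP] := @cvg_subseq_near u H.
  apply: (ZH (n0 + n)%N); first exact: leq_addr.
  by rewrite ltW// (lt_le_trans (uc n)).
exists x; apply: tmgf_lim => j.
apply/ler_addgt0Pl => e e0.
set T := tmgf j%:R x.
have T0 : 0 <= T by exact: tmgf_ge0.
have jT : 0 < j%:R * T + 1 by rewrite ltr_wpDl// mulr_ge0.
have [n jn un] := xP j (e / (j%:R * T + 1)) (divr_gt0 e0 jT).
have h1 : expR (- (`|u n - x| * j%:R)) * T <= c.
  apply: le_trans (tmgf_lip _ _ _ _ _) _; apply/ltW.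
  apply: le_lt_trans (uc n); apply: le_tmgf.
  by rewrite ler_nat (leq_trans jn)// leq_addl.
have h2 : (1 - `|u n - x| * j%:R) * T <= c.
  by apply: le_trans h1; rewrite ler_wpM2r//; exact: expR_ge1Dx.
have h3 : `|u n - x| * (j%:R * T) <= e.
  move: un; rewrite ltr_pdivlMr// => /ltW; apply: le_trans.
  by rewrite ler_wpM2l// lerDl.
by move: h2 h3; rewrite mulrBl mul1r mulrA; lra.
Qed.

(** Countable additivity over the shells at distance between 1 / (n + 1) and
    n + 1 from nu. *)
Lemma mass_beyond (sg : R) : F0 [set x : mR | 0 < sg * (x - nu)] != 0%E ->
  exists n : nat, (0 < F0 [set x : mR | (n.+1%:R^-1 <= sg * (x - nu) <= n.+1%:R)%R])%E.
Proof.
set D := fun n : nat => [set x : mR | (n.+1%:R^-1 <= sg * (x - nu) <= n.+1%:R)%R].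
have mf : measurable_fun setT (fun x : mR => sg * (x - nu)).
  apply: measurable_realfun.measurable_funM => //.
  by apply: measurable_funB.
have mD n : measurable (D n).
  rewrite -[X in measurable X]setTI.
  have -> : D n = (fun x : mR => sg * (x - nu)) @^-1` `[n.+1%:R^-1, n.+1%:R].
    by apply/seteqP; split => x /=; rewrite in_itv.
  exact: mf.
move=> F0pos; apply: contrapT => /forallNP H; move/eqP: F0pos; apply.
have DU : [set x : mR | 0 < sg * (x - nu)] `<=` \bigcup_n D n.
  move=> x /= y0; set y := sg * (x - nu).
  exists (maxn (Num.bound y) (Num.bound y^-1)) => //=.
  have y1 : y < (Num.bound y)%:R by apply: archi_boundP; exact: ltW.
  have y2 : y^-1 < (Num.bound y^-1)%:R.
    by apply: archi_boundP; rewrite invr_ge0; exact: ltW.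
  apply/andP; split.
    rewrite -[leRHS]invrK lef_pV2 ?posrE ?invr_gt0//.
    apply/ltW/(lt_le_trans y2); rewrite ler_nat.
    by apply: leqW; rewrite leq_max leqnn orbT.
  by apply/ltW/(lt_le_trans y1); rewrite ler_nat; apply: leqW; rewrite leq_max leqnn.
have mU : measurable (\bigcup_n D n) by exact: bigcup_measurable.
have : F0.-negligible (\bigcup_n D n).
  apply: negligible_bigcup => n; exists (D n); split => //.
  by apply/eqP; rewrite -measure_le0 leNgt; apply/negP; exact: H.
move=> /(negligibleS DU) [A [mA A0 sA]].
apply/eqP; rewrite -measure_le0 -A0 le_measure// inE//.
rewrite (_ : [set _ | _] = (fun x : mR => sg * (x - nu)) @^-1` `]0, +oo[).
  by rewrite -[X in measurable X]setTI; exact: mf.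
by apply/seteqP; split => x /=; rewrite in_itv/= andbT.
Qed.

(** When F0 has no mass on one side of nu, tilting strongly towards that side
    leaves only the neighbourhood of nu, so that the rate at nu is at least the
    opposite of the logarithm of the mass found there. *)
Lemma cramer_one_sided (sg I d : R) : `|sg| = 1 -> 0 < d ->
  (rate F0 nu <= I%:E)%E -> F0 [set x : mR | 0 < sg * (x - nu)] = 0%E ->
  ((expR (- I))%:E <= F0 [set x : mR | (`|x - nu| <= d)%R])%E.
Proof.
move=> sg1 d0 rI F00; set B := [set x : mR | (`|x - nu| <= d)%R].
have mB : measurable B by exact: measurable_near.
have fB : F0 B \is a fin_num by exact: fin_num_measure.
rewrite -(fineK fB) lee_fin; apply/ler_addgt0Pl => e e0.
(* with this s, exp (- s d) is at most e *)
pose s := e^-1 / d; have s0 : 0 < s by rewrite divr_gt0// invr_gt0.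
have mpos : measurable [set x : mR | 0 < sg * (x - nu)].
  rewrite (_ : [set _ | _] = (fun x : mR => sg * (x - nu)) @^-1` `]0, +oo[).
    rewrite -[X in measurable X]setTI.
    have mf : measurable_fun setT (fun x : mR => sg * (x - nu)).
      by apply: measurable_realfun.measurable_funM => //; apply: measurable_funB.
    exact: mf.
  by apply/seteqP; split => x /=; rewrite in_itv/= andbT.
have mexp t : measurable_fun setT (fun x : mR => (expR (t * x))%:E).
  by have := @measurable_expM R t 0; under eq_fun do rewrite subr0.
set t := s * sg.
have intle : (\int[F0]_x (expR (t * x))%:E <=
    (expR (t * nu) * (fine (F0 B) + e))%:E)%E.
  apply: (@le_trans _ _ (\int[F0]_x ((expR (t * nu))%:E * ((\1_B x)%:E + e%:E)))%E).
    apply: ae_ge0_le_integral => //.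
    - by move=> x _; rewrite -EFinD -EFinM lee_fin mulr_ge0 ?expR_ge0// addr_ge0 ?indicE// ltW.
    - apply: emeasurable_funM => //; apply: emeasurable_funD => //.
      by apply/measurable_EFinP; exact: measurable_indic.
    - exists [set x : mR | 0 < sg * (x - nu)]; split => // x /= H.
      rewrite ltNge; apply/negP => sgx; apply: H => _.
      rewrite -EFinD -EFinM lee_fin (_ : t * x = t * nu + t * (x - nu)); last by ring.
      rewrite expRD ler_pM2l ?expR_gt0// indicE.
      rewrite /t -mulrA.
      have [xB|] := boolP (x \in B).
        rewrite -[leLHS]addr0 lerD ?(ltW e0)//.
        by rewrite expR_le1 mulr_ge0_le0// ltW.
      rewrite notin_setE/= => /negP; rewrite -ltNge => xd.
      rewrite add0r -[leRHS]invrK -[sg * _]opprK mulrN expRN lef_pV2 ?posrE ?expR_gt0 ?invr_gt0//.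
      apply: le_trans (expR_ge1Dx _).
      have xd' : d <= - (sg * (x - nu)).
        by rewrite -(ler0_norm sgx) normrM sg1 mul1r ltW.
      apply: (@le_trans _ _ (s * d)); last first.
        by rewrite -[leLHS]add0r lerD// ler_pM2l.
      by rewrite /s -mulrA mulVf ?mulr1// gt_eqF.
  rewrite ge0_integralZl ?lee_fin ?expR_ge0//; last 2 first.
  all: try by move=> x _; rewrite -EFinD lee_fin addr_ge0 ?indicE// ltW.
    by apply: emeasurable_funD => //; apply/measurable_EFinP; exact: measurable_indic.
  rewrite EFinM lee_pmul2l ?lte_fin ?expR_gt0// ge0_integralD//; last 2 first.
  all: try by move=> x _; rewrite lee_fin ?indicE// ltW.
    by apply/measurable_EFinP; exact: measurable_indic.
  rewrite integral_indic// setIT integral_cst//.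
  rewrite EFinD fineK// leeD2l// -[leRHS]mule1 lee_wpmul2l ?lee_fin ?(ltW e0)//.
  exact: probability_le1.
have Fe : 0 < fine (F0 B) + e by rewrite ltr_wpDl// fine_ge0.
have [Tt pt] : Theta F0 t /\ psi F0 t <= t * nu + ln (fine (F0 B) + e).
  by apply: Theta_psi_le; rewrite expRD lnK.
have := le_trans (rate_ge nu Tt) rI; rewrite lee_fin => rle.
rewrite addrC -[leRHS]lnK ?posrE// ler_expR.
by lra.
Qed.

(** If one side of nu is null for F0, already a single observation is close to
    nu with probability exp (- I), and cpow_near concludes. Otherwise tmgf grows at
    both ends, its near-minimizers are bounded uniformly in the truncation level,
    and some level has minimum at least exp (- (I + e / 2)): if not,
    tmgf_uniform_bound would give a parameter of Theta that contradicts the value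
    of the rate. At that level cramer_truncated applies. *)
Theorem cramer (I d e : R) : 0 < d -> 0 < e -> (rate F0 nu <= I%:E)%E ->
  \forall k \near \oo, ((expR (- (k%:R * (I + e))))%:E <=
    cpow F0 k [set x : mR | (`|x - k%:R * nu| <= k%:R * d)%R])%E.
Proof.
move=> d0 e0 rI.
have one_sided sg : `|sg| = 1 -> F0 [set x : mR | 0 < sg * (x - nu)] = 0%E ->
    \forall k \near \oo, ((expR (- (k%:R * (I + e))))%:E <=
    cpow F0 k [set x : mR | (`|x - k%:R * nu| <= k%:R * d)%R])%E.
  move=> sg1 F00.
  near=> k; apply: le_trans (cpow_near _ _ _ _).
  apply: (@le_trans _ _ (((expR (- I))%:E) ^+ k)%E); last first.
    have := cramer_one_sided sg1 d0 rI F00.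
    elim: (k) => [|j IH] h //; rewrite !expeS lee_pmul ?lee_fin ?expR_ge0//.
      by apply: expe_ge0; rewrite lee_fin expR_ge0.
    exact: IH.
  rewrite -EFin_expe lee_fin -expRM_natl ler_expR.
  by rewrite -mulrN ler_wpM2l// lerN2 lerDl ltW.
have [F1|/mass_beyond[n1 p1]] := eqVneq (F0 [set x : mR | 0 < 1 * (x - nu)]) 0%E.
  by apply: (one_sided 1) => //; exact: normr1.
have [F2|/mass_beyond[n2 p2]] := eqVneq (F0 [set x : mR | 0 < -1 * (x - nu)]) 0%E.
  by apply: (one_sided (-1)) => //; rewrite normrN1.
pose n0 := (maxn n1 n2).+1.
pose p := Num.min (fine (F0 [set x : mR | (n1.+1%:R^-1 <= 1 * (x - nu) <= n1.+1%:R)%R]))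
  (fine (F0 [set x : mR | (n2.+1%:R^-1 <= -1 * (x - nu) <= n2.+1%:R)%R])).
have mD sg (n : nat) : measurable [set x : mR | (n.+1%:R^-1 <= sg * (x - nu) <= n.+1%:R)%R].
  have mf : measurable_fun setT (fun x : mR => sg * (x - nu)).
    by apply: measurable_realfun.measurable_funM => //; apply: measurable_funB.
  rewrite -[X in measurable X]setTI.
  have -> : [set x : mR | (n.+1%:R^-1 <= sg * (x - nu) <= n.+1%:R)%R] =
      (fun x : mR => sg * (x - nu)) @^-1` `[n.+1%:R^-1, n.+1%:R].
    by apply/seteqP; split => x /=; rewrite in_itv.
  exact: mf.
have p0 : 0 < p.
  rewrite /p lt_min; apply/andP; split; apply: fine_gt0; rewrite (p1, p2)/=;
    by rewrite -ge0_fin_numE// fin_num_measure.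
pose H := 2 * n0%:R / p.
have bound sg (n m : nat) s : `|sg| = 1 -> 0 <= s * sg -> (n < n0)%N -> (n0 <= m)%N ->
    p <= fine (F0 [set x : mR | (n.+1%:R^-1 <= sg * (x - nu) <= n.+1%:R)%R]) ->
    tmgf m%:R s <= 2 -> `|s| <= H.
  move=> sg1 ssg nn0 n0m pn Z2.
  have s1 : s = s * sg * sg.
    have : sg * sg = 1 by rewrite -expr2 -real_normK ?num_real// sg1 expr1n.
    by rewrite -mulrA => ->; rewrite mulr1.
  have sn : `|s| = s * sg by rewrite -(ger0_norm ssg) normrM sg1 mulr1.
  have sD : [set x : mR | (n.+1%:R^-1 <= sg * (x - nu) <= n.+1%:R)%R] `<=`
      [set x : mR | (`|x - nu| <= m%:R)%R].
    move=> x /= /andP[x1 x2].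
    have : `|sg * (x - nu)| <= n.+1%:R.
      by rewrite ger0_norm// (le_trans _ x1)// invr_ge0.
    rewrite normrM sg1 mul1r => /le_trans; apply.
    by rewrite ler_nat (leq_trans _ n0m).
  have := @tmgf_mass _ F0 nu m%:R s (`|s| / n0%:R) _ (mD sg n) sD.
  have cD x : [set x : mR | (n.+1%:R^-1 <= sg * (x - nu) <= n.+1%:R)%R] x ->
      `|s| / n0%:R <= s * (x - nu).
    move=> /= /andP[x1 x2]; have -> : s * (x - nu) = `|s| * (sg * (x - nu)).
      by rewrite sn mulrA -s1.
    rewrite ler_wpM2l//.
    apply: le_trans x1; rewrite lef_pV2 ?posrE ?ltr0n// ler_nat//.
  move=> /(_ cD) h1; rewrite /H ler_pdivlMr// mulrC.
  have n00 : 0 < n0%:R :> R by rewrite ltr0n.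
  rewrite -ler_pdivrMr// -mulrA.
  apply: le_trans Z2; apply: le_trans h1.
  apply: ler_pM => //; [exact: ltW|].
  by apply: le_trans (expR_ge1Dx _); rewrite lerDr.
have ZH (n : nat) s : (n0 <= n)%N -> tmgf n%:R s <= 2 -> `|s| <= H.
  move=> n0n Z2; have [s0|s0] := leP 0 s.
    apply: (bound 1 n1 n) => //; rewrite ?normr1 ?mulr1//.
      by rewrite ltnS leq_max leqnn.
    by rewrite /p ge_min lexx.
  apply: (bound (-1) n2 n) => //; rewrite ?normrN1 ?mulrN1 ?oppr_ge0 ?(ltW s0)//.
    by rewrite ltnS leq_max leqnn orbT.
  by rewrite /p ge_min lexx orbT.
pose c := expR (- (I + e / 2)).
have I0 : 0 <= I by rewrite -lee_fin; apply: le_trans rI; exact: rate_ge0.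
have c1 : c < 1 by rewrite /c expR_lt1; lra.
have c2 : c <= 2 by lra.
have [n n0n nc] : exists2 n : nat, (n0 <= n)%N & forall s, c <= tmgf n%:R s.
  apply: contrapT => /forall2NP Hn.
  have [n n0n|s sle] := @tmgf_uniform_bound H c n0 (expR_ge0 _) ZH c2.
    have [/(_ n0n)//|/existsNP[s /negP]] := Hn n.
    by rewrite -ltNge => ?; exists s.
  have mexp t : measurable_fun setT (fun x : mR => (expR (t * x))%:E).
    by have := @measurable_expM R t 0; under eq_fun do rewrite subr0.
  have [Ts ps] : Theta F0 s /\ psi F0 s <= s * nu - (I + e / 2).
    apply: Theta_psi_le; rewrite expRD -/c EFinM.
    apply: le_trans (_ : (expR (s * nu))%:E * \int[F0]_x (expR (s * (x - nu)))%:E <= _)%E; last first.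
      by rewrite lee_pmul2l ?lte_fin ?expR_gt0.
    rewrite -ge0_integralZl ?lee_fin ?expR_ge0//; last first.
      have := @measurable_expM R s (s * nu).
      by under eq_fun do rewrite -mulrBr.
    rewrite le_eqVlt; apply/orP; left; apply/eqP; apply: eq_integral => x _.
    by rewrite -EFinM -expRD; congr (expR _)%:E; ring.
  have := le_trans (rate_ge nu Ts) rI; rewrite lee_fin; lra.
have npos : 0 < n%:R :> R by rewrite ltr0n (leq_trans _ n0n).
have e2 : 0 < e / 2 by lra.
have := @cramer_truncated _ F0 nu n%:R H c (e / 2) d npos (expR_gt0 _) e2 d0 nc
  (fun s => ZH n s n0n).
apply: filterS => k; apply: le_trans; rewrite lee_fin /c -expRM_natl mulr_natl.
rewrite -expRD ler_expR le_eqVlt; apply/orP; left; apply/eqP.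
by field.
Unshelve. all: by end_near. Qed.
End cramer_lower_bound.

(** * Randomized p-values *)

Section uniform_facts.
Context {R : realType}.
Local Notation mR := (measurableTypeR R).
Local Notation U := (uniform_prob (@ltr01 R)).

Lemma uniform01E (A : set mR) : measurable A ->
  U A = lebesgue_measure (A `&` `[0, 1]%classic).
Proof.
move=> mA; rewrite /uniform_prob integral_uniform_pdf.
rewrite (eq_integral (fun=> 1%E)); last first.
  move=> x; rewrite inE => -[_ /=]; rewrite in_itv/= /uniform_pdf => ->.
  by rewrite subr0 invr1.
by rewrite integral_cst ?mul1e//; exact: measurableI.
Qed.

Lemma uniform01_itv (r : R) : 0 <= r <= 1 -> U `]-oo, r]%classic = r%:E.
Proof.
move=> /andP[r0 r1]; rewrite uniform01E; last exact: measurable_itv.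
rewrite (_ : _ `&` _ = `[0, r]%classic); last first.
  apply/seteqP; split => x /=; rewrite !in_itv/=; first by move=> [? /andP[->]].
  by move=> /andP[-> xr]; rewrite xr (le_trans xr).
rewrite lebesgue_measure_itv/= lte_fin; case: ltP; first by rewrite sube0.
by move=> r0'; congr _%:E; apply/eqP; rewrite eq_le r0.
Qed.

Lemma uniform01_itvc (r : R) : 0 <= r <= 1 -> U `[0, r]%classic = r%:E.
Proof.
move=> r01; rewrite -(uniform01_itv r01) !uniform01E; try exact: measurable_itv.
congr lebesgue_measure; apply/seteqP; split => x /=; rewrite !in_itv/=.
  by move=> [/andP[-> ->]].
by move=> [-> /andP[-> ->]].
Qed.

Lemma uniform01_out : U (~` `[0, 1]%classic) = 0%E.
Proof.
rewrite uniform01E; last by apply: measurableC; exact: measurable_itv.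
by rewrite setICl measure0.
Qed.

End uniform_facts.

Section randomized_tail.
Context {R : realType} (G : probability (measurableTypeR R) R).
Local Notation mR := (measurableTypeR R).
Local Notation U := (uniform_prob (@ltr01 R)).

(** The randomized upper tail probability of a general law G, with v the
    auxiliary uniform variable. *)
Definition utail (y v : R) : R := fine (G `]y, +oo[%classic) + v * fine (G [set y]).

Let mray b (y : R) : measurable ([set` Interval (BSide b y) +oo%O] : set mR).
Proof. exact: measurable_itv. Qed.

Let fG (A : set mR) : measurable A -> G A \is a fin_num.
Proof. exact: fin_num_measure. Qed.

Lemma measurable_utail :
  measurable_fun setT (fun z : mR * mR => utail z.1 z.2).
Proof.
have m1 b : measurable_fun setT (fun y : mR => fine (G [set` Interval (BSide b y) +oo%O])).
  apply: nonincreasing_measurable => // x y xy.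
  rewrite fine_le ?fG// le_measure ?inE//.
  by apply: subset_itvr; rewrite bnd_simp.
have e (y : mR) : fine (G [set y]) = fine (G `[y, +oo[%classic) - fine (G `]y, +oo[%classic).
  rewrite -(@setU1itv _ _ +oo%O y false)// measureU//; last first.
    by apply/seteqP; split => // x [/= -> ]; rewrite in_itv/= ltxx.
  by rewrite fineD ?fG// addrK.
apply: measurable_realfun.measurable_funD.
  by apply: (measurableT_comp (m1 false)); exact: measurable_fst.
apply: measurable_realfun.measurable_funM; first exact: measurable_snd.
under eq_fun do rewrite e.
by apply: measurable_funB; [apply: (measurableT_comp (m1 true))|apply: (measurableT_comp (m1 false))]; exact: measurable_fst.
Qed.

(** y0 is the infimum of the points whose open upper tail is at most s; the two
    bounds at y0 are the right continuity of the open tail and the left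
    continuity of the closed one. *)
Lemma quantile (s : R) : 0 < s < 1 -> exists y0 : R,
  [/\ fine (G `]y0, +oo[%classic) <= s, s <= fine (G `[y0, +oo[%classic) &
      forall y, y < y0 -> s < fine (G `]y, +oo[%classic)].
Proof.
move=> /andP[s0 s1].
pose A := [set y : R | fine (G `]y, +oo[%classic) <= s].
have mono (x y : R) : x <= y -> fine (G `]y, +oo[%classic) <= fine (G `]x, +oo[%classic).
  move=> xy; rewrite fine_le ?fG// le_measure ?inE//.
  by apply: subset_itvr; rewrite bnd_simp.
have A0 : A !=set0.
  have : G `]n%:R, +oo[%classic @[n --> \oo] --> G (\bigcap_n (`]n%:R, +oo[%classic : set mR)).
    apply: nonincreasing_cvg_mu => //.
    - by rewrite -ge0_fin_numE// fG.
    - exact: bigcapT_measurable.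
    - move=> n m nm; apply/subsetPset/subset_itvr; by rewrite bnd_simp ler_nat.
  rewrite (_ : \bigcap_n _ = set0); last first.
    apply/seteqP; split => // x /(_ (Num.bound x) Logic.I)/=.
    rewrite in_itv/= andbT => xb.
    have [x0|x0] := leP 0 x; first by have := archi_boundP x0; rewrite ltNge (ltW xb).
    by have := lt_trans (le_lt_trans (ler0n _ _) xb) x0; rewrite ltxx.
  rewrite measure0 => /fine_cvgP[_] /cvgrPdist_le/(_ _ s0)[N _ /(_ N (leqnn N))/=].
  rewrite sub0r normrN => h; exists N%:R; rewrite /A/=.
  exact: le_trans (ler_norm _) h.
have Alb : has_lbound A.
  have s1' : 0 < 1 - s by rewrite subr_gt0.
  have : G `]- n%:R, +oo[%classic @[n --> \oo] --> G (\bigcup_n (`]- n%:R, +oo[%classic : set mR)).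
    apply: nondecreasing_cvg_mu => //.
    - exact: bigcup_measurable.
    - move=> n m nm; apply/subsetPset/subset_itvr; by rewrite bnd_simp lerN2 ler_nat.
  rewrite (_ : \bigcup_n _ = setT); last first.
    apply/seteqP; split => // x _; exists (Num.bound (- x)) => //=.
    rewrite in_itv/= andbT ltrNl.
    have [x0|x0] := leP 0 (- x); first exact: archi_boundP.
    by apply: lt_le_trans x0 _; rewrite ler0n.
  rewrite probability_setT => /fine_cvgP[_] /cvgrPdist_lt/(_ _ s1')[N _ /(_ N (leqnn N))/=].
  move=> h; exists (- N%:R) => y Ay; rewrite leNgt; apply/negP => yN.
  have := mono _ _ (ltW yN); move: Ay h; rewrite /A/= => Ay.
  move=> /(le_lt_trans (ler_norm _)); lra.
pose y0 := inf A; exists y0.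
have below (y : R) : y < y0 -> s < fine (G `]y, +oo[%classic).
  move=> yy0; rewrite ltNge; apply/negP => Ay.
  by have := ge_inf Alb Ay; rewrite leNgt yy0.
have above (y : R) : y0 < y -> fine (G `]y, +oo[%classic) <= s.
  move=> y0y; have [z Az zy] := inf_lt A0 y0y.
  by apply: le_trans Az; apply: mono; exact: ltW.
have inv0 (n : nat) : 0 < n.+1%:R^-1 :> R by rewrite invr_gt0.
have invd (n m : nat) : (n <= m)%N -> m.+1%:R^-1 <= n.+1%:R^-1 :> R.
  by move=> nm; rewrite lef_pV2 ?posrE// ler_nat.
have invs (e : R) : 0 < e -> exists n : nat, n.+1%:R^-1 < e.
  move=> e0; exists (Num.bound e^-1); rewrite -[ltRHS]invrK ltf_pV2 ?posrE ?invr_gt0//.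
  have e1 := ltW e0; rewrite -invr_ge0 in e1.
  by apply: lt_le_trans (archi_boundP e1) _; rewrite ler_nat.
split => //.
- have cv : G `]y0 + n.+1%:R^-1, +oo[%classic @[n --> \oo] -->
      G (\bigcup_n (`]y0 + n.+1%:R^-1, +oo[%classic : set mR)).
    apply: nondecreasing_cvg_mu => //.
    - exact: bigcup_measurable.
    - by move=> n m nm; apply/subsetPset/subset_itvr; rewrite bnd_simp lerD2l invd.
  move: cv; rewrite (_ : \bigcup_n _ = `]y0, +oo[%classic); last first.
    apply/seteqP; split => x /=.
      by move=> [n _ /=]; rewrite !in_itv/= !andbT; apply: lt_trans; rewrite ltrDl.
    rewrite in_itv/= andbT => xy; have [|n nn] := invs (x - y0); first by rewrite subr_gt0.
    by exists n => //=; rewrite in_itv/= andbT -ltrBrDl.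
  move=> cv; rewrite -lee_fin fineK ?fG// -(cvg_lim _ cv)//.
  apply: lime_le; first by apply/cvg_ex; eexists; exact: cv.
  by apply: nearW => n; rewrite -[leLHS]fineK ?fG// lee_fin above// ltrDl.
- have cv : G `]y0 - n.+1%:R^-1, +oo[%classic @[n --> \oo] -->
      G (\bigcap_n (`]y0 - n.+1%:R^-1, +oo[%classic : set mR)).
    apply: nonincreasing_cvg_mu => //.
    - by rewrite -ge0_fin_numE// fG.
    - exact: bigcapT_measurable.
    - by move=> n m nm; apply/subsetPset/subset_itvr; rewrite bnd_simp lerD2l lerN2 invd.
  move: cv; rewrite (_ : \bigcap_n _ = `[y0, +oo[%classic); last first.
    apply/seteqP; split => x /=; rewrite in_itv/= andbT.
      move=> H; rewrite leNgt; apply/negP => xy.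
      have [|n nn] := invs (y0 - x); first by rewrite subr_gt0.
      have := H n Logic.I; rewrite /= in_itv/= andbT ltrBlDr -ltrBlDl.
      by move=> /(lt_trans nn); rewrite ltxx.
    by move=> xy n _ /=; rewrite in_itv/= andbT; apply: lt_le_trans xy; rewrite gtrDl oppr_lt0.
  move=> cv; rewrite -lee_fin fineK ?fG// -(cvg_lim _ cv)//.
  apply: lime_ge; first by apply/cvg_ex; eexists; exact: cv.
  by apply: nearW => n; rewrite -[leRHS]fineK ?fG// lee_fin ltW// below// gtrDl oppr_lt0.
Qed.
End randomized_tail.

Section utail_uniform.
Context {R : realType} (G : probability (measurableTypeR R) R).
Local Notation mR := (measurableTypeR R).
Local Notation U := (uniform_prob (@ltr01 R)).
Local Notation utail := (utail G).

Let mray b (y : R) : measurable ([set` Interval (BSide b y) +oo%O] : set mR).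
Proof. exact: measurable_itv. Qed.

Let fG (A : set mR) : measurable A -> G A \is a fin_num.
Proof. exact: fin_num_measure. Qed.

Lemma measurable_utail_le (s : R) :
  measurable [set z : mR * mR | utail z.1 z.2 <= s].
Proof.
have := @measurable_utail R G measurableT `]-oo, s]%classic (measurable_itv _).
by rewrite setTI; congr measurable.
Qed.

(** The randomized tail exceeds s below the quantile y0 and is at most s above
    it. At y0 the auxiliary variable selects the fraction r of the atom that
    brings the total mass to s. *)
Lemma utail_uniform (s : R) : 0 < s < 1 ->
  ((G \x U) [set z : mR * mR | (utail z.1 z.2 <= s)%R] = s%:E)%E.
Proof.
move=> s01; have [y0 [us su below]] := quantile G s01.
set u0 := fine (G `]y0, +oo[%classic) in us.
set g0 := fine (G [set y0]).
have sug : s <= u0 + g0.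
  move: su; rewrite -(@setU1itv _ _ +oo%O y0 false)// measureU//; last first.
    by apply/seteqP; split => // x [/= -> ]; rewrite in_itv/= ltxx.
  by rewrite fineD ?fG// addrC.
have u00 : 0 <= u0 by exact: fine_ge0.
have g00 : 0 <= g0 by exact: fine_ge0.
have above (y v : R) : y0 < y -> 0 <= v <= 1 -> utail y v <= s.
  move=> y0y /andP[v0 v1]; apply: le_trans us.
  apply: (@le_trans _ _ (fine (G `]y, +oo[%classic) + fine (G [set y]))).
    by rewrite lerD2l ler_piMl// fine_ge0.
  rewrite -fineD ?fG// -measureU//; last first.
    by apply/seteqP; split => // x [/= /[swap] ->]; rewrite in_itv/= ltxx.
  rewrite fine_le ?fG//; first exact: measurableU.
  rewrite le_measure ?inE//; first exact: measurableU.
  move=> x /= [|->]; rewrite !in_itv/= ?andbT//; exact: lt_trans.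
pose r := if g0 == 0 then 0 else (s - u0) / g0.
have r01 : 0 <= r <= 1.
  rewrite /r; case: eqVneq => [_|g0n]; first by rewrite lexx ler01.
  have gp : 0 < g0 by rewrite lt_def g0n.
  rewrite divr_ge0 ?subr_ge0//= ler_pdivrMr// mul1r lerBlDl.
  exact: sug.
have ur : u0 + g0 * r = s.
  rewrite /r; case: eqVneq => [g0e|g0n]; last by rewrite mulrCA mulfV// mulr1 addrC subrK.
  by rewrite mulr0 addr0; apply/eqP; rewrite eq_le us/=; move: sug; rewrite g0e addr0.
have mE := measurable_utail_le s.
have E1 (A B : set mR) : measurable A -> measurable B ->
  ((G \x U) (A `*` B) = G A * U B)%E by exact: product_measure1E.
have mc (B : set mR) : measurable B -> measurable (setT `*` B : set (mR * mR)).
  by move=> mB; exact: measurableX.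
apply/eqP; rewrite eq_le; apply/andP; split.
  pose A1 : set (mR * mR) := (`]y0, +oo[%classic : set mR) `*` (setT : set mR).
  pose A3 : set (mR * mR) := (setT : set mR) `*` (~` `[0, 1]%classic : set mR).
  have mA1 : measurable A1 by exact: measurableX.
  have mA3 : measurable A3.
    by apply: mc; apply: measurableC; exact: measurable_itv.
  pose A2 : set (mR * mR) := if g0 == 0 then ([set y0] : set mR) `*` (setT : set mR)
    else ([set y0] : set mR) `*` (`]-oo, r]%classic : set mR).
  have mA2 : measurable A2.
    by rewrite /A2; case: ifP => _; apply: measurableX => //; exact: measurable_itv.
  have sub : [set z : mR * mR | utail z.1 z.2 <= s] `<=`
      (A1 `|` A2) `|` A3.
    move=> [y v] /= Tle; have [v01|v01] := boolP (0 <= v <= 1); last first.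
      by right; split => //=; rewrite in_itv/=; exact/negP.
    left; have [yy|yy|yy] := ltgtP y0 y.
    - by left; split => //=; rewrite in_itv/= andbT.
    - exfalso; have := below _ yy; apply/negP; rewrite -leNgt.
      apply: le_trans Tle; rewrite lerDl mulr_ge0 ?fine_ge0//.
      by case/andP: v01.
    - right; rewrite /A2; case: eqVneq => g0n; split => //=.
      rewrite in_itv/= /r (negbTE g0n) ler_pdivlMr; last by rewrite lt_def g0n.
      by rewrite lerBrDl; move: Tle; rewrite /utail -yy.
  apply: (@le_trans _ _ ((G \x U) A1 + (G \x U) A2 + (G \x U) A3)%E).
    apply: (@le_trans _ _ ((G \x U)%E ((A1 `|` A2) `|` A3))).
      by apply: le_measure; rewrite ?inE//; do 2?apply: measurableU.
    apply: (@le_trans _ _ ((G \x U) (A1 `|` A2) + (G \x U) A3)%E).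
      by apply: measureU2 => //; exact: measurableU.
    by rewrite leeD2r//; exact: measureU2.
  have -> : ((G \x U) A3 = 0)%E.
    rewrite E1//; last by apply: measurableC; exact: measurable_itv.
    by rewrite uniform01_out mule0.
  rewrite adde0.
  have -> : ((G \x U) A1 = u0%:E)%E.
    by rewrite E1// -[G _]fineK ?fG// -/u0 [U _]probability_setT mule1.
  have -> : ((G \x U) A2 = (g0 * r)%:E)%E.
    have -> : g0 * r = s - u0 by rewrite -ur addrC addKr.
    have [g0e|g0n] := eqVneq g0 0.
      rewrite /A2 g0e eqxx E1// -[G _]fineK ?fG// -/g0 g0e mul0e -ur g0e.
      by rewrite mul0r addr0 subrr.
    rewrite /A2 (negbTE g0n) E1//.
    rewrite uniform01_itv//.
    by rewrite -[G _]fineK ?fG// -/g0 -EFinM -ur addrAC subrr add0r.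
  by rewrite -EFinD lee_fin ur.
pose B1 : set (mR * mR) := (`]y0, +oo[%classic : set mR) `*` (`[0, 1]%classic : set mR).
pose B2 : set (mR * mR) := ([set y0] : set mR) `*` (`[0, r]%classic : set mR).
have sub : B1 `|` B2 `<=` [set z : mR * mR | utail z.1 z.2 <= s].
  move=> [y v] [[/= h1 h2]|[/= h1 h2]].
    by move: h1 h2; rewrite !in_itv/= andbT; exact: above.
  move: h2; rewrite in_itv/= => /andP[v0 vr].
  by rewrite h1 /utail -/u0 -/g0 -ur lerD2l mulrC ler_wpM2l.
have m1 : measurable B1.
  by apply: measurableX => //; exact: measurable_itv.
have m2 : measurable B2.
  by apply: measurableX => //; exact: measurable_itv.
apply: (@le_trans _ _ ((G \x U)%E (B1 `|` B2))); last first.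
  by apply: le_measure; rewrite ?inE//; exact: measurableU.
have -> : ((G \x U) (B1 `|` B2) = (G \x U) B1 + (G \x U) B2)%E.
  apply: measureU => //; apply/seteqP; split => // -[y v] [[/= yy _] [/= yy' _]].
  by move: yy; rewrite yy' in_itv/= ltxx.
rewrite !E1//.
rewrite !uniform01_itvc ?ler01 ?lexx// mule1.
rewrite -[X in (_ <= X + _)%E]fineK ?fG// -[X in (_ <= _ + X * _)%E]fineK ?fG//.
by rewrite -EFinM -EFinD lee_fin -/u0 -/g0 ur.
Qed.

(** The two-sided randomized p-value of a general law G. *)
Definition upval (z : mR * mR) : R := 2 * Num.min (utail z.1 z.2) (1 - utail z.1 z.2).

Lemma measurable_upval : measurable_fun setT upval.
Proof.
apply: measurable_realfun.measurable_funM => //.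
apply: measurable_minr; first exact: measurable_utail.
by apply: measurable_funB => //; exact: measurable_utail.
Qed.

Lemma measurable_upval_le (t : R) : measurable [set z : mR * mR | upval z <= t].
Proof.
have := @measurable_upval measurableT `]-oo, t]%classic (measurable_itv _).
by rewrite setTI; congr measurable.
Qed.

Lemma upval_le (t : R) : 0 <= t ->
  ((G \x U) [set z : mR * mR | (upval z <= t)%R] <= t%:E)%E.
Proof.
move=> t0; apply/lee_addgt0Pr => e e0.
have [te1|te1] := leP 1 (t + e).
  by apply: le_trans (probability_le1 _ _) _; rewrite -?EFinD ?lee_fin//; exact: measurable_upval_le.
(* the margin e separates the two tail events from the boundary, where the
   inequalities on utail are strict *)
pose s := (t + e) / 2.
have s01 : 0 < s < 1 by rewrite /s; lra.
have s01' : 0 < 1 - s < 1 by rewrite /s; lra.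
have sub : [set z : mR * mR | upval z <= t] `<=`
    [set z | utail z.1 z.2 <= s] `|` ~` [set z | utail z.1 z.2 <= 1 - s].
  move=> z /=; rewrite /upval mulrC -ler_pdivlMr// ge_min => /orP[h|h].
    by left; apply: (le_trans h); rewrite /s; lra.
  by right; apply/negP; rewrite -ltNge; rewrite /s; lra.
pose D1 := [set z : mR * mR | utail z.1 z.2 <= s].
pose D2 := [set z : mR * mR | utail z.1 z.2 <= 1 - s].
have mD1 : measurable D1 by exact: measurable_utail_le.
have mD2 : measurable D2 by exact: measurable_utail_le.
have e2 : ((G \x U) (~` D2) = s%:E)%E.
  transitivity (1 - (G \x U) D2)%E; first exact: probability_setC.
  by rewrite [X in (_ - X)%E]utail_uniform// -EFinD; congr _%:E; ring.
apply: (@le_trans _ _ ((G \x U)%E (D1 `|` ~` D2))).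
  apply: le_measure; rewrite ?inE//; first exact: measurable_upval_le.
  by apply: measurableU => //; exact: measurableC.
apply: (@le_trans _ _ ((G \x U) D1 + (G \x U) (~` D2))%E).
  by apply: measureU2 => //; exact: measurableC.
rewrite e2 [X in (X + _)%E]utail_uniform// -EFinD lee_fin /s; lra.
Qed.

(** Counting one of the two tails only loses the factor 2. *)
Lemma upval_ge (t : R) : 0 < t <= 1 ->
  ((t / 2)%:E <= (G \x U) [set z : mR * mR | (upval z <= t)%R])%E.
Proof.
move=> t01; rewrite -(@utail_uniform (t / 2)); last by lra.
apply: le_measure; rewrite ?inE//.
- exact: measurable_utail_le.
- exact: measurable_upval_le.
move=> z /= h; rewrite /upval mulrC -ler_pdivlMr//.
by rewrite ge_min h.
Qed.

End utail_uniform.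

(** * Laws of the p-values *)

Section cpow_probability.
Context {R : realType}.
Local Notation mR := (measurableTypeR R).

Lemma cpow_setT (P : probability mR R) k : cpow P k setT = 1%E.
Proof.
elim: k => [|k IH] /=; first by rewrite diracT.
rewrite convolution_setT IH mule1; exact: probability_setT.
Qed.

Definition cpow_prob (P : probability mR R) k : probability mR R :=
  HB.pack (Measure.sort (cpow P k)) (Measure.class (cpow P k))
    (Measure_isProbability.Build _ _ _ (cpow P k) (cpow_setT P k)).

End cpow_probability.

Section pvalue_laws.
Context {R : realType} (F0 : probability (measurableTypeR R) R) (theta : R).
Hypothesis Ttheta : Theta F0 theta.
Local Notation mR := (measurableTypeR R).
Local Notation U := (uniform_prob (@ltr01 R)).
Local Notation psi := (psi F0).
Local Notation Theta := (Theta F0).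
Local Notation Ftheta := (Fexp_prob Ttheta).

Definition null_law k : probability (mR * mR)%type R := (cpow_prob F0 k \x U)%E.
Definition alt_law k : probability (mR * mR)%type R := (cpow_prob Ftheta k \x U)%E.

Definition small_pvalue k (t : R) : set (mR * mR) :=
  [set z | pvalue F0 k z.1 z.2 <= t].

Lemma pvalueE k (z : mR * mR) : pvalue F0 k z.1 z.2 = upval (cpow_prob F0 k) z.
Proof. by rewrite /pvalue /upper_tail !cpowE. Qed.

Lemma small_pvalueE k t :
  small_pvalue k t = [set z | upval (cpow_prob F0 k) z <= t].
Proof. by apply/seteqP; split => z; rewrite /small_pvalue/= pvalueE. Qed.

Lemma measurable_small_pvalue k t : measurable (small_pvalue k t).
Proof. by rewrite small_pvalueE; exact: measurable_upval_le. Qed.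

Lemma null_pvalue_le k t : 0 <= t -> (null_law k (small_pvalue k t) <= t%:E)%E.
Proof. by move=> t0; rewrite small_pvalueE; exact: upval_le. Qed.

Lemma null_pvalue_ge k t : 0 < t <= 1 ->
  ((t / 2)%:E <= null_law k (small_pvalue k t))%E.
Proof. by move=> t0; rewrite small_pvalueE; exact: upval_ge. Qed.

Lemma integral_cpow_Fexp k (f : mR -> \bar R) :
  measurable_fun setT f -> (forall x, 0 <= f x)%E ->
  (\int[cpow Ftheta k]_y f y =
   \int[cpow F0 k]_y (f y * (expR (theta * y - k%:R * psi theta))%:E))%E.
Proof.
move=> mf f0.
have mg : measurable_fun setT (fun y : mR => expR (theta * y - k%:R * psi theta)).
  by apply/measurable_EFinP; exact: measurable_expM.
rewrite (@eq_measure_integral _ _ _ setT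
  (weighted_measure (cpow F0 k) mg (fun y => expR_ge0 _))).
  exact: integral_weighted.
by move=> A mA _; exact: cpow_Fexp.
Qed.

(** Holder's inequality for the indicator of a small p-value, of null mass at
    most t, and the likelihood ratio, whose power 1 / l has an integral governed
    by psi (theta / l). It is obtained by linearizing the likelihood ratio with
    expR_conv before integrating. *)
Lemma alt_pvalue_le k t l : 0 < l <= 1 -> Theta (theta / l) -> 0 < t ->
  (alt_law k (small_pvalue k t) <= (expR ((1 - l) * ln t +
     k%:R * (l * psi (theta / l) - psi theta)))%:E)%E.
Proof.
move=> /andP[l0 l1] Teta t0; set eta := theta / l in Teta *.
set E := small_pvalue k t.
have mE : measurable E by exact: measurable_small_pvalue.
pose w (y : mR) := U (xsection E y).
have mw : measurable_fun setT w by exact: measurable_fun_xsection.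
have w0 y : (0 <= w y)%E by [].
have w1 y : (w y <= 1)%E.
  by apply: probability_le1; exact: measurable_xsection.
have altE : (alt_law k E = \int[cpow Ftheta k]_y w y)%E by [].
have nullE : (\int[cpow F0 k]_y w y <= t%:E)%E.
  exact: (null_pvalue_le k (ltW t0)).
rewrite altE integral_cpow_Fexp//.
(* with this c both terms of the linearized bound integrate to multiples of t *)
pose c := k%:R * psi eta - ln t.
pose C := expR (l * c - k%:R * psi theta).
have mexp s : measurable_fun setT (fun x : mR => (expR (s * x))%:E).
  by have := @measurable_expM R s 0; under eq_fun do rewrite subr0.
apply: (@le_trans _ _ (\int[cpow F0 k]_y ((C * (1 - l))%:E * w y +
    (C * l * expR (- c))%:E * (expR (eta * y))%:E))%E).
  apply: ge0_le_integral => //.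
  - by move=> y _; rewrite mule_ge0// lee_fin expR_ge0.
  - by apply: emeasurable_funM => //; exact: measurable_expM.
  - apply: emeasurable_funD; first exact: emeasurable_funM.
    exact: emeasurable_funM.
  - move=> y _.
    have fw : w y \is a fin_num by rewrite ge0_fin_numE// (le_lt_trans (w1 y))// ltry.
    have : 0 <= fine (w y) <= 1 by rewrite fine_ge0//= -lee_fin fineK.
    rewrite -(fineK fw) -!EFinM -EFinD lee_fin; set x := fine (w y) => /andP[x0 x1].
    have h : expR (theta * y - k%:R * psi theta) <= C * ((1 - l) + l * (expR (- c) * expR (eta * y))).
      have -> : theta * y - k%:R * psi theta = (l * c - k%:R * psi theta) + (l * (- c + eta * y) + (1 - l) * 0).
        by rewrite mulr0 addr0 /eta; field; rewrite gt_eqF.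
      rewrite expRD ler_pM2l ?expR_gt0// -expRD.
      by apply: le_trans (expR_conv _ _ _) _; rewrite ?(ltW l0)// expR0 mulr1 addrC.
    apply: (le_trans (ler_wpM2l x0 h)).
    have -> : x * (C * (1 - l + l * (expR (- c) * expR (eta * y)))) =
        C * (1 - l) * x + x * (C * (l * (expR (- c) * expR (eta * y)))) by ring.
    rewrite lerD2l.
    apply: (@le_trans _ _ (1 * (C * (l * (expR (- c) * expR (eta * y)))))).
      by rewrite ler_wpM2r// !mulr_ge0 ?expR_ge0// ltW.
    by rewrite le_eqVlt; apply/orP; left; apply/eqP; ring.
have C0 : 0 <= C * (1 - l) by rewrite mulr_ge0 ?expR_ge0// subr_ge0.
have C1 : 0 <= C * l * expR (- c) by rewrite !mulr_ge0 ?expR_ge0// ltW.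
rewrite ge0_integralD//; last 4 first.
all: try by move=> y _; rewrite mule_ge0// lee_fin.
all: try by apply: emeasurable_funM.
rewrite !ge0_integralZl ?lee_fin//.
rewrite integral_expR_cpowF0//.
apply: (@le_trans _ _ ((C * (1 - l))%:E * t%:E +
  (C * l * expR (- c))%:E * (expR (k%:R * psi eta))%:E)%E).
  by rewrite leeD2r// lee_wpmul2l// lee_fin.
rewrite -!EFinM -EFinD lee_fin.
have -> : C * l * expR (- c) * expR (k%:R * psi eta) = C * l * t.
  rewrite -mulrA -expRD /c opprB addrC addrA addrAC addrC !addrA.
  by rewrite (_ : _ + _ = ln t) ?lnK ?posrE//; ring.
rewrite (_ : C * (1 - l) * t + C * l * t = C * expR (ln t)); last first.
  by rewrite lnK ?posrE//; ring.
rewrite /C -expRD ler_expR /c le_eqVlt; apply/orP; left; apply/eqP; ring.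
Qed.

(** Markov applied to exp (s x). *)
Lemma cpow_chernoff k s c (A : set mR) : Theta s -> measurable A ->
  (forall x, A x -> c <= s * x) ->
  (cpow F0 k A <= (expR (k%:R * psi s - c))%:E)%E.
Proof.
move=> Ts mA Ac.
rewrite expRD mulrC EFinM -(integral_expR_cpowF0 k Ts).
have mexp : measurable_fun setT (fun x : mR => (expR (s * x))%:E).
  by have := @measurable_expM R s 0; under eq_fun do rewrite subr0.
rewrite -ge0_integralZl ?lee_fin ?expR_ge0//.
rewrite -(setIT A) -(integral_indic (cpow F0 k) measurableT mA).
apply: ge0_le_integral => //.
- by apply/measurable_EFinP; exact: measurable_indic.
- exact: emeasurable_funM.
- move=> x _; rewrite -EFinM -expRD lee_fin indicE.
  case: (boolP (x \in A)) => xA /=; last exact: expR_ge0.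
  rewrite -expR0 ler_expR addrC subr_ge0; apply: Ac.
  by move: xA; rewrite inE.
Qed.

(** On the window around k nu the p-value is small by Chernoff's bound, for the
    upper tail when s is nonnegative and for the lower tail otherwise; and there
    the likelihood ratio is at least its value at k nu up to the slack |theta| d. *)
Lemma alt_pvalue_ge k t s nu d : Theta s ->
  2 * expR (- (k%:R * (s * nu - psi s - `|s| * d))) <= t ->
  ((expR (k%:R * (theta * nu - psi theta - `|theta| * d)))%:E *
     cpow F0 k [set x : mR | (`|x - k%:R * nu| <= k%:R * d)%R] <=
   alt_law k (small_pvalue k t))%E.
Proof.
move=> Ts st; set B := [set x : mR | _].
have mB : measurable B by exact: measurable_near.
have BM u (y : mR) : B y -> `|u * y - k%:R * (u * nu)| <= k%:R * (`|u| * d).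
  by move=> yB; rewrite mulrCA -mulrBr normrM mulrCA ler_wpM2l.
have sub : (B : set mR) `*` (`[0, 1]%classic : set mR) `<=` small_pvalue k t.
  move=> [y v] [/= yB]; rewrite in_itv/= => /andP[v0 v1].
  apply: le_trans st; rewrite /pvalue ler_pM2l// /upper_tail cpowE.
  set T := _ + _ * _.
  have fG A : measurable A -> cpow F0 k A \is a fin_num by exact: fin_num_measure.
  have mr b : measurable ([set` Interval (BSide b y) +oo%O] : set mR) by exact: measurable_itv.
  have ml : measurable (`]-oo, y]%classic : set mR) by exact: measurable_itv.
  have := BM s y yB; rewrite ler_distl => /andP[sy1 sy2].
  have bnd (A : set mR) : measurable A -> (forall x, A x -> s * y <= s * x) ->
      fine (cpow F0 k A) <= expR (- (k%:R * (s * nu - psi s - `|s| * d))).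
    move=> mA Ay; rewrite -lee_fin fineK ?fG//.
    apply: le_trans (cpow_chernoff k Ts mA Ay) _; rewrite lee_fin ler_expR.
    by rewrite !mulrBr; lra.
  rewrite ge_min; have [s0|s0] := leP 0 s.
    apply/orP; left; apply: le_trans (bnd `[y, +oo[%classic _ _); last 2 first.
    - exact: mr.
    - by move=> x; rewrite /= in_itv/= andbT => yx; rewrite ler_wpM2l.
    rewrite -(@setU1itv _ _ +oo%O y false)// measureU//; last first.
      by apply/seteqP; split => // x [/= -> ]; rewrite in_itv/= ltxx.
    rewrite fineD ?fG//.
    by rewrite /T [leRHS]addrC lerD2l ler_piMl// fine_ge0.
  apply/orP; right; apply: le_trans (bnd `]-oo, y]%classic _ _) => //; last first.
    by move=> x; rewrite /= in_itv/= => xy; rewrite ler_wnM2l// ltW.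
  apply: (@le_trans _ _ (1 - fine (cpow F0 k `]y, +oo[%classic))).
    by rewrite lerD2l lerN2 lerDl mulr_ge0// fine_ge0.
  rewrite lerBlDr -fineD ?fG//.
  rewrite -measureU//; last first.
    by apply/seteqP; split => // x [/=]; rewrite !in_itv/= andbT => /le_lt_trans h /h; rewrite ltxx.
  have -> : (`]-oo, y] `|` `]y, +oo[ = setT :> set mR)%classic.
    apply/seteqP; split => // x _ /=; rewrite !in_itv/= andbT.
    by case: (leP x y); [left|right].
  by rewrite [X in fine X]cpow_setT.
have mBU : measurable ((B : set mR) `*` (`[0, 1]%classic : set mR)).
  by apply: measurableX => //; exact: measurable_itv.
apply: (@le_trans _ _ (alt_law k ((B : set mR) `*` (`[0, 1]%classic : set mR)))); last first.
  by apply: le_measure; rewrite ?inE//; exact: measurable_small_pvalue.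
have -> : (alt_law k ((B : set mR) `*` (`[0%R, 1%R]%classic : set mR)) = cpow Ftheta k B)%E.
  transitivity (cpow Ftheta k B * U `[0%R, 1%R]%classic)%E.
    by apply: product_measure1E => //; exact: measurable_itv.
  by rewrite uniform01_itvc ?ler01 ?lexx// mule1.
rewrite cpow_Fexp//.
rewrite -integral_cst//.
apply: ge0_le_integral => //.
- by move=> x _; rewrite lee_fin expR_ge0.
- by apply: measurable_funTS; exact: measurable_expM.
- move=> x xB; rewrite lee_fin ler_expR.
  have := BM theta x xB; rewrite ler_distl => /andP[h1 _].
  by rewrite !mulrBr; lra.
Qed.

End pvalue_laws.

(** * Joint law of the observations *)

Section finite_measure_add.
Context d (T : measurableType d) (R : realType).
Variables m1 m2 : {finite_measure set T -> \bar R}.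

HB.instance Definition _ := Measure.on (measure_add m1 m2).

Let measure_add_fin : fin_num_fun (measure_add m1 m2).
Proof. by move=> A mA; rewrite measure_addE fin_numD !fin_num_measure. Qed.

HB.instance Definition _ :=
  Measure_isFinite.Build _ _ _ (measure_add m1 m2) measure_add_fin.

End finite_measure_add.

Lemma measurable_forall d (T : measurableType d) n (E : 'I_n -> set T) :
  (forall i, measurable (E i)) -> measurable [set w | forall i, E i w].
Proof.
move=> mE; rewrite (_ : [set w | _] = \bigcap_(i in [set: 'I_n]) E i).
  by apply: fin_bigcap_measurable => //; exact: finite_finset.
by apply/seteqP; split => w /= h i; [move=> _|]; exact: h.
Qed.

Lemma prode_D1 (R : realType) n (j : 'I_n) (f g : 'I_n -> \bar R) :
  (forall i, i != j -> f i = g i) ->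
  (\prod_(i < n) f i = (\prod_(i < n | i != j) g i) * f j)%E.
Proof. by move=> fg; rewrite (bigD1 j)//= muleC (eq_bigr _ fg). Qed.

Section product_formula.
Context {R : realType} (F0 : probability (measurableTypeR R) R) (theta : R).
Hypothesis Ttheta : Theta F0 theta.
Local Notation mR := (measurableTypeR R).
Local Notation U := (uniform_prob (@ltr01 R)).
Variables (pmf : nat -> R) (eps : R) (n : nat).
Context d (Om : measurableType d) (P : probability Om R).
Variables (K : 'I_n -> Om -> nat) (Y V : 'I_n -> Om -> mR).
Hypothesis PS : sample F0 theta pmf eps P K Y V.
Hypothesis eps01 : 0 <= eps <= 1.
Hypothesis pmf_ge0 : forall k, (0 < k)%N -> 0 <= pmf k.
Hypothesis pmf_pos : exists2 k, (0 < k)%N & 0 < pmf k.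

(** The law of (Y i, V i) given K i = k. *)
Definition mix_law k (D : set (mR * mR)) : \bar R :=
  ((1 - eps)%:E * null_law F0 k D + eps%:E * alt_law Ttheta k D)%E.

(** The law of one triple (K, Y, V), a set of triples being given by its
    sections at the values of K. *)
Definition obs_law (D : nat -> set (mR * mR)) : \bar R :=
  (\sum_(k <oo) (pmf k.+1)%:E * mix_law k.+1 (D k.+1))%E.

Definition obs_event (D : 'I_n -> nat -> set (mR * mR)) : set Om :=
  [set w | forall i, D i (K i w) (Y i w, V i w)].

Definition at_size k (E : set (mR * mR)) : nat -> set (mR * mR) :=
  fun k' => if k' == k then E else set0.

Let mD_at k E : measurable E -> forall k', measurable (at_size k E k').
Proof. by move=> mE k'; rewrite /at_size; case: ifP. Qed.

Lemma mix_law_ge0 k D : (0 <= mix_law k D)%E.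
Proof.
have /andP[e0 e1] := eps01.
by rewrite adde_ge0// mule_ge0// lee_fin// subr_ge0.
Qed.

Lemma mix_law_le1 k D : measurable D -> (mix_law k D <= 1)%E.
Proof.
move=> mD; have /andP[e0 e1] := eps01.
rewrite /mix_law; apply: (@le_trans _ _ ((1 - eps)%:E * 1 + eps%:E * 1)%E).
  by apply: leeD; apply: lee_wpmul2l; rewrite ?lee_fin ?subr_ge0//; exact: probability_le1.
by rewrite !mule1 -EFinD subrK.
Qed.

Lemma mix_law_setT k : mix_law k setT = 1%E.
Proof.
rewrite /mix_law [null_law _ _ _]probability_setT [alt_law _ _ _]probability_setT.
by rewrite !mule1 -EFinD subrK.
Qed.

Lemma mix_law_set0 k : mix_law k set0 = 0%E.
Proof. by rewrite /mix_law !measure0 !mule0 adde0. Qed.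

Lemma obs_law_at_size k E : (0 < k)%N ->
  obs_law (at_size k E) = ((pmf k)%:E * mix_law k E)%E.
Proof.
case: k => // k _; rewrite /obs_law.
rewrite (@nneseriesD1 _ _ k) //; last first.
  by move=> j _; rewrite mule_ge0 ?mix_law_ge0// lee_fin pmf_ge0.
rewrite /at_size eqxx eseries0 ?adde0// => j _ /=.
by rewrite eqSS => /negbTE ->; rewrite mix_law_set0 mule0.
Qed.

Lemma mixture_prodE k (A B : set mR) : measurable A -> measurable B ->
  (mixture F0 theta eps k A * U B = mix_law k (A `*` B))%E.
Proof.
move=> mA mB; rewrite /mixture /mix_law.
have -> : null_law F0 k (A `*` B) = (cpow F0 k A * U B)%E.
  exact: product_measure1E.
have -> : alt_law Ttheta k (A `*` B) = (cpow (Fexp_prob Ttheta) k A * U B)%E.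
  exact: product_measure1E.
rewrite cpowE (Fexp_probE Ttheta) cpowE.
have /andP[e0 e1] := eps01.
rewrite ge0_muleDl ?muleA// mule_ge0// lee_fin// subr_ge0//.
Qed.

Let mK i k : measurable [set w | K i w = k].
Proof.
have [mK _ _ _ _] := PS.
by have := mK i measurableT [set k] Logic.I; rewrite setTI.
Qed.

Let K_gt0 i w : (0 < K i w)%N.
Proof. by have [_ _ _ + _] := PS; exact. Qed.

Let mYV i : measurable_fun setT (fun w => (Y i w, V i w)).
Proof.
have [_ mY mV _ _] := PS.
by apply/measurable_fun_pairP; split; [exact: mY|exact: mV].
Qed.

Lemma measurable_obs (D : nat -> set (mR * mR)) i :
  (forall k, measurable (D k)) -> measurable [set w | D (K i w) (Y i w, V i w)].
Proof.
move=> mD.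
rewrite (_ : [set w | _] =
  \bigcup_k ([set w | K i w = k] `&` (fun w => (Y i w, V i w)) @^-1` D k)).
  apply: bigcup_measurable => k _; apply: measurableI => //.
  by rewrite -[X in measurable X]setTI; exact: mYV.
apply/seteqP; split => w /=; first by move=> h; exists (K i w).
by move=> [k _ [<-]].
Qed.

Lemma measurable_obs_event (D : 'I_n -> nat -> set (mR * mR)) :
  (forall i k, measurable (D i k)) -> measurable (obs_event D).
Proof. by move=> mD; apply: measurable_forall => i; exact: measurable_obs. Qed.

Definition upd (D : 'I_n -> nat -> set (mR * mR)) j E :=
  fun i => if i == j then E else D i.

Let obs_event_upd D j E : obs_event (upd D j E) =
  obs_event (upd D j (fun=> setT)) `&` [set w | E (K j w) (Y j w, V j w)].
Proof.
apply/seteqP; split => w; rewrite /obs_event/upd/=.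
  move=> h; split; last by have := h j; rewrite eqxx.
  by move=> i; have := h i; case: ifP.
by move=> [h1 h2] i; have := h1 i; case: eqVneq => [->|].
Qed.

Let rect (D : nat -> set (mR * mR)) : Prop :=
  exists k A B, [/\ (0 < k)%N, measurable A, measurable B &
    D = at_size k (A `*` B)].

Let obs_event_rect D : (forall i, rect (D i)) ->
  P (obs_event D) = (\prod_(i < n) obs_law (D i))%E.
Proof.
move=> Dr.
have /choice[k /choice[A /choice[B H]]] := Dr.
have [_ _ _ _ /(_ k A B)] := PS.
have k0 i : (0 < k i)%N by have [] := H i.
have mA i : measurable (A i) by have [] := H i.
have mB i : measurable (B i) by have [] := H i.
have DE i : D i = at_size (k i) (A i `*` B i) by have [] := H i.
move=> /(_ k0 mA mB).
rewrite (_ : [set w | _] = obs_event D); last first.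
  apply/seteqP; split => w /= h i; have := h i.
    by rewrite DE => -[-> Ai Bi]; rewrite /at_size eqxx.
  by rewrite DE /at_size; case: eqP => // -> [].
move=> ->; apply: eq_bigr => i _.
by rewrite DE obs_law_at_size// -mixture_prodE// muleA.
Qed.

Lemma obs_law_ge0 D : (0 <= obs_law D)%E.
Proof.
by apply: nneseries_ge0 => k _; rewrite mule_ge0 ?mix_law_ge0// lee_fin pmf_ge0.
Qed.

Let step D j : (forall i k, measurable (D i k)) ->
  (forall E, rect E -> P (obs_event (upd D j E)) =
     ((\prod_(i < n | i != j) obs_law (D i)) * obs_law E)%E) ->
  forall E, (forall k, measurable (E k)) -> P (obs_event (upd D j E)) =
     ((\prod_(i < n | i != j) obs_law (D i)) * obs_law E)%E.
Proof.
move=> mD; set Q := (\prod_(i < n | _) _)%E => rE.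
have Q0 : (0 <= Q)%E by apply: prode_ge0 => i _; exact: obs_law_ge0.
have mupd E : (forall k, measurable (E k)) -> forall i k, measurable (upd D j E i k).
  by move=> mE i k; rewrite /upd; case: ifP.
have rectT k : (0 < k)%N -> rect (at_size k setT).
  by move=> k0; exists k, setT, setT; split; rewrite ?setXTT.
have fQ : Q \is a fin_num.
  have [k k0 pk] := pmf_pos.
  have := rE _ (rectT _ k0); rewrite obs_law_at_size// mix_law_setT mule1 => PE.
  rewrite ge0_fin_numE// ltNge; apply/negP => Qoo.
  have := probability_le1 P (measurable_obs_event (mupd (at_size k setT) (fun k' => mD_at k measurableT k'))).
  rewrite PE; move: Qoo; rewrite leye_eq => /eqP ->.
  by rewrite gt0_mulye ?lte_fin.
have fixed k E : (0 < k)%N -> measurable E -> P (obs_event (upd D j (at_size k E))) =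
    (Q * ((pmf k)%:E * mix_law k E))%E.
  move=> k0 mE.
  pose C := obs_event (upd D j (at_size k setT)).
  have mC : measurable C by apply: measurable_obs_event; apply: mupd; exact: mD_at.
  have PC E' : obs_event (upd D j (at_size k E')) =
      C `&` (fun w => (Y j w, V j w)) @^-1` E'.
    rewrite /C obs_event_upd [in RHS]obs_event_upd -setIA; congr (_ `&` _).
    apply/seteqP; split => w; rewrite /at_size/=; first by case: ifP.
    by case: ifP => // _ [].
  have /andP[e0 e1] := eps01.
  have c0 : 0 <= fine Q * pmf k * (1 - eps).
    by rewrite !mulr_ge0 ?fine_ge0 ?pmf_ge0 ?subr_ge0.
  have c1 : 0 <= fine Q * pmf k * eps by rewrite !mulr_ge0 ?fine_ge0 ?pmf_ge0.
  pose m1 : {finite_measure set mR -> \bar R} :=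
    measure_add (mscale (NngNum c0) (cpow F0 k))
      (mscale (NngNum c1) (cpow (Fexp_prob Ttheta) k)).
  pose m' := pushforward (mrestr P mC) (fun w => (Y j w, V j w)).
  have m'E E' : m' E' = P (obs_event (upd D j (at_size k E'))).
    by rewrite PC /m' /pushforward /mrestr setIC.
  have QE E' : (Q * ((pmf k)%:E * mix_law k E') =
      (fine Q * pmf k * (1 - eps))%:E * null_law F0 k E' +
      (fine Q * pmf k * eps)%:E * alt_law Ttheta k E')%E.
    rewrite -[in LHS](fineK fQ) muleA -EFinM /mix_law.
    by rewrite ge0_muleDr ?muleA -?EFinM// mule_ge0// lee_fin subr_ge0.
  transitivity ((m1 \x U)%E E); last first.
    rewrite QE /product_measure1.
    rewrite ge0_integral_measure_add//; last exact: measurable_fun_xsection.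
    rewrite ge0_integral_mscale//; last exact: measurable_fun_xsection.
    rewrite ge0_integral_mscale//; last exact: measurable_fun_xsection.
  rewrite -m'E; symmetry.
  pose M : {measure set (mR * mR) -> \bar R} :=
    measure_function_pushforward__canonical__measure_function_Measure
      (mrestr P mC) (mYV j).
  have MU (A B : set mR) : measurable A -> measurable B ->
      (M (A `*` B) = m1 A * U B)%E.
    move=> mA mB; transitivity (m' (A `*` B)); first by [].
    rewrite m'E rE; last by exists k, A, B.
    rewrite obs_law_at_size// QE.
    transitivity (((fine Q * pmf k * (1 - eps))%:E * cpow F0 k A +
      (fine Q * pmf k * eps)%:E * cpow (Fexp_prob Ttheta) k A) * U B)%E; last first.
      by congr (_ * _)%E; rewrite /m1 /= measure_addE.
    rewrite ge0_muleDl ?mule_ge0 ?lee_fin//.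
    by rewrite -!muleA; congr (_ * _ + _ * _)%E; exact: product_measure1E.
  exact: (@product_measure_unique _ _ _ _ R m1 U M MU E mE).
move=> E mE.
rewrite (_ : obs_event (upd D j E) =
    \bigcup_k obs_event (upd D j (at_size k.+1 (E k.+1)))); last first.
  apply/seteqP; split => w.
    rewrite obs_event_upd => -[h1 h2]; exists (K j w).-1 => //.
    rewrite obs_event_upd; split => //=.
    by rewrite /at_size prednK ?K_gt0// eqxx.
  move=> [k _]; rewrite obs_event_upd => -[h1 h2].
  rewrite obs_event_upd; split => //; move: h2; rewrite /at_size/=.
  by case: eqP => // ->.
rewrite measure_bigcup//.
- rewrite (eq_eseriesl (Q:=xpredT)); last by move=> k; rewrite in_setT.
  rewrite (eq_eseriesr (g:=fun k => (Q * ((pmf k.+1)%:E * mix_law k.+1 (E k.+1)))%E)).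
    rewrite -[X in (_ = X * _)%E](fineK fQ) -nneseriesZl//; last first.
      by move=> k _; rewrite mule_ge0 ?mix_law_ge0// lee_fin pmf_ge0.
    by rewrite fineK.
  by move=> k _; exact: fixed.
- by move=> k _; apply: measurable_obs_event; apply: mupd; exact: mD_at.
- have Kk (k : nat) w : obs_event (upd D j (at_size k.+1 (E k.+1))) w -> K j w = k.+1.
    by move=> /(_ j); rewrite /upd eqxx /at_size; case: eqP.
  apply/trivIsetP => k k' _ _ /eqP kk'; apply/seteqP; split => // w [/Kk e1 /Kk e2].
  by apply: kk'; apply: succn_inj; rewrite -e1.
Qed.

#[local] Opaque obs_law obs_event.

(** Independence, extended from rectangles to all measurable events. The
    coordinates are treated one by one: at a fixed size k both sides are finite
    measures in the section of one coordinate, equal on rectangles and hence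
    everywhere, and a sum over k gives all sets of triples. *)
Theorem obs_event_prob D : (forall i k, measurable (D i k)) ->
  P (obs_event D) = (\prod_(i < n) obs_law (D i))%E.
Proof.
suff H m : (m <= n)%N -> forall D, (forall i k, measurable (D i k)) ->
    (forall i : 'I_n, (m <= i)%N -> rect (D i)) ->
    P (obs_event D) = (\prod_(i < n) obs_law (D i))%E.
  by move=> mD; apply: (H n) => // i; rewrite leqNgt ltn_ord.
elim: m => [|m IH] mn {}D mD Dr.
  by apply: obs_event_rect => i; exact: Dr.
pose j := Ordinal mn.
have updj E : (\prod_(i < n) obs_law (upd D j E i) =
    (\prod_(i < n | i != j) obs_law (D i)) * obs_law E)%E.
  have := @prode_D1 R n j (fun i => obs_law (upd D j E i)) (fun i => obs_law (D i)).
  cbv beta.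
  have e1 : obs_law (upd D j E j) = obs_law E by rewrite /upd eqxx; reflexivity.
  rewrite e1; apply.
  by move=> i /negbTE ij; rewrite /upd ij; reflexivity.
have Dj : D = upd D j (D j).
  by apply/funext => i; rewrite /upd; case: eqVneq => [->|].
have IHj E : rect E -> P (obs_event (upd D j E)) =
    ((\prod_(i < n | i != j) obs_law (D i)) * obs_law E)%E.
  move=> rE; rewrite -updj; apply: IH; first exact: ltnW.
    move=> i k; rewrite /upd; case: ifP => _; last exact: mD.
    have [k' [A [B [_ mA mB ->]]]] := rE.
    by apply: mD_at; exact: measurableX.
  move=> i mi; rewrite /upd; case: eqVneq => [_|ij]; first exact: rE.
  apply: Dr; rewrite ltn_neqAle mi andbT.
  by apply: contra ij => /eqP im; apply/eqP/val_inj.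
have := step mD IHj (mD j); rewrite -updj -Dj => ->; reflexivity.
Qed.

End product_formula.

(** * Conditioning on the vector of sample sizes *)

(** Factors in [0, 1] are replaced one at a time, each at a cost of at most a i. *)
Lemma prod_le_sum (R : realType) (I : Type) (s : seq I) (u v a : I -> R) :
  (forall i, 0 <= u i <= 1) -> (forall i, 0 <= v i <= 1) ->
  (forall i, 0 <= a i) -> (forall i, u i <= v i + a i) ->
  \prod_(i <- s) u i <= \prod_(i <- s) v i + \sum_(i <- s) a i.
Proof.
move=> u01 v01 a0 uva.
have p01 (w : I -> R) r : (forall i, 0 <= w i <= 1) -> 0 <= \prod_(i <- r) w i <= 1.
  move=> w01; apply: (big_ind (fun x => 0 <= x <= 1)) => //; first by rewrite ler01 lexx.
  by move=> x y /andP[x0 x1] /andP[y0 y1]; rewrite mulr_ge0//= mulr_ile1.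
elim: s => [|i s IH]; first by rewrite !big_nil addr0.
rewrite !big_cons.
have /andP[u0 u1] := u01 i; have /andP[v0 v1] := v01 i.
have /andP[pu0 pu1] := p01 _ s u01; have /andP[pv0 pv1] := p01 _ s v01.
have := a0 i; have := uva i.
set A := \prod_(j <- s) u j in IH pu0 pu1 *; set B := \prod_(j <- s) v j in IH pv0 pv1 *.
set C := \sum_(j <- s) a j in IH *.
have C0 : 0 <= C by apply: sumr_ge0.
move=> h1 h2.
have e1 : (u i - v i) * A <= a i.
  have [h|h] := leP (u i - v i) 0; first by apply: le_trans h2; rewrite mulr_le0_ge0.
  by apply: (@le_trans _ _ ((u i - v i) * 1)); [rewrite ler_wpM2l// ltW|lra].
have e2 : v i * (A - B) <= C.
  have [h|h] := leP (A - B) 0; first by apply: le_trans C0; rewrite mulr_ge0_le0.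
  by apply: (@le_trans _ _ (1 * (A - B))); [rewrite ler_wpM2r// ltW|lra].
have -> : u i * A = v i * B + ((u i - v i) * A + v i * (A - B)) by ring.
by rewrite lerD2l lerD.
Qed.

Lemma lt_bigmin_ereal (R : realType) n (c : R) (x : 'I_n -> R) :
  (c%:E < \big[Order.min/+oo]_(i < n) (x i)%:E)%E <-> (forall i, c < x i).
Proof.
rewrite (_ : (forall i, c < x i) <-> forall i, i \in index_enum 'I_n -> c < x i); last first.
  by split => h i //; apply: h; rewrite mem_index_enum.
elim: (index_enum _) => [|i s IH]; first by rewrite big_nil ltry.
rewrite big_cons lt_min lte_fin; split.
  move=> /andP[h1 /IH h2] j; rewrite inE => /orP[/eqP ->//|]; exact: h2.
move=> h; rewrite h ?mem_head//=; apply/IH => j js; apply: h.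
by rewrite inE js orbT.
Qed.

Section vector_partition.
Context {R : realType} d (Om : measurableType d) (n : nat).
Variable K : 'I_n -> Om -> nat.
Hypothesis mK : forall i, measurable_fun setT (K i).
Hypothesis K_gt0 : forall i w, (0 < K i w)%N.

Definition Kvec (w : Om) : {ffun 'I_n -> nat} := [ffun i => K i w].

(** The vectors of sizes form a countable type. *)
Lemma measurable_Kvec (E : set {ffun 'I_n -> nat}) :
  measurable [set w | E (Kvec w)].
Proof.
have m1 kv : measurable [set w | Kvec w = kv].
  rewrite (_ : [set w | _] = [set w | forall i, K i w = kv i]).
    apply: measurable_forall => i.
    by have := mK i measurableT (Y:=[set kv i]) Logic.I; rewrite setTI.
  apply/seteqP; split => w /=; first by move=> <- i; rewrite ffunE.
  by move=> h; apply/ffunP => i; rewrite ffunE h.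
rewrite (_ : [set w | _] = \bigcup_m
    [set w | E (Kvec w) /\ pickle (Kvec w) = m]).
  apply: bigcup_measurable => m _.
  have [[kv Ekv km]|nE] := pselect (exists2 kv, E kv & pickle kv = m).
    rewrite (_ : [set w | _] = [set w | Kvec w = kv])//.
    apply/seteqP; split => w /=.
      by move=> [_]; rewrite -km; exact: (pcan_inj pickleK).
    by move=> ->.
  rewrite (_ : [set w | _] = set0)//; apply/seteqP; split => // w /= [Ew ew].
  by apply: nE; exists (Kvec w).
apply/seteqP; split => w /=; first by move=> Ew; exists (pickle (Kvec w)).
by move=> [m _ []].
Qed.

Lemma measurable_fun_Kvec (h : {ffun 'I_n -> nat} -> R) :
  measurable_fun setT (fun w => h (Kvec w)).
Proof.
move=> _ B mB; rewrite setTI.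
exact: (measurable_Kvec [set kv | B (h kv)]).
Qed.

(** Summation over the countably many vectors of sizes: a comparison given the
    sizes integrates to an unconditional one. *)
Lemma le_measure_Kvec (P P' P'' : {measure set Om -> \bar R}) (A B : set Om)
    (h : {ffun 'I_n -> nat} -> R) :
  measurable A -> measurable B -> (forall kv, 0 <= h kv) ->
  (forall kv : {ffun 'I_n -> nat}, (forall i, (0 < kv i)%N) ->
    (P (A `&` [set w | Kvec w = kv]) <=
     P' (B `&` [set w | Kvec w = kv]) + (h kv)%:E * P'' [set w | Kvec w = kv])%E) ->
  (P A <= P' B + \int[P'']_w (h (Kvec w))%:E)%E.
Proof.
move=> mA mB h0 H.
pose X m := [set w | pickle (Kvec w) = m].
have mX m : measurable (X m).
  exact: (measurable_Kvec [set kv | pickle kv = m]).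
have tX : trivIset setT X.
  by apply/trivIsetP => m m' _ _ /eqP mm'; apply/seteqP; split => // w [/= e1 e2]; apply: mm'; rewrite -e1.
have UX : \bigcup_m X m = setT.
  by apply/seteqP; split => // w _; exists (pickle (Kvec w)).
have dec (Q : {measure set Om -> \bar R}) C : measurable C ->
    Q C = (\sum_(m <oo) Q (C `&` X m))%E.
  move=> mC; rewrite -[in LHS](setIT C) -UX setI_bigcupr measure_bigcup//.
  - by rewrite (eq_eseriesl (Q:=xpredT))// => m; rewrite in_setT.
  - by move=> m _; exact: measurableI.
  - exact: trivIset_setIl.
rewrite (dec P A)// (dec P' B)// -UX ge0_integral_bigcup//; last 2 first.
- rewrite UX; apply/measurable_EFinP; exact: measurable_fun_Kvec.
- by move=> w _; rewrite lee_fin.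
rewrite -nneseriesD//; last first.
  by move=> m _ _; apply: integral_ge0 => w _; rewrite lee_fin.
apply: lee_nneseries => // m _.
have [[w0 Xw0]|nX] := pselect (exists w, X m w); last first.
  have -> : X m = set0 by apply/seteqP; split => // w Xw; apply: nX; exists w.
  by rewrite !setI0 !measure0 add0e integral_set0.
have XE : X m = [set w | Kvec w = Kvec w0].
  apply/seteqP; split => w; rewrite /X /=; last by move=> ->.
  by rewrite -Xw0; exact: (pcan_inj pickleK).
have -> : (\int[P'']_(w in X m) (h (Kvec w))%:E = (h (Kvec w0))%:E * P'' (X m))%E.
  rewrite -integral_cst//; apply: eq_integral => w; rewrite inE XE /= => -> //.
rewrite XE; apply: H => i; rewrite ffunE; exact: K_gt0.
Qed.

End vector_partition.

Section one_sample.
Context {R : realType} (F0 : probability (measurableTypeR R) R) (theta : R).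
Hypothesis Ttheta : Theta F0 theta.
Local Notation mR := (measurableTypeR R).
Variables (pmf : nat -> R) (eps : R) (n : nat).
Context d (Om : measurableType d) (P : probability Om R).
Variables (K : 'I_n -> Om -> nat) (Y V : 'I_n -> Om -> mR).
Hypothesis PS : sample F0 theta pmf eps P K Y V.
Hypothesis eps01 : 0 <= eps <= 1.
Hypothesis pmf_ge0 : forall k, (0 < k)%N -> 0 <= pmf k.
Hypothesis pmf_pos : exists2 k, (0 < k)%N & 0 < pmf k.
Hypothesis n_gt0 : (0 < n)%N.

Local Notation obs_law := (obs_law Ttheta pmf eps).
Local Notation obs_event := (obs_event K Y V).
Local Notation mix_law := (mix_law Ttheta eps).
Local Notation Kv := (Kvec K).

Let probE D (mD : forall i k, measurable (D i k)) :=
  obs_event_prob Ttheta PS eps01 pmf_ge0 pmf_pos mD.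

Lemma sample_mK i : measurable_fun setT (K i).
Proof. by have [mK _ _ _ _] := PS; exact: mK. Qed.

Lemma sample_K_gt0 i w : (0 < K i w)%N.
Proof. by have [_ _ _ K0 _] := PS; exact: K0. Qed.

(** By the product formula 1 is the n-th power of the total mass of one triple.
    It amounts to pmf having sum 1. *)
Lemma obs_law_setT : obs_law (fun=> setT) = 1%E.
Proof.
have := @probE (fun _ _ => setT) (fun _ _ => measurableT).
rewrite (_ : obs_event _ = setT); last by apply/seteqP; split.
rewrite probability_setT.
set x := obs_law _ => e.
have x0 : (0 <= x)%E by exact: (obs_law_ge0 Ttheta eps01 pmf_ge0).
move: x0 e; case: x => [r|//|//]; last first.
  move=> _; case: n n_gt0 => // m _; rewrite big_ord_recl => e.
  have : (1 <= \prod_(i < m) +oo%E :> \bar R)%E.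
    by apply: (big_ind (fun x => 1 <= x)%E) => //; [move=> x y x1 y1; rewrite -[1%E]mule1 lee_pmul|rewrite leey].
  by move=> h; move: e; rewrite gt0_mulye// (lt_le_trans _ h).
rewrite lee_fin => r0; rewrite prodEFin big_const_ord iter_mulr mulr1 => -[] /esym/eqP.
by rewrite pexpr_eq1// => /eqP ->.
Qed.

Lemma obs_law_one i (D : nat -> set (mR * mR)) : (forall k, measurable (D k)) ->
  P [set w | D (K i w) (Y i w, V i w)] = obs_law D.
Proof.
move=> mD; pose D' (j : 'I_n) := if j == i then D else fun=> setT.
have mD' j k : measurable (D' j k) by rewrite /D'; case: ifP => _; [exact: mD|].
have -> : [set w | D (K i w) (Y i w, V i w)] = obs_event D'.
  apply/seteqP; split => w.
    by move=> h j; rewrite /D'; case: eqP => [->|].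
  by move=> /(_ i); rewrite /D' eqxx.
rewrite probE//.
have e (j : 'I_n) : j != i -> obs_law (D' j) = 1%E.
  by move=> /negbTE ji; rewrite /D' ji obs_law_setT.
have := @prode_D1 R n i (fun j => obs_law (D' j)) (fun=> 1%E) e.
cbv beta => ->.
rewrite big1; last by move=> j _; reflexivity.
by rewrite mul1e /D' eqxx.
Qed.

Lemma size_prob i k : (0 < k)%N -> P [set w | K i w = k] = (pmf k)%:E.
Proof.
move=> k0.
have := @obs_law_one i (at_size k setT).
rewrite (_ : [set w | _] = [set w | K i w = k]); last first.
  by apply/seteqP; split => w; rewrite /at_size/=; case: eqP.
move=> ->; last by move=> k'; rewrite /at_size; case: ifP.
by rewrite obs_law_at_size// mix_law_setT mule1.
Qed.

Lemma pmf_le1 k : (0 < k)%N -> pmf k <= 1.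
Proof.
move=> k0; rewrite -lee_fin -(size_prob (Ordinal n_gt0) k0).
apply: probability_le1.
by have := sample_mK (Ordinal n_gt0) measurableT (Y:=[set k]) Logic.I; rewrite setTI.
Qed.

Lemma size_tail_prob i m : P [set w | (m <= K i w)%N] =
  (\sum_(k <oo) (if (m <= k.+1)%N then pmf k.+1 else 0)%:E)%E.
Proof.
have := @obs_law_one i (fun k => if (m <= k)%N then setT else set0).
rewrite (_ : [set w | _] = [set w | (m <= K i w)%N]); last first.
  by apply/seteqP; split => w /=; case: leqP.
move=> ->; last by move=> k; case: leqP.
rewrite /Submission.obs_law; apply: eq_eseriesr => k _.
by case: ifP => _; rewrite ?mix_law_setT ?mix_law_set0 ?mule1 ?mule0.
Qed.

Lemma vector_prob (kv : {ffun 'I_n -> nat}) (E : 'I_n -> set (mR * mR)) :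
  (forall i, (0 < kv i)%N) -> (forall i, measurable (E i)) ->
  P ([set w | forall i, E i (Y i w, V i w)] `&` [set w | Kv w = kv]) =
  (\prod_(i < n) ((pmf (kv i))%:E * mix_law (kv i) (E i)))%E.
Proof.
move=> k0 mE.
have -> : [set w | forall i, E i (Y i w, V i w)] `&` [set w | Kv w = kv] =
    obs_event (fun i => at_size (kv i) (E i)).
  apply/seteqP; split => w.
    by move=> [h /= <-] i; rewrite /at_size ffunE eqxx.
  move=> h; have {}h i : K i w = kv i /\ E i (Y i w, V i w).
    by have := h i; rewrite /at_size; case: eqP.
  by split => [i|/=]; [have [] := h i|apply/ffunP => i; rewrite ffunE; have [] := h i].
rewrite probE; last by move=> i k; rewrite /at_size; case: ifP.
apply: eq_bigr => i _; rewrite obs_law_at_size//.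
Qed.

Lemma vector_prob0 (kv : {ffun 'I_n -> nat}) : (forall i, (0 < kv i)%N) ->
  P [set w | Kv w = kv] = (\prod_(i < n) (pmf (kv i)))%:E.
Proof.
move=> k0; have := @vector_prob kv (fun=> setT) k0 (fun=> measurableT).
rewrite (_ : [set w | forall i, _] = setT); last by apply/seteqP; split.
rewrite setTI => ->; rewrite -prodEFin; apply: eq_bigr => i _.
by rewrite mix_law_setT mule1.
Qed.

Lemma no_hit_prob k (E : set (mR * mR)) : (0 < k)%N -> measurable E ->
  (P [set w | forall i, ~ (K i w = k /\ E (Y i w, V i w))] <=
   ((1 - pmf k * fine (mix_law k E)) ^+ n)%:E)%E.
Proof.
move=> k0 mE.
pose D k' := ~` at_size k E k'.
have mA k' : measurable (at_size k E k') by rewrite /at_size; case: ifP.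
have mD k' : measurable (D k') by exact: measurableC.
have -> : [set w | forall i, ~ (K i w = k /\ E (Y i w, V i w))] = obs_event (fun=> D).
  apply/seteqP; split => w h i.
    by have := h i; rewrite /D /at_size /=; case: eqP => // Kk h1 h2; apply: h1.
  by move=> [Kk Ei]; have := h i; rewrite /D /at_size /= Kk eqxx.
rewrite probE//.
have fm : mix_law k E \is a fin_num.
  rewrite ge0_fin_numE ?mix_law_ge0//.
  by apply: le_lt_trans (mix_law_le1 Ttheta eps01 k mE) _; rewrite ltry.
have m0 : 0 <= fine (mix_law k E) by rewrite fine_ge0 ?mix_law_ge0.
have sumD : (obs_law D + (pmf k * fine (mix_law k E))%:E = 1)%E.
  rewrite -(obs_law_one (Ordinal n_gt0) mD) EFinM fineK//.
  rewrite -(obs_law_at_size Ttheta eps01 pmf_ge0 E k0).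
  rewrite -(obs_law_one (Ordinal n_gt0) mA) -measureU.
  - rewrite (_ : _ `|` _ = setT); first exact: probability_setT.
    by apply/seteqP; split => // w _; rewrite /D/=; case: (pselect (at_size k E (K (Ordinal n_gt0) w) (Y (Ordinal n_gt0) w, V (Ordinal n_gt0) w))); [right|left].
  - exact: (measurable_obs PS _ mD).
  - exact: (measurable_obs PS _ mA).
  - by apply/seteqP; split => // w [/= h1 h2]; exact: h1.
have -> : obs_law D = (1 - pmf k * fine (mix_law k E))%:E.
  by rewrite EFinB -sumD addeK.
by rewrite prodEFin big_const_ord iter_mulr mulr1.
Qed.

End one_sample.

(** * Minima of weighted p-values *)

Section weighted_minimum.
Context {R : realType} (F0 : probability (measurableTypeR R) R) (theta : R).
Hypothesis Ttheta : Theta F0 theta.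
Local Notation mR := (measurableTypeR R).
Variables (pmf : nat -> R) (eps : R) (n : nat).
Context d (Om : measurableType d) (P0 P1 : probability Om R).
Variables (K : 'I_n -> Om -> nat) (Y V : 'I_n -> Om -> mR).
Hypothesis S0 : sample F0 theta pmf 0 P0 K Y V.
Hypothesis S1 : sample F0 theta pmf eps P1 K Y V.
Hypothesis eps01 : 0 <= eps <= 1.
Hypothesis pmf_ge0 : forall k, (0 < k)%N -> 0 <= pmf k.
Hypothesis pmf_pos : exists2 k, (0 < k)%N & 0 < pmf k.
Hypothesis n_gt0 : (0 < n)%N.
Variable W : {ffun 'I_n -> nat} -> 'I_n -> nat.
Hypothesis W_gt0 : forall kv i, (0 < W kv i)%N.

Local Notation Kv := (Kvec K).

(** Common form of both test statistics. As the weights are functions of the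
    vector of sizes, acceptance is a product event given the sizes. *)
Definition weighted_min (w : Om) : \bar R :=
  \big[Order.min/+oo%E]_(i < n) ((W (Kv w) i)%:R * pval F0 K Y V i w)%:E.

Definition accept (c : R) : set Om := [set w | (c%:E < weighted_min w)%E].

Definition alt_power k (t : R) : R := fine (alt_law Ttheta k (small_pvalue F0 k t)).
Definition null_power k (t : R) : R := fine (null_law F0 k (small_pvalue F0 k t)).

Let zero01 : 0 <= (0 : R) <= 1. Proof. by rewrite lexx ler01. Qed.

Let W0 kv i : 0 < (W kv i)%:R :> R. Proof. by rewrite ltr0n. Qed.

Lemma alt_power_ge0 k t : 0 <= alt_power k t.
Proof. by rewrite /alt_power fine_ge0. Qed.

Lemma alt_powerE k t :
  alt_law Ttheta k (small_pvalue F0 k t) = (alt_power k t)%:E.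
Proof. by rewrite fineK// fin_num_measure//; exact: measurable_small_pvalue. Qed.

Lemma null_powerE k t :
  null_law F0 k (small_pvalue F0 k t) = (null_power k t)%:E.
Proof. by rewrite fineK// fin_num_measure//; exact: measurable_small_pvalue. Qed.

Lemma alt_power_le1 k t : alt_power k t <= 1.
Proof.
rewrite -lee_fin -alt_powerE; apply: probability_le1.
exact: measurable_small_pvalue.
Qed.

Lemma null_power_le1 k t : null_power k t <= 1.
Proof.
rewrite -lee_fin -null_powerE; apply: probability_le1.
exact: measurable_small_pvalue.
Qed.

Lemma le_alt_power k t t' : t <= t' -> alt_power k t <= alt_power k t'.
Proof.
move=> tt'; rewrite -lee_fin -!alt_powerE.
have sub : small_pvalue F0 k t `<=` small_pvalue F0 k t'.
  by move=> z /= /le_trans; apply.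
have ms u := mem_set (measurable_small_pvalue F0 k u).
exact: (le_measure (alt_law Ttheta k) (ms t) (ms t') sub).
Qed.

Definition accept_region k (t : R) : set (mR * mR) := ~` small_pvalue F0 k t.

Lemma measurable_accept_region k t : measurable (accept_region k t).
Proof. by apply: measurableC; exact: measurable_small_pvalue. Qed.

Lemma accept_vectorE c (kv : {ffun 'I_n -> nat}) :
  accept c `&` [set w | Kv w = kv] =
  [set w | forall i, accept_region (kv i) (c / (W kv i)%:R) (Y i w, V i w)]
    `&` [set w | Kv w = kv].
Proof.
apply/seteqP; split => w [+ /= wk]; rewrite /accept /weighted_min/= wk.
  move=> /lt_bigmin_ereal h; split => // i.
  move: (h i); rewrite /pval /accept_region /= -wk ffunE => h1.
  by apply/negP; rewrite -ltNge ltr_pdivrMr// mulrC wk.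
move=> h; split => //; apply/lt_bigmin_ereal => i.
have /= := h i; rewrite /accept_region/= => /negP; rewrite -ltNge.
by rewrite ltr_pdivrMr// mulrC /pval -wk ffunE.
Qed.

Lemma measurable_accept c : measurable (accept c).
Proof.
rewrite (_ : accept c = \bigcup_m (accept c `&` [set w | pickle (Kv w) = m])); last first.
  by apply/seteqP; split => w; [move=> h; exists (pickle (Kv w))|move=> [m _ []]].
apply: bigcup_measurable => m _.
have [[kv km]|nE] := pselect (exists kv : {ffun 'I_n -> nat}, pickle kv = m); last first.
  rewrite (_ : [set w | _] = set0) ?setI0//; apply/seteqP; split => // w /= e.
  by apply: nE; exists (Kv w).
rewrite (_ : [set w | _] = [set w | Kv w = kv]); last first.
  by apply/seteqP; split => w /=; rewrite -km; [exact: (pcan_inj pickleK)|move=> ->].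
rewrite accept_vectorE; apply: measurableI.
  apply: measurable_forall => i.
  have [_ mY mV _ _] := S0.
  have mYV : measurable_fun setT (fun w => (Y i w, V i w)).
    by apply/measurable_fun_pairP; split; [exact: mY|exact: mV].
  have := mYV measurableT _ (measurable_accept_region (kv i) (c / (W kv i)%:R)).
  by rewrite setTI.
exact: (measurable_Kvec (sample_mK S0) [set kv' | kv' = kv]).
Qed.

Let mvec kv : measurable [set w | Kv w = kv].
Proof. exact: (measurable_Kvec (sample_mK S0) [set kv' | kv' = kv]). Qed.

Lemma mix_accept e k t : (0 <= e <= 1) ->
  mix_law Ttheta e k (accept_region k t) =
  ((1 - e) * (1 - null_power k t) + e * (1 - alt_power k t))%:E.
Proof.
move=> e01; rewrite /mix_law /accept_region.
have mS := @measurable_small_pvalue R F0 k t.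
have -> : null_law F0 k (~` small_pvalue F0 k t) = (1 - null_power k t)%:E.
  by rewrite EFinB -null_powerE; exact: probability_setC.
have -> : alt_law Ttheta k (~` small_pvalue F0 k t) = (1 - alt_power k t)%:E.
  by rewrite EFinB -alt_powerE; exact: probability_setC.
by rewrite -!EFinM -EFinD.
Qed.

Lemma accept_vector_prob (P : probability Om R) e c (kv : {ffun 'I_n -> nat}) :
  0 <= e <= 1 -> sample F0 theta pmf e P K Y V -> (forall i, (0 < kv i)%N) ->
  P (accept c `&` [set w | Kv w = kv]) =
  ((\prod_(i < n) ((1 - e) * (1 - null_power (kv i) (c / (W kv i)%:R)) +
     e * (1 - alt_power (kv i) (c / (W kv i)%:R)))) * \prod_(i < n) pmf (kv i))%:E.
Proof.
move=> e01 PS k0; rewrite accept_vectorE.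
have mE i : measurable (accept_region (kv i) (c / (W kv i)%:R)).
  exact: measurable_accept_region.
rewrite (vector_prob Ttheta PS e01 pmf_ge0 pmf_pos k0 mE).
rewrite -big_split -prodEFin; apply: eq_bigr => i _.
by rewrite mix_accept// -EFinM mulrC.
Qed.

Lemma vector_probE (P : probability Om R) e (kv : {ffun 'I_n -> nat}) :
  0 <= e <= 1 -> sample F0 theta pmf e P K Y V -> (forall i, (0 < kv i)%N) ->
  P [set w | Kv w = kv] = (\prod_(i < n) pmf (kv i))%:E.
Proof. by move=> e01 PS k0; rewrite (vector_prob0 Ttheta PS e01 pmf_ge0 pmf_pos). Qed.

(** Union bound given the sizes. *)
Lemma null_reject_le c b : 0 <= c ->
  (forall kv, \sum_(i < n) c / (W kv i)%:R <= b) ->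
  (P0 (~` accept c) <= b%:E)%E.
Proof.
move=> c0 Hb.
have b0 : 0 <= b.
  by apply: le_trans (Hb [ffun=> 0]); apply: sumr_ge0 => i _; rewrite divr_ge0.
have mA := measurable_accept c.
have := @le_measure_Kvec R d Om n K (sample_mK S0) (sample_K_gt0 S0) P0 P0 P0
  (~` accept c) set0 (fun=> b) (measurableC mA) measurable0 (fun=> b0).
have H (kv : {ffun 'I_n -> nat}) : (forall i, (0 < kv i)%N) ->
    (P0 (~` accept c `&` [set w | Kv w = kv]) <=
     P0 (set0 `&` [set w | Kv w = kv]) + b%:E * P0 [set w | Kv w = kv])%E.
  move=> k0; rewrite set0I measure0 add0e.
  have split_eq : (P0 [set w | Kv w = kv] = P0 (accept c `&` [set w | Kv w = kv]) +
      P0 (~` accept c `&` [set w | Kv w = kv]))%E.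
    rewrite -measureU; [|exact: measurableI|by apply: measurableI => //; exact: measurableC|].
      by rewrite -setIUl setUv setTI.
    by apply/seteqP; split => // w [[h1 _] [h2 _]]; exact: h2.
  have := split_eq.
  rewrite (accept_vector_prob c zero01 S0 k0) (vector_probE zero01 S0 k0) => e.
  have fin : P0 (~` accept c `&` [set w | Kv w = kv]) \is a fin_num.
    by apply: fin_num_measure; apply: measurableI => //; exact: measurableC.
  move: e; rewrite -(fineK fin) -EFinD -EFinM lee_fin => -[].
  set q := \prod_(i < n) pmf (kv i); set x := fine _; set p := \prod_(i < n) _.
  have q0 : 0 <= q by apply: prodr_ge0 => i _; exact: pmf_ge0.
  have p1 : 1 <= p + b.
    apply: le_trans (lerD (lexx p) (Hb kv)).
    rewrite -[leLHS](_ : \prod_(i < n) 1 = 1 :> R); last by rewrite big1.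
    apply: prod_le_sum.
    - by move=> i; rewrite ler01 lexx.
    - move=> i; rewrite subr0 mul1r mul0r addr0.
      have := null_power_le1 (kv i) (c / (W kv i)%:R).
      have : 0 <= null_power (kv i) (c / (W kv i)%:R) by rewrite /null_power fine_ge0.
      by move=> *; lra.
    - by move=> i; rewrite divr_ge0.
    - move=> i; rewrite subr0 mul1r mul0r addr0.
      have : null_power (kv i) (c / (W kv i)%:R) <= c / (W kv i)%:R.
        by rewrite -lee_fin -null_powerE null_pvalue_le// divr_ge0.
      lra.
  by move=> e; move: (ler_wpM2r q0 p1); rewrite mul1r mulrDl; lra.
move=> /(_ H) h; apply: le_trans h _; rewrite measure0 add0e.
rewrite integral_cst// -[leRHS]mule1 lee_wpmul2l ?lee_fin//.
exact: probability_le1.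
Qed.

(** Given the sizes the p-values are independent, and each is at most t with
    probability at least t / 2. *)
Lemma null_accept_le c b : 0 < c -> 0 <= b ->
  (forall kv, \prod_(i < n) (1 - Num.min 1 (c / (W kv i)%:R) / 2) <= b) ->
  (P0 (accept c) <= b%:E)%E.
Proof.
move=> c0 b0 Hb.
have mA := measurable_accept c.
have := @le_measure_Kvec R d Om n K (sample_mK S0) (sample_K_gt0 S0) P0 P0 P0
  (accept c) set0 (fun=> b) mA measurable0 (fun=> b0).
have H (kv : {ffun 'I_n -> nat}) : (forall i, (0 < kv i)%N) ->
    (P0 (accept c `&` [set w | Kv w = kv]) <=
     P0 (set0 `&` [set w | Kv w = kv]) + b%:E * P0 [set w | Kv w = kv])%E.
  move=> k0; rewrite set0I measure0 add0e.
  rewrite (accept_vector_prob c zero01 S0 k0) (vector_probE zero01 S0 k0).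
  rewrite -EFinM lee_fin ler_wpM2r//.
    by apply: prodr_ge0 => i _; exact: pmf_ge0.
  apply: le_trans (Hb kv); apply: ler_prod => i _.
  rewrite subr0 mul1r mul0r addr0 subr_ge0 null_power_le1/= lerD2l lerN2.
  have t01 : 0 < Num.min 1 (c / (W kv i)%:R) <= 1.
    by rewrite lt_min ltr01 divr_gt0//= ge_min lexx.
  rewrite -lee_fin -null_powerE; apply: le_trans (null_pvalue_ge F0 (kv i) t01) _.
  apply: le_measure; rewrite ?inE; try exact: measurable_small_pvalue.
  by move=> z /= /le_trans; apply; rewrite ge_min lexx orbT.
move=> /(_ H) h; apply: le_trans h _; rewrite measure0 add0e.
rewrite integral_cst// -[leRHS]mule1 lee_wpmul2l ?lee_fin//.
exact: probability_le1.
Qed.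

Definition expected_detections (c : R) (kv : {ffun 'I_n -> nat}) : R :=
  \sum_(i < n) alt_power (kv i) (c / (W kv i)%:R).

(** Given the sizes both acceptance probabilities are products over i, with
    factors that differ by at most eps times the alternative power; prod_le_sum
    adds these differences up. *)
Lemma accept_compare c : 
  (P0 (accept c) <= P1 (accept c) +
    \int[P0]_w (eps * expected_detections c (Kv w))%:E)%E.
Proof.
have /andP[e0 e1] := eps01.
have mA := measurable_accept c.
have h0 kv : 0 <= eps * expected_detections c kv.
  by rewrite mulr_ge0// sumr_ge0// => i _; exact: alt_power_ge0.
suff H (kv : {ffun 'I_n -> nat}) : (forall i, (0 < kv i)%N) ->
    (P0 (accept c `&` [set w | Kv w = kv]) <=
     P1 (accept c `&` [set w | Kv w = kv]) +
     (eps * expected_detections c kv)%:E * P0 [set w | Kv w = kv])%E.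
  exact: (@le_measure_Kvec R d Om n K (sample_mK S0) (sample_K_gt0 S0) P0 P1 P0
    (accept c) (accept c) (fun kv => eps * expected_detections c kv) mA mA h0 H).
move=> k0.
rewrite (accept_vector_prob c zero01 S0 k0) (accept_vector_prob c eps01 S1 k0).
rewrite (vector_probE zero01 S0 k0) -EFinM -EFinD lee_fin -mulrDl.
rewrite ler_wpM2r//; first by apply: prodr_ge0 => i _; exact: pmf_ge0.
rewrite /expected_detections mulr_sumr; apply: prod_le_sum => i.
all: rewrite ?subr0 ?mul1r ?mul0r ?addr0.
all: have := null_power_le1 (kv i) (c / (W kv i)%:R);
  have := alt_power_le1 (kv i) (c / (W kv i)%:R);
  have := alt_power_ge0 (kv i) (c / (W kv i)%:R);
  have : 0 <= null_power (kv i) (c / (W kv i)%:R) by rewrite /null_power fine_ge0.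
all: set u := null_power _ _; set v := alt_power _ _ => u0 v0 v1 u1.
- by rewrite subr_ge0 u1/= lerBlDr lerDl.
- apply/andP; split; first by rewrite addr_ge0// mulr_ge0// subr_ge0.
  apply: (@le_trans _ _ ((1 - eps) * 1 + eps * 1)); last by lra.
  by apply: lerD; apply: ler_wpM2l; lra.
- by rewrite mulr_ge0.
- by nra.
Qed.

(** Detection by samples of a single size k: outside of bad, each of them with a
    p-value at most t leads to rejection, and none of the n observations being of
    that kind is a product event. *)
Lemma alt_accept_le c t k (bad : set Om) : (0 < k)%N -> measurable bad ->
  (forall w i, ~ bad w -> K i w = k -> pval F0 K Y V i w <= t ->
     (W (Kv w) i)%:R * pval F0 K Y V i w <= c) ->
  (P1 (accept c) <= P1 bad + ((1 - pmf k * (eps * alt_power k t)) ^+ n)%:E)%E.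
Proof.
move=> k0 mbad Hbad.
have mS := @measurable_small_pvalue R F0 k t.
pose hit0 := [set w | forall i, ~ (K i w = k /\ small_pvalue F0 k t (Y i w, V i w))].
have mhit : measurable hit0.
  pose E i := ~` [set w | at_size k (small_pvalue F0 k t) (K i w) (Y i w, V i w)].
  have -> : hit0 = [set w | forall i, E i w].
    apply/seteqP; split => w h i; have := h i; rewrite /E /at_size /=.
      by move=> h1; case: eqP => // e s; apply: h1.
    by move=> h1 [e s]; apply: h1; rewrite e eqxx.
  apply: measurable_forall => i; apply: measurableC.
  apply: (measurable_obs S0) => k'.
  by rewrite /at_size; case: ifP.
apply: (@le_trans _ _ (P1 (bad `|` hit0))).
  apply: le_measure; rewrite ?inE; [exact: measurable_accept|exact: measurableU|].
  move=> w aw; have [bw|bw] := pselect (bad w); [by left|right].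
  move=> i [Kk sp]; move/lt_bigmin_ereal: aw => /(_ i); apply/negP; rewrite -leNgt.
  by apply: Hbad => //; rewrite /pval Kk.
apply: (le_trans (measureU2 _ _ _)) => //.
rewrite leeD2l//.
apply: le_trans (no_hit_prob Ttheta S1 eps01 pmf_ge0 pmf_pos n_gt0 k0 mS) _.
rewrite lee_fin.
have /andP[e0 e1] := eps01.
have mixE : mix_law Ttheta eps k (small_pvalue F0 k t) =
    ((1 - eps) * null_power k t + eps * alt_power k t)%:E.
  by rewrite /mix_law null_powerE alt_powerE -!EFinM -EFinD.
have nn0 : 0 <= null_power k t by rewrite /null_power fine_ge0.
have p0 := pmf_ge0 k0.
have p1 := pmf_le1 Ttheta S1 eps01 pmf_ge0 pmf_pos n_gt0 k0.
have a0 := alt_power_ge0 k t; have a1 := alt_power_le1 k t.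
have n1 := null_power_le1 k t.
have m1 : (1 - eps) * null_power k t + eps * alt_power k t <= 1.
  apply: (@le_trans _ _ ((1 - eps) * 1 + eps * 1)); last by lra.
  by apply: lerD; apply: ler_wpM2l; lra.
have m0 : 0 <= (1 - eps) * null_power k t + eps * alt_power k t.
  by rewrite addr_ge0// mulr_ge0// subr_ge0.
rewrite mixE /=; apply: lerXn2r; rewrite ?nnegrE.
- by rewrite subr_ge0 mulr_ile1.
- by rewrite subr_ge0 !mulr_ile1// mulr_ge0.
- rewrite lerD2l lerN2 ler_wpM2l// lerDr mulr_ge0// subr_ge0//.
Qed.

End weighted_minimum.

(** * Bounds on the risk *)

Section size_counts.
Context {R : realType} d (Om : measurableType d) (P : probability Om R) (n : nat).
Variable K : 'I_n -> Om -> nat.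
Hypothesis mK : forall i, measurable_fun setT (K i).
Hypothesis K_gt0 : forall i w, (0 < K i w)%N.
Local Notation Kv := (Kvec K).

Lemma integral_count (C : R) (E : nat -> bool) i : 0 <= C ->
  (\int[P]_w (C * (E (K i w))%:R)%:E = C%:E * P [set w | E (K i w)])%E.
Proof.
move=> C0.
have mE : measurable [set w | E (K i w)].
  by have := mK i measurableT (Y:=[set k | E k]) Logic.I; rewrite setTI.
have -> : (fun w => (C * (E (K i w))%:R)%:E) = (fun w => C%:E * (\1_[set w | E (K i w)] w)%:E)%E.
  apply/funext => w; rewrite -EFinM indicE; congr (_ * (nat_of_bool _)%:R)%:E.
  by apply/idP/idP; rewrite inE.
rewrite ge0_integralZl//.
  by rewrite integral_indic// setIT.
by apply/measurable_EFinP; exact: measurable_indic.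
Qed.

Let mcount (C : R) (E : nat -> bool) i : measurable_fun setT (fun w => (C * (E (K i w))%:R)%:E).
Proof.
apply/measurable_EFinP; apply: measurable_realfun.measurable_funM => //.
have := @measurable_fun_Kvec R _ _ _ _ mK (fun kv => (E (kv i))%:R).
by under eq_fun do rewrite ffunE.
Qed.

(** Expected number of detections. Sizes up to m0 are treated one by one, C k
    being paid for each observation of size k and C' k once for all of them;
    each larger size counts for one detection. *)
Lemma integral_counts_le (h : {ffun 'I_n -> nat} -> R) (m0 : nat)
    (pmf C C' : nat -> R) (tau eps : R) :
  0 <= eps -> (forall kv, 0 <= h kv) -> (forall k, 0 <= C k) -> (forall k, 0 <= C' k) ->
  (forall i k, (0 < k)%N -> P [set w | K i w = k] = (pmf k)%:E) ->
  (forall i, P [set w | (m0 < K i w)%N] <= tau%:E)%E ->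
  (forall kv : {ffun 'I_n -> nat}, (forall i, (0 < kv i)%N) ->
    h kv <= \sum_(i < n) \sum_(1 <= k < m0.+1) C k * (kv i == k)%:R +
     \sum_(1 <= k < m0.+1) C' k + \sum_(i < n) (m0 < kv i)%N%:R) ->
  (\int[P]_w (eps * h (Kv w))%:E <=
    (eps * (\sum_(1 <= k < m0.+1) (n%:R * pmf k * C k + C' k) + n%:R * tau))%:E)%E.
Proof.
move=> e0 h0 C0 C0' Hpmf Htau H.
pose f1 (w : Om) : \bar R := (\sum_(i < n) \sum_(1 <= k < m0.+1) (C k * (K i w == k)%:R)%:E)%E.
pose f2 (w : Om) : \bar R := (\sum_(i < n) ((1 : R) * (m0 < K i w)%N%:R)%:E)%E.
pose c : R := \sum_(1 <= k < m0.+1) C' k.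
have f10 w : (0 <= f1 w)%E.
  by apply: sume_ge0 => i _; apply: sume_ge0 => k _; rewrite lee_fin mulr_ge0.
have f20 w : (0 <= f2 w)%E.
  by apply: sume_ge0 => i _; rewrite lee_fin mulr_ge0.
have c0 : 0 <= c by apply: sumr_ge0.
have mf1 : measurable_fun setT f1.
  apply: emeasurable_sum => i; apply: emeasurable_sum => k.
  exact: (mcount (C k) (fun j => j == k) i).
have mf2 : measurable_fun setT f2.
  by apply: emeasurable_sum => i; exact: (mcount 1 (fun j => (m0 < j)%N) i).
have mf3 : measurable_fun setT (fun w => c%:E + f2 w)%E.
  by apply: emeasurable_funD.
have mf : measurable_fun setT (fun w => f1 w + (c%:E + f2 w))%E.
  by apply: emeasurable_funD.
have f30 w : (0 <= c%:E + f2 w)%E by apply: adde_ge0.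
apply: (@le_trans _ _ (\int[P]_w (eps%:E * (f1 w + (c%:E + f2 w))))%E).
  apply: ge0_le_integral => //.
  - by move=> w _; rewrite lee_fin mulr_ge0.
  - apply/measurable_EFinP; exact: (measurable_fun_Kvec mK (fun kv => eps * h kv)).
  - exact: emeasurable_funM.
  - move=> w _; rewrite EFinM lee_wpmul2l ?lee_fin//.
    have Kp i : (0 < Kv w i)%N by rewrite ffunE.
    have := H _ Kp; rewrite -lee_fin => /le_trans; apply.
    rewrite le_eqVlt; apply/orP; left; apply/eqP.
    rewrite -addrA !EFinD; congr (_ + (_ + _))%E.
      rewrite -sumEFin; apply: eq_bigr => i _; rewrite -sumEFin.
      by apply: eq_bigr => k _; rewrite ffunE.
    by rewrite -sumEFin; apply: eq_bigr => i _; rewrite mul1r ffunE.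
have f1f3 w : (0 <= f1 w + (c%:E + f2 w))%E by apply: adde_ge0.
rewrite ge0_integralZl ?lee_fin// EFinM lee_wpmul2l ?lee_fin//.
rewrite ge0_integralD// ge0_integralD//.
have -> : (\int[P]_w c%:E = c%:E)%E.
  rewrite integral_cst// -[RHS]mule1; congr (_ * _)%E; exact: probability_setT.
have -> : (\int[P]_w f1 w = (\sum_(1 <= k < m0.+1) (n%:R * pmf k * C k))%:E)%E.
  rewrite /f1 ge0_integral_sum//; last 2 first.
  - by move=> i; apply: emeasurable_sum => k; exact: (mcount (C k) (fun j => j == k) i).
  - by move=> i w _; apply: sume_ge0 => k _; rewrite lee_fin mulr_ge0.
  have e i : (\int[P]_w (\sum_(1 <= k < m0.+1) (C k * (K i w == k)%:R)%:E) =
      (\sum_(1 <= k < m0.+1) C k * pmf k)%:E)%E.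
    rewrite ge0_integral_sum//; last 2 first.
    - by move=> k; exact: (mcount (C k) (fun j => j == k) i).
    - by move=> k w _; rewrite lee_fin mulr_ge0.
    rewrite -sumEFin big_nat_cond [RHS]big_nat_cond; apply: eq_bigr => k /andP[/andP[k1 _] _].
    rewrite (@integral_count (C k) (fun j => j == k))// EFinM -(Hpmf i k k1).
    by congr (_ * P _)%E; apply/seteqP; split => w /= /eqP.
  under eq_bigr do rewrite e.
  rewrite sumEFin sumr_const card_ord -(mulr_natl (\sum_(1 <= k < m0.+1) C k * pmf k) n) mulr_sumr; congr _%:E.
  by apply: eq_bigr => k _; ring.
rewrite big_split/= -/c -addrA [(_ + (c + _))%:E]EFinD leeD2l// EFinD leeD2l//.
have mg i := mcount 1 (fun j => (m0 < j)%N) i.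
rewrite /f2 (ge0_integral_sum P measurableT mg)//.
apply: (@le_trans _ _ (\sum_(i < n) tau%:E)%E).
  apply: lee_sum => i _; rewrite (@integral_count 1 (fun j => (m0 < j)%N))// mul1e.
  exact: Htau.
by rewrite sumEFin sumr_const card_ord mulr_natl.
Qed.

End size_counts.

Section risk_bounds.
Context {R : realType} (F0 : probability (measurableTypeR R) R) (theta : R).
Hypothesis Ttheta : Theta F0 theta.
Local Notation mR := (measurableTypeR R).
Variables (pmf : nat -> R) (eps : R) (n : nat).
Context d (Om : measurableType d) (P0 P1 : probability Om R).
Variables (K : 'I_n -> Om -> nat) (Y V : 'I_n -> Om -> mR).
Hypothesis S0 : sample F0 theta pmf 0 P0 K Y V.
Hypothesis S1 : sample F0 theta pmf eps P1 K Y V.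
Hypothesis eps01 : 0 <= eps <= 1.
Hypothesis pmf_ge0 : forall k, (0 < k)%N -> 0 <= pmf k.
Hypothesis pmf_pos : exists2 k, (0 < k)%N & 0 < pmf k.
Hypothesis n_gt0 : (0 < n)%N.
Variable W : {ffun 'I_n -> nat} -> 'I_n -> nat.
Hypothesis W_gt0 : forall kv i, (0 < W kv i)%N.

Local Notation Kv := (Kvec K).
Local Notation T := (weighted_min F0 K Y V W).
Local Notation accept := (accept F0 K Y V W).
Local Notation expected_detections := (expected_detections Ttheta W).

Let zero01 : 0 <= (0 : R) <= 1. Proof. by rewrite lexx ler01. Qed.

Let mA c : measurable (accept c).
Proof. exact: (measurable_accept S0 W_gt0). Qed.

Let rejectE c : [set w | (T w <= c%:E)%E] = ~` accept c.
Proof.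
apply/seteqP; split => w /=; first by move=> h; apply/negP; rewrite -leNgt.
by move=> /negP; rewrite -leNgt.
Qed.

Lemma risk_le c (b0 b1 : R) : (P0 (~` accept c) <= b0%:E)%E ->
  (P1 (accept c) <= b1%:E)%E -> (risk P0 P1 T <= (b0 + b1)%:E)%E.
Proof.
move=> h0 h1; apply: ge_ereal_inf.
exists (P0 (~` accept c) + P1 (accept c))%E; last by rewrite EFinD leeD.
by exists c => //; rewrite rejectE.
Qed.

Lemma risk_le1 : (risk P0 P1 T <= 1)%E.
Proof.
rewrite -[leRHS]add0e.
have := @risk_le 0 0 1; rewrite add0r add0e; apply.
  apply: (null_reject_le Ttheta S0 pmf_ge0 pmf_pos W_gt0) => // kv.
  by rewrite big1// => i _; rewrite mul0r.
by apply: probability_le1; exact: mA.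
Qed.

Lemma risk_ge0 : (0 <= risk P0 P1 T)%E.
Proof. by apply: le_ereal_inf_tmp => _ [c _ <-]; rewrite adde_ge0. Qed.

Let hd0 c w : (0 <= (eps * expected_detections c (Kv w))%:E)%E.
Proof.
have /andP[e0 e1] := eps01; rewrite lee_fin; apply: mulr_ge0; first exact: e0.
by apply: sumr_ge0 => i _; exact: alt_power_ge0.
Qed.

Let hdm c : measurable_fun setT (fun w => (eps * expected_detections c (Kv w))%:E).
Proof.
apply/measurable_EFinP.
exact: (measurable_fun_Kvec (sample_mK S0) (fun kv => eps * expected_detections c kv)).
Qed.

(** A threshold above c0 rejects a true null with probability at least 1 - b0.
    For a threshold below c0 there are few detections, so that by accept_compare
    acceptance is almost as likely under the alternative as under the null. *)
Lemma risk_ge c0 (b0 b1 : R) : (P0 (accept c0) <= b0%:E)%E ->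
  (\int[P0]_w (eps * expected_detections c0 (Kv w))%:E <= b1%:E)%E ->
  0 <= b0 -> 0 <= b1 -> ((1 - (b0 + b1))%:E <= risk P0 P1 T)%E.
Proof.
move=> h0 h1 b00 b10; apply: le_ereal_inf_tmp => _ [c _ <-]; rewrite rejectE.
have /andP[e0 e1] := eps01.
have fin (P : probability Om R) B : measurable B -> P B \is a fin_num.
  by move=> mB; exact: fin_num_measure.
have mC := measurableC (mA c).
have compl : (P0 (~` accept c) = 1 - P0 (accept c))%E by exact: probability_setC.
have [cc0|/ltW cc0] := leP c0 c.
  apply: (@le_trans _ _ (P0 (~` accept c))); last by rewrite leeDl.
  have sub : (P0 (accept c) <= P0 (accept c0))%E.
    apply: le_measure; rewrite ?inE; try exact: mA.
    by move=> w; rewrite /Submission.accept/=; apply: le_lt_trans; rewrite lee_fin.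
  have := le_trans sub h0.
  rewrite compl -(fineK (fin P0 _ (mA c))) -EFinB !lee_fin; lra.
have hc : (\int[P0]_w (eps * expected_detections c (Kv w))%:E <= b1%:E)%E.
  apply: le_trans h1.
  apply: (ge0_le_integral P0 measurableT (fun w _ => hd0 c w) (hdm c) (hdm c0)).
  move=> w _; rewrite lee_fin; apply: ler_wpM2l; first exact: e0.
  apply: ler_sum => i _; apply: le_alt_power.
  by apply: ler_wpM2r; [rewrite invr_ge0|].
have := accept_compare Ttheta S0 S1 eps01 pmf_ge0 pmf_pos W_gt0 c.
move=> /le_trans/(_ (leeD2l _ hc)).
rewrite compl -(fineK (fin P0 _ (mA c))) -(fineK (fin P1 _ (mA c))).
rewrite -EFinB -!EFinD !lee_fin; lra.
Qed.

End risk_bounds.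

(** * The rate function of the sample sizes *)

Section rate_J.
Context {R : realType} (a0 : R) (J : R -> R).
Hypotheses (A1 : J_flat a0 J) (A2 : J_convex a0 J).

Lemma a0_gt0 : 0 < a0. Proof. by have [] := A1. Qed.

Lemma J_eq0 a : 0 <= a <= a0 -> J a = 0.
Proof. by move=> a01; have [_ ->] := A1; rewrite ?in_itv. Qed.

Lemma J_derivable a : a0 <= a -> derivable J a 1.
Proof. by move=> a0a; have [H _ _ _ _] := A2; apply: H; rewrite in_itv/= a0a. Qed.

Lemma J_near0 (a : R) : 0 < a -> a < a0 -> \forall x \near a, cst 0 x = J x.
Proof.
move=> a_gt0 aa0.
have : a \in `]0, a0[ by rewrite in_itv/= a_gt0.
move=> /near_in_itvoo; apply: filterS => y; rewrite in_itv/= => /andP[y0 ya].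
by rewrite J_eq0// !ltW.
Qed.

Lemma J_derive0 a : 0 < a -> a <= a0 -> derive1 J a = 0.
Proof.
move=> a_gt0; rewrite le_eqVlt => /predU1P[->|aa0]; first by have [_ _ _ -> _] := A2.
rewrite derive1E -(@near_eq_derive R R R (cst 0) J a 1 (J_near0 a_gt0 aa0)).
by rewrite -derive1E derive1_cst.
Qed.

Lemma J_continuous a : 0 < a -> {for a, continuous J}.
Proof.
move=> a_gt0; have [aa0|a0a] := ltP a a0.
  have h := J_near0 a_gt0 aa0.
  have Ja : J a = 0 by rewrite J_eq0// !ltW.
  apply/cvgrPdist_lt => e e0; apply: filterS h => x <-.
  by rewrite Ja /cst subrr normr0.
by apply: differentiable_continuous; apply/derivable1_diffP; exact: J_derivable.
Qed.

Lemma derive1J_lt a b : a0 <= a -> a < b -> derive1 J a < derive1 J b.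
Proof.
move=> a0a ab; have [_ _ H _ _] := A2; apply: H => //; rewrite in_itv/= andbT//.
by rewrite (le_trans a0a)// ltW.
Qed.

Lemma derive1J_le a b : 0 < a -> a <= b -> derive1 J a <= derive1 J b.
Proof.
move=> a_gt0 ab; have [aa0|a0a] := leP a a0.
  rewrite J_derive0//; have [ba0|a0b] := leP b a0.
    by rewrite J_derive0// (lt_le_trans a_gt0).
  by rewrite -(J_derive0 a0_gt0 (lexx a0)) ltW// derive1J_lt.
by move: ab; rewrite le_eqVlt => /predU1P[->//|ab]; rewrite ltW// derive1J_lt// ltW.
Qed.

Lemma derive1J_ge0 a : 0 < a -> 0 <= derive1 J a.
Proof.
move=> a_gt0; have m0 : 0 < Num.min a a0 by rewrite lt_min a_gt0 a0_gt0.
rewrite -(J_derive0 m0); last by rewrite ge_min lexx orbT.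
by apply: derive1J_le => //; rewrite ge_min lexx.
Qed.

(** Mean value theorem, with a nondecreasing derivative. *)
Lemma J_mvt a b : a0 <= a -> a <= b ->
  derive1 J a * (b - a) <= J b - J a <= derive1 J b * (b - a).
Proof.
move=> a0a; rewrite le_eqVlt => /predU1P[->|ab]; first by rewrite !subrr !mulr0 lexx.
have aab x : x \in `]a, b[ -> a0 <= x.
  by rewrite in_itv/= => /andP[ax _]; rewrite (le_trans a0a)// ltW.
have [x xab||c] := @MVT R J (derive1 J) a b ab.
- by rewrite derive1E; apply: derivableP; apply: J_derivable; exact: aab.
- apply: derivable_within_continuous => x; rewrite in_itv/= => /andP[ax _].
  by apply: J_derivable; exact: le_trans ax.
rewrite in_itv/= => /andP[ac cb] ->.
have ba : 0 < b - a by rewrite subr_gt0.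
by rewrite !ler_pM2r// !ltW// derive1J_lt// (le_trans a0a)// ltW.
Qed.

Lemma J_ge0 a : 0 <= a -> 0 <= J a.
Proof.
move=> a_ge0; have [aa0|a0a] := leP a a0; first by rewrite J_eq0// a_ge0.
have /andP[+ _] := J_mvt (lexx a0) (ltW a0a).
rewrite J_derive0 ?a0_gt0// mul0r (@J_eq0 a0) ?subr0//.
by rewrite lexx ltW// a0_gt0.
Qed.

Lemma J_le a b : 0 <= a -> a <= b -> J a <= J b.
Proof.
move=> a_ge0 ab; have [aa0|a0a] := leP a a0.
  by rewrite J_eq0 ?a_ge0// J_ge0// (le_trans a_ge0).
have /andP[+ _] := J_mvt (ltW a0a) ab.
move=> h; rewrite -subr_ge0; apply: le_trans h; rewrite mulr_ge0 ?subr_ge0//.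
by rewrite derive1J_ge0// (lt_trans a0_gt0).
Qed.

Lemma J_tangent a b : 0 < a -> a <= b -> J b - J a <= derive1 J b * (b - a).
Proof.
move=> a_gt0 ab; have b_gt0 := lt_le_trans a_gt0 ab.
have [a0a|aa0] := leP a0 a; first by have /andP[] := J_mvt a0a ab.
have [ba0|a0b] := leP b a0.
  rewrite !J_eq0 ?subrr ?mulr_ge0 ?derive1J_ge0 ?subr_ge0//.
    by rewrite !ltW.
  by rewrite ba0 ltW.
have /andP[_ +] := J_mvt (lexx a0) (ltW a0b).
have -> : J a0 = 0 by rewrite J_eq0// lexx ltW// a0_gt0.
have -> : J a = 0 by rewrite J_eq0// (ltW a_gt0) ltW.
move=> /le_trans; apply.
by rewrite ler_wpM2l ?derive1J_ge0// lerD2l lerN2 ltW.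
Qed.

Lemma derive1J_gt0 a : a0 < a -> 0 < derive1 J a.
Proof. by move=> a0a; rewrite -(J_derive0 a0_gt0 (lexx a0)) derive1J_lt. Qed.

(** J grows at least linearly beyond a0 + 1, where its derivative is positive. *)
Lemma J_unbounded (M : R) : exists2 A, a0 < A & forall a, A <= a -> M <= J a.
Proof.
pose b := a0 + 1.
have a0b : a0 < b by rewrite ltrDl.
have s0 := derive1J_gt0 a0b.
pose A := b + `|M| / derive1 J b.
have bA : b <= A by rewrite lerDl divr_ge0// ltW.
exists A => [|a Aa]; first exact: lt_le_trans bA.
have /andP[+ _] := J_mvt (ltW a0b) (le_trans bA Aa).
have Jb : 0 <= J b by rewrite J_ge0// ltW// (lt_trans a0_gt0).
have : `|M| <= derive1 J b * (a - b).
  by rewrite mulrC -ler_pdivrMr// lerBrDl.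
have := ler_norm M; lra.
Qed.

End rate_J.

Section alpha.
Context {R : realType} (a0 : R) (alpha : nat -> nat -> R).
Hypothesis A3 : alpha_subexponential a0 alpha.

(** The value of lne is infinite at nonpositive arguments, so the bound on the
    supremum also yields positivity. *)
Lemma alpha_bounds (e : R) : 0 < e -> \forall n \near \oo, forall k : nat,
  (0 < k)%N -> a0 * ln n%:R <= k%:R ->
  0 < alpha n k /\ expR (- (e * k%:R)) <= alpha n k <= expR (e * k%:R).
Proof.
move=> e0.
have nb : nbhs (0%E : \bar R) [set x : \bar R | (x < e%:E)%E].
  by apply: open_nbhs_nbhs; split; [exact: open_ereal_lt_ereal|rewrite /= lte_fin].
have : \forall n \near \oo, (ereal_sup [set (`|lne (alpha n k)%:E| * (k%:R^-1)%:E)%E |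
      k in [set k : nat | (0 < k)%N /\ (a0 * ln n%:R <= k%:R)%R]] < e%:E)%E.
  exact: A3 nb.
apply: filterS => n sup_lt k k0 ak.
have kp : 0 < k%:R :> R by rewrite ltr0n.
have : (`|lne (alpha n k)%:E| * (k%:R^-1)%:E < e%:E)%E.
  by apply: le_lt_trans sup_lt; apply: ereal_sup_ubound; exists k.
have [a_gt0|a_le0] := ltP 0 (alpha n k); last first.
  by rewrite le0_lneNy ?lee_fin//= gt0_mulye ?lte_fin ?invr_gt0.
rewrite /= leNgt a_gt0 /= -EFinM lte_fin ltr_pdivrMr// => /ltW.
rewrite ler_norml => /andP[l1 l2]; split => //.
by rewrite -[alpha n k]lnK ?posrE// !ler_expR -mulNr mulNr l1.
Qed.

End alpha.

(** * Duality between the rate and the cumulant function *)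

Section duality.
Context {R : realType} (F0 : probability (measurableTypeR R) R) (theta : R).
Hypothesis Ttheta : Theta F0 theta.
Hypothesis theta_neq0 : theta != 0.
Hypothesis dpsi : psi_derivable F0 theta.
Local Notation psi := (psi F0).
Local Notation Theta := (Theta F0).
Local Notation mu := (mean F0 theta).
Local Notation rate := (rate F0).
Local Notation Imu := (theta * mu - psi theta).

Let mul_slope (l x : R) : 0 < l -> l * (theta / l * x) = theta * x.
Proof. by move=> l0; rewrite mulrA mulrCA mulfV ?mulr1 ?gt_eqF. Qed.

(** psi is convex and mean is its derivative at theta along Theta, so the line of
    slope mean supports psi at theta, also when theta is an end point of Theta:
    the points used tend to theta along the segment from theta to eta. *)
Lemma psi_tangent eta : Theta eta -> psi theta + mu * (eta - theta) <= psi eta.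
Proof.
move=> Teta; have [->|neq] := eqVneq eta theta; first by rewrite subrr mulr0 addr0.
rewrite -lerBrDl; apply/ler_addgt0Pl => e e0.
have d0 : 0 < `|eta - theta| by rewrite normr_gt0 subr_eq0.
have e'0 : 0 < e / `|eta - theta| by rewrite divr_gt0.
have /cvgrPdist_le/(_ _ e'0) : psi_quotient F0 theta eta @[eta --> within Theta theta^'] --> mu.
  exact: dpsi.
rewrite /within /dnbhs /= => -[r /= r0 Hr].
pose t := Num.min 1 (r / 2 / `|eta - theta|).
have t0 : 0 < t by rewrite lt_min ltr01 divr_gt0// divr_gt0.
have t01 : 0 <= t <= 1 by rewrite ltW//= ge_min lexx.
pose xi := t * eta + (1 - t) * theta.
have xit : xi - theta = t * (eta - theta) by rewrite /xi; ring.
have [Txi pxi] := psi_convex t01 Teta Ttheta.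
have xin : xi != theta by rewrite -subr_eq0 xit mulf_eq0 negb_or (gt_eqF t0)/= subr_eq0.
have xib : ball theta r xi.
  rewrite -ball_normE/= distrC xit normrM gtr0_norm// -ltr_pdivlMr//.
  apply: (@le_lt_trans _ _ (r / 2 / `|eta - theta|)); first by rewrite ge_min lexx orbT.
  by rewrite ltr_pM2r ?invr_gt0// ltr_pdivrMr// mulr_natr mulr2n ltrDl.
have := Hr xi xib xin Txi; rewrite ler_pdivlMr// => hq.
rewrite -(@ler_pM2l _ t)//.
have -> : t * (mu * (eta - theta)) = (mu - psi_quotient F0 theta xi) * (t * (eta - theta)) +
    (psi xi - psi theta).
  rewrite /psi_quotient xit; field.
  by rewrite subr_eq0 neq (gt_eqF t0).
have h1 : (mu - psi_quotient F0 theta xi) * (t * (eta - theta)) <= t * e.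
  rewrite mulrCA ler_pM2l//; apply: le_trans (ler_norm _) _.
  by rewrite normrM.
have h2 : psi xi - psi theta <= t * (psi eta - psi theta) by move: pxi; rewrite -/xi; lra.
apply: le_trans (lerD h1 h2) _.
by rewrite [leRHS]mulrDr addrC.
Qed.

(** By psi_tangent the supremum that defines the rate is attained at theta. *)
Lemma rate_mean : rate mu = Imu%:E.
Proof.
apply/eqP; rewrite eq_le; apply/andP; split; last exact: rate_ge.
by apply: rate_le => s Ts; have := psi_tangent Ts; rewrite mulrBr; lra.
Qed.

Lemma Imu_ge0 : 0 <= Imu.
Proof. by rewrite -lee_fin -rate_mean; exact: rate_ge0. Qed.

Lemma rate_fin_le nu I s : rate nu = I%:E -> Theta s -> s * nu - psi s <= I.
Proof. by move=> rI Ts; rewrite -lee_fin -rI; exact: rate_ge. Qed.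

(** Beyond the mean, in the direction of theta, the supremum that defines the
    rate may be restricted to the parameters theta / l with 0 < l <= 1: by
    psi_tangent the other parameters do not do better than theta. *)
Lemma rate_le_beyond (nu s : R) : 0 <= theta * (nu - mu) ->
  (forall l, 0 < l <= 1 -> Theta (theta / l) ->
     (theta / l) * nu - psi (theta / l) <= s) ->
  (rate nu <= s%:E)%E.
Proof.
move=> num Hl; apply: rate_le => eta Teta.
have [h|h] := leP (theta ^+ 2) (eta * theta).
  have t2 : 0 < theta ^+ 2 by rewrite exprn_even_gt0.
  have et : 0 < eta * theta by exact: lt_le_trans h.
  have eta0 : eta != 0 by apply: contraTneq et => ->; rewrite mul0r ltxx.
  have -> : eta = theta / (theta ^+ 2 / (eta * theta)).
    by field; rewrite theta_neq0 eta0.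
  apply: Hl.
    by rewrite divr_gt0//= ler_pdivrMr// mul1r.
  by rewrite (_ : _ / _ = eta)//; field; rewrite theta_neq0 eta0.
have := Hl 1; rewrite ltr01 lexx divr1 => /(_ isT Ttheta); apply: le_trans.
have := psi_tangent Teta.
suff : (eta - theta) * (nu - mu) <= 0 by nra.
have h1 : (eta - theta) * theta <= 0 by move: h; rewrite expr2; nra.
have [t0|t0] := ltP 0 theta; first by apply: mulr_le0_ge0; nra.
have t0' : theta < 0 by rewrite lt_neqAle theta_neq0.
by apply: mulr_ge0_le0; nra.
Qed.

Lemma rate_nondecreasing nu nu' : 0 <= theta * (nu - mu) ->
  0 <= theta * (nu' - nu) -> (rate nu <= rate nu')%E.
Proof.
move=> h1 h2; have := rate_ge0 F0 nu'.
case E : (rate nu') => [s||] r0; [|by rewrite leey|by []].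
apply: rate_le_beyond => // l /andP[l0 l1] Tl.
apply: le_trans (rate_fin_le E Tl); rewrite lerD2r.
by rewrite -subr_ge0 -mulrBr mulrAC mulr_ge0// invr_ge0 ltW.
Qed.

(** Lagrange duality. The point nu with theta nu equal to the infimum of
    l (s + psi (theta / l)) over l is, by rate_le_beyond, the farthest one beyond
    the mean with rate at most s. When its rate is strictly less than s, the
    infimum is approached only as l tends to 0, which makes the rate infinite at
    all points beyond nu. *)
Lemma rate_dual (s : R) : Imu <= s -> exists nu : R,
  [/\ 0 <= theta * (nu - mu), (rate nu <= s%:E)%E,
   forall e, 0 < e -> exists l, [/\ 0 < l <= 1, Theta (theta / l) &
     l * (s + psi (theta / l)) < theta * nu + e] &
   (rate nu < s%:E)%E -> forall nu', 0 < theta * (nu' - nu) -> rate nu' = +oo%E].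
Proof.
move=> Is.
pose A := [set l * (s + psi (theta / l)) | l in [set l | 0 < l <= 1 /\ Theta (theta / l)]].
have A0 : A !=set0.
  by exists (1 * (s + psi (theta / 1))), 1 => //; rewrite /= ltr01 lexx divr1.
have lbA : lbound A (theta * mu).
  move=> _ [l [/andP[l0 l1] Tl] <-].
  have := rate_fin_le rate_mean Tl => h.
  have : theta / l * mu <= s + psi (theta / l) by lra.
  by rewrite -(ler_pM2l l0) mul_slope.
have hA : has_inf A by split => //; exists (theta * mu).
pose w := inf A; pose nu := w / theta.
have tnu : theta * nu = w by rewrite /nu mulrCA mulfV ?mulr1.
have wA l : 0 < l <= 1 -> Theta (theta / l) -> w <= l * (s + psi (theta / l)).
  by move=> l01 Tl; apply: ge_inf; [case: hA|exists l].
have num : 0 <= theta * (nu - mu).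
  by rewrite mulrBr tnu subr_ge0; apply: lb_le_inf.
have approx e : 0 < e -> exists l, [/\ 0 < l <= 1, Theta (theta / l) &
     l * (s + psi (theta / l)) < theta * nu + e].
  move=> e0; have [_ [l [l01 Tl] <-] lt] := inf_adherent e0 hA.
  by exists l; split => //; rewrite tnu.
have rle : (rate nu <= s%:E)%E.
  apply: rate_le_beyond => // l l01 Tl; have /andP[l0 _] := l01.
  by rewrite lerBlDr -(ler_pM2l l0) mul_slope// tnu; exact: wA.
exists nu; split => // rlt nu' d0.
set d := theta * (nu' - nu) in d0.
have [I rI] : exists I, rate nu = I%:E.
  by move: rlt (rate_ge0 F0 nu); case: (rate nu) => [I|//|//] _ _; exists I.
move: rlt; rewrite rI lte_fin => Ilt.
have sI : 0 < s - I by rewrite subr_gt0.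
apply: eq_infty => M.
pose B := `|M| + `|s| + 1.
have B0 : 0 < B by rewrite ltr_wpDl// addr_ge0.
(* e is small enough to force l B <= d / 2, so that l M is absorbed by the gain
   d = theta (nu' - nu) *)
pose e := Num.min (d / 2) (d * (s - I) / (2 * B)).
have e0 : 0 < e.
  by rewrite lt_min; apply/andP; split; rewrite divr_gt0// mulr_gt0.
have [l [/andP[l0 l1] Tl lt]] := approx _ e0.
have h1 := rate_fin_le rI Tl.
have {}h1 : theta * nu <= l * (I + psi (theta / l)).
  have : theta / l * nu <= I + psi (theta / l) by lra.
  by rewrite -(ler_pM2l l0) mul_slope.
have lsI : l * (s - I) < e by lra.
have e1 : e <= d / 2 by rewrite ge_min lexx.
have lB : l * B <= d / 2.
  have : l * (s - I) <= d * (s - I) / (2 * B).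
    by apply: (le_trans (ltW lsI)); rewrite ge_min lexx orbT.
  rewrite ler_pdivlMr ?mulr_gt0// => h.
  rewrite -(ler_pM2r sI) mulrAC -mulrA; lra.
apply: le_trans (rate_ge nu' Tl); rewrite lee_fin -(ler_pM2l l0) mulrBr.
have -> : l * (theta / l * nu') = theta * nu + d.
  by rewrite mulrA mulrCA mulfV ?mulr1 ?gt_eqF// /d; ring.
have h2 : l * (M - s) <= l * B.
  rewrite ler_pM2l// /B; have := ler_norm M; have := ler_norm (- s); rewrite normrN; lra.
lra.
Qed.

End duality.

(** * Exponents above the transition curves *)

Section exponents.
Context {R : realType} (F0 : probability (measurableTypeR R) R) (theta a0 : R)
  (J : R -> R).
Hypothesis Ttheta : Theta F0 theta.
Hypothesis theta_neq0 : theta != 0.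
Hypothesis dpsi : psi_derivable F0 theta.
Hypotheses (A1 : J_flat a0 J) (A2 : J_convex a0 J).
Local Notation psi := (psi F0).
Local Notation Theta := (Theta F0).
Local Notation mu := (mean F0 theta).
Local Notation rate := (rate F0).
Local Notation Imu := (theta * mu - psi theta).

(** On the curve the three terms of fH add up to
    a (theta nu - psi theta) - J a. *)
Lemma bB_ge nu I a : rate nu = I%:E -> 0 < a -> a * I = 1 ->
  ((a * (theta * nu - psi theta) - J a)%:E <= bB F0 J theta)%E.
Proof.
move=> rI a_gt0 aI; apply: ereal_sup_ubound; exists (nu, a).
  by split => //=; rewrite rI -EFinM aI.
rewrite /fH /gH /= rI.
by rewrite -!EFinM -EFinD; congr _%:E; rewrite aI; field.
Qed.

(** On the curve fR reduces to a (theta nu - psi theta). *)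
Lemma bR_ge nu I a : rate nu = I%:E -> 0 < a -> a * I + J a = 1 ->
  ((a * (theta * nu - psi theta))%:E <= bR F0 J theta)%E.
Proof.
move=> rI a_gt0 aI; apply: ereal_sup_ubound; exists (nu, a).
  by split => //=; rewrite /gR rI -EFinM -EFinD aI.
rewrite /fR /gR /= rI.
by rewrite -!EFinM -EFinD; congr _%:E; rewrite aI subrr mulr0 addr0.
Qed.

Lemma curveR_through nu I a b : rate nu = I%:E -> 0 < a -> a <= b ->
  a * I + J a <= 1 -> 1 <= b * I + J b ->
  exists2 c, a <= c <= b & c * I + J c = 1.
Proof.
move=> rI a_gt0 ab fa fb.
have [||c] := @IVT R (fun x => x * I + J x) a b 1 ab.
- apply: continuous_in_subspaceT => x; rewrite inE/= in_itv/= => /andP[ax _].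
  apply: cvgD; first by apply: cvgM; [exact: cvg_id|exact: cvg_cst].
  by apply: (J_continuous A1 A2); exact: lt_le_trans ax.
- by rewrite ge_min fa/= le_max fb orbT.
by rewrite in_itv/= => cab fc; exists c.
Qed.

(** The exponent per unit of sample size in alt_pvalue_le. *)
Definition cumulant_gap (l : R) : R := l * psi (theta / l) - psi theta.

Lemma cumulant_gap1 : cumulant_gap 1 = 0.
Proof. by rewrite /cumulant_gap divr1 mul1r subrr. Qed.

Let l1 : 0 < (1 : R) <= 1. Proof. by rewrite ltr01 lexx. Qed.
Let T1 : Theta (theta / 1). Proof. by rewrite divr1. Qed.

Lemma rate_real nu s : (rate nu <= s%:E)%E -> exists2 I, rate nu = I%:E & 0 <= I <= s.
Proof.
move: (rate_ge0 F0 nu); case: (rate nu) => [I||] //.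
by rewrite !lee_fin => I0 Is; exists I; rewrite ?I0.
Qed.

(** The quantity to be bounded is, at the l provided by the duality, arbitrarily
    close to its value at the dual point nu. *)
Let dual_exponent nu s a c b' : 0 < a ->
  (forall e, 0 < e -> exists l, [/\ 0 < l <= 1, Theta (theta / l) &
     l * (s + psi (theta / l)) < theta * nu + e]) ->
  a * (theta * nu - psi theta) - c < b' ->
  exists l, [/\ 0 < l <= 1, Theta (theta / l) &
    l * (a * s) + a * cumulant_gap l - c < b'].
Proof.
move=> a_gt0 H lt.
pose e := (b' - (a * (theta * nu - psi theta) - c)) / a.
have e0 : 0 < e by rewrite divr_gt0// subr_gt0.
have ae : a * e = b' - (a * (theta * nu - psi theta) - c).
  by rewrite mulrC divfK// gt_eqF.
have [l [l01 Tl]] := H _ e0.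
rewrite -(ltr_pM2l a_gt0) => h.
by exists l; split => //; rewrite /cumulant_gap; lra.
Qed.

(** The point nu is the dual of s = a ^-1. If the rate of nu is s, then (nu, a)
    lies on the curve. If the rate jumps at nu, the curve ends above nu at some
    a1 >= a; the peak not having been passed there, the tangent of J shows that
    a (theta nu - psi theta) - J a is at most its value at a1. If s is below the
    rate of the mean, then l = 1 and the point of the curve above the mean do. *)
Lemma bonferroni_exponent b' a : curve_reaches_peak F0 J theta ->
  (bB F0 J theta < b'%:E)%E -> 0 < a ->
  exists l, [/\ 0 < l <= 1, Theta (theta / l) & l + a * cumulant_gap l - J a < b'].
Proof.
move=> peak lt a_gt0.
have [Is|sI] := leP Imu a^-1; last first.
  have I0 : 0 < Imu by apply: lt_trans sI; rewrite invr_gt0.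
  have a1 : 0 < Imu^-1 by rewrite invr_gt0.
  have aI : Imu^-1 * Imu = 1 by rewrite mulVf// gt_eqF.
  have := le_lt_trans (bB_ge (rate_mean Ttheta dpsi) a1 aI) lt.
  rewrite lte_fin aI => h; exists 1; split => //.
  rewrite cumulant_gap1 mulr0 addr0; apply: le_lt_trans h; rewrite lerD2l lerN2.
  apply: (J_le A1 A2); first exact: ltW.
  by rewrite -[leRHS]invrK lef_pV2 ?posrE ?invr_gt0// ltW.
have [nu [num rle approx jump]] := rate_dual Ttheta theta_neq0 dpsi Is.
suff h : a * (theta * nu - psi theta) - J a < b'.
  have [l [l01 Tl]] := dual_exponent a_gt0 approx h.
  by rewrite mulfV ?gt_eqF// mulr1 => ?; exists l.
have [I rI /andP[I0 Is']] := rate_real rle.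
move: Is'; rewrite le_eqVlt => /predU1P[IE|Ilt].
  have := le_lt_trans (bB_ge rI a_gt0 _) lt; rewrite lte_fin; apply.
  by rewrite IE mulfV// gt_eqF.
have [nu' [a' [a'_gt0 ar' num' Ja']]] := peak.
have rjump := jump; rewrite rI lte_fin in rjump.
have nu'nu : theta * nu' <= theta * nu.
  rewrite leNgt; apply/negP => nn.
  move: ar'; rewrite (rjump Ilt nu'); last by rewrite mulrBr subr_gt0.
  by rewrite gt0_muley ?lte_fin.
have rle' : (rate nu' <= rate nu)%E.
  by apply: (rate_nondecreasing Ttheta theta_neq0 dpsi) => //; rewrite mulrBr subr_ge0.
have [I' rI' /andP[I'0 I'I]] : exists2 I', rate nu' = I'%:E & 0 <= I' <= I.
  by apply: rate_real; rewrite -rI.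
move: ar'; rewrite rI' -EFinM => -[aI'].
have I'_gt0 : 0 < I'.
  rewrite lt_def I'0 andbT; apply: contraPneq aI' => ->.
  by rewrite mulr0; apply/eqP; rewrite eq_sym oner_eq0.
have I_gt0 : 0 < I by exact: lt_le_trans I'I.
pose a1 := I^-1.
have a1I : a1 * I = 1 by rewrite mulVf// gt_eqF.
have a1_gt0 : 0 < a1 by rewrite invr_gt0.
have aa1 : a <= a1 by rewrite -[leLHS]invrK lef_pV2 ?posrE ?invr_gt0// ltW.
have a1a' : a1 <= a'.
  have -> : a' = I'^-1 by apply/eqP; rewrite -[_ == _](inj_eq (mulIf (lt0r_neq0 I'_gt0))) aI' mulVf// gt_eqF.
  by rewrite lef_pV2 ?posrE.
have := le_lt_trans (bB_ge rI a1_gt0 a1I) lt; rewrite lte_fin; apply: le_lt_trans.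
have := J_tangent A1 A2 a_gt0 aa1.
have h1 : derive1 J a1 * (a1 - a) <= (theta * nu - psi theta) * (a1 - a).
  rewrite ler_wpM2r ?subr_ge0//.
  apply: le_trans (derive1J_le A1 A2 a1_gt0 a1a') _.
  by apply: le_trans Ja' _; rewrite lerD2r.
by move=> h2; have := le_trans h2 h1; lra.
Qed.

(** The point nu is the dual of s = (1 - J a) / a, or the mean if its rate
    exceeds s. The function b I + J b of b is continuous, so the curve is met above
    nu at some b; this b is at least a in the first case, including when the rate
    jumps at nu, and at most a in the second one, where l = 1. *)
Lemma rank_exponent b' a : (bR F0 J theta < b'%:E)%E -> 0 < a ->
  exists l, [/\ 0 < l <= 1, Theta (theta / l) &
    l * (1 - J a) + a * cumulant_gap l < b'].
Proof.
move=> lt a_gt0.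
have Imu0 := Imu_ge0 Ttheta dpsi.
have rmu := rate_mean Ttheta dpsi.
have [Is|sI] := leP Imu ((1 - J a) / a); last first.
  have fa : 1 <= a * Imu + J a.
    by move: sI; rewrite ltr_pdivrMr// => /ltW; lra.
  pose x := Num.min (Num.min a a0) (2 * (Imu + 1))^-1.
  have D0 : 0 < 2 * (Imu + 1) by lra.
  have x0 : 0 < x by rewrite !lt_min a_gt0 (a0_gt0 A1) invr_gt0.
  have xa : x <= a by rewrite !ge_min lexx.
  have fx : x * Imu + J x <= 1.
    rewrite (J_eq0 A1); last by rewrite ltW//= !ge_min lexx orbT.
    have : x <= (2 * (Imu + 1))^-1 by rewrite !ge_min lexx orbT.
    by rewrite -[x <= _]/(x <= _) -div1r ler_pdivlMr// => h; nra.
  have [c /andP[xc ca] fc] := curveR_through rmu x0 xa fx fa.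
  have c0 := lt_le_trans x0 xc.
  have := le_lt_trans (bR_ge rmu c0 fc) lt; rewrite lte_fin => h.
  exists 1; split => //; rewrite cumulant_gap1 mulr0 addr0 mul1r.
  by have := J_le A1 A2 (ltW c0) ca; lra.
have [nu [num rle approx jump]] := rate_dual Ttheta theta_neq0 dpsi Is.
suff h : a * (theta * nu - psi theta) - 0 < b'.
  have [l [l01 Tl]] := dual_exponent a_gt0 approx h.
  by rewrite subr0 [a * (_ / a)]mulrC divfK ?gt_eqF// => ?; exists l.
rewrite subr0.
have [I rI /andP[I0 Is']] := rate_real rle.
have fa : a * I + J a <= 1.
  by move: Is'; rewrite ler_pdivlMr//; lra.
have [A a0A JA] := J_unbounded A1 A2 1.
pose b := Num.max a A.
have ab : a <= b by rewrite le_max lexx.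
have fb : 1 <= b * I + J b.
  have : 1 <= J b by apply: JA; rewrite le_max lexx orbT.
  have : 0 <= b * I by rewrite mulr_ge0// (le_trans (ltW a_gt0)).
  lra.
have [c /andP[ac cb] fc] := curveR_through rI a_gt0 ab fa fb.
have c0 := lt_le_trans a_gt0 ac.
have := le_lt_trans (bR_ge rI c0 fc) lt; rewrite lte_fin; apply: le_lt_trans.
by rewrite ler_wpM2r//; move: num; rewrite mulrBr; lra.
Qed.

End exponents.

(** * Detection points below the transition curves *)

Section power_points.
Context {R : realType} (F0 : probability (measurableTypeR R) R) (theta a0 : R)
  (J : R -> R) (beta : R).
Hypothesis Ttheta : Theta F0 theta.
Hypothesis dpsi : psi_derivable F0 theta.
Hypotheses (A1 : J_flat a0 J) (A2 : J_convex a0 J).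
Hypothesis a0_le : (a0%:E * rate F0 (mean F0 theta) <= 1)%E.
Hypothesis beta_gt0 : 0 < beta.
Local Notation psi := (psi F0).
Local Notation mu := (mean F0 theta).
Local Notation rate := (rate F0).
Local Notation Imu := (theta * mu - psi theta).

(** The exponent of n in the expected number of alternative samples of size a L
    whose mean is near nu: there are n ^ (1 - beta - J a) alternative samples of
    that size, and the last term is the cost of a mean near nu. *)
Definition hit_exponent (nu I a : R) : R :=
  1 - beta - J a - a * (I - (theta * nu - psi theta)).

Let a0_gt0 := a0_gt0 A1.

Lemma alt_rate_ge0 nu I : rate nu = I%:E -> 0 <= I - (theta * nu - psi theta).
Proof. by move=> rI; rewrite subr_ge0; exact: (rate_fin_le rI Ttheta). Qed.

(** Continuity in a; a move to the right makes the detection inequality strict. *)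
Lemma hit_exponent_right nu I a : rate nu = I%:E -> a0 <= a ->
  0 < hit_exponent nu I a ->
  exists2 b, a < b & 0 < hit_exponent nu I b.
Proof.
move=> rI a0a; rewrite /hit_exponent; set E := 1 - _ - _ - _ => E0.
have k0 := alt_rate_ge0 rI; set kap := I - _ in E k0 E0 *.
have a_gt0 : 0 < a := lt_le_trans a0_gt0 a0a.
pose s := derive1 J (a + 1) + kap + 1.
have dJ : 0 <= derive1 J (a + 1) by apply: (derive1J_ge0 A1 A2); lra.
have s0 : 0 < s by rewrite /s; lra.
pose t := Num.min 1 (E / 2 / s).
have t0 : 0 < t by rewrite lt_min ltr01 !divr_gt0.
have t1 : t <= 1 by rewrite ge_min lexx.
have ts : t * s <= E / 2 by rewrite -ler_pdivlMr// ge_min lexx orbT.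
exists (a + t); first by rewrite ltrDl.
have h1 : J (a + t) - J a <= derive1 J (a + t) * (a + t - a).
  by apply: (J_tangent A1 A2) => //; lra.
have h2 : derive1 J (a + t) <= derive1 J (a + 1) by apply: (derive1J_le A1 A2); lra.
have h3 : derive1 J (a + t) * (a + t - a) <= derive1 J (a + 1) * t.
  by rewrite (_ : a + t - a = t) ?ler_wpM2r//; [exact: ltW|ring].
have EE : E = 1 - beta - J a - a * kap by [].
rewrite (_ : 1 - beta - J (a + t) - (a + t) * kap = E - (J (a + t) - J a) - t * kap); last first.
  by rewrite EE; ring.
have ts' : derive1 J (a + 1) * t + t * kap + t <= E / 2.
  by apply: le_trans ts; rewrite le_eqVlt; apply/orP; left; apply/eqP; rewrite /s; ring.
clearbody kap E; lra.
Qed.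

Let Imu_le : Imu <= a0^-1.
Proof.
move: a0_le; rewrite (rate_mean Ttheta dpsi) -EFinM lee_fin => h.
by rewrite -div1r ler_pdivlMr// mulrC.
Qed.

Lemma rate_convex x y Ix Iy t : rate x = Ix%:E -> rate y = Iy%:E -> 0 <= t <= 1 ->
  (rate ((1 - t) * x + t * y)%R <= ((1 - t) * Ix + t * Iy)%:E)%E.
Proof.
move=> rx ry /andP[t0 t1]; apply: rate_le => s Ts.
have h1 := rate_fin_le rx Ts; have h2 := rate_fin_le ry Ts.
have h3 : (1 - t) * (s * x - psi s) <= (1 - t) * Ix by rewrite ler_wpM2l// subr_ge0.
have h4 : t * (s * y - psi s) <= t * Iy by rewrite ler_wpM2l.
by have := lerD h3 h4; apply: le_trans; rewrite le_eqVlt; apply/orP; left; apply/eqP; ring.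
Qed.

(** A point of the curve with a < a0 is moved to a0. Along the segment from the
    mean to nu the rate crosses the level a0 ^-1, and convexity of the rate
    compares theta nu - psi theta at the crossing with its value at nu. *)
Lemma segment_point nu I a : rate nu = I%:E -> 0 < a -> a < a0 -> a * I = 1 ->
  beta < a * (theta * nu - psi theta) ->
  exists nu' I', [/\ rate nu' = I'%:E, 1 < a0 * I' & 0 < hit_exponent nu' I' a0].
Proof.
move=> rI a_gt0 aa0 aI bay; set y := theta * nu - psi theta in bay.
have Imu0 := Imu_ge0 Ttheta dpsi; have rmu := rate_mean Ttheta dpsi.
have I_gt0 : 0 < I by rewrite -(pmulr_rgt0 _ a_gt0) aI.
have IE : I = a^-1 by apply: (mulfI (lt0r_neq0 a_gt0)); rewrite aI mulfV// gt_eqF.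
have yI : y <= I by exact: (rate_fin_le rI Ttheta).
have Ia0 : a0^-1 < I by rewrite IE ltf_pV2 ?posrE.
have [eta Teta hgap] : exists2 s, Theta F0 s & a0^-1 < s * nu - psi s.
  by apply: rate_gt; rewrite rI lte_fin.
pose gap := eta * nu - psi eta - a0^-1.
have gap0 : 0 < gap by rewrite subr_gt0.
pose nt t := (1 - t) * mu + t * nu.
pose rho := Num.min 1 (gap / 2 / (`|eta * (nu - mu)| + 1)).
have D0 : 0 < `|eta * (nu - mu)| + 1 by rewrite ltr_wpDl.
have rho0 : 0 < rho by rewrite lt_min ltr01 !divr_gt0.
have rhoD : rho * (`|eta * (nu - mu)| + 1) <= gap / 2.
  by rewrite -ler_pdivlMr// ge_min lexx orbT.
(* The rate is only lower semicontinuous, so the crossing is taken just beyond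
   a near-supremum of the parameters with rate at most a0 ^-1, at a point where
   convexity bounds the rate from above. *)
pose S := [set t : R | 0 <= t <= 1 /\ (rate (nt t) <= (a0^-1)%:E)%E].
have S_le t : S t -> t <= 1 - rho.
  move=> [/andP[t0 t1] rt]; rewrite leNgt; apply/negP => tr.
  have := le_trans (rate_ge (nt t) Teta) rt; rewrite lee_fin /nt => h.
  have h1 : (1 - t) * (eta * (nu - mu)) <= rho * `|eta * (nu - mu)|.
    apply: (@le_trans _ _ ((1 - t) * `|eta * (nu - mu)|)).
      by rewrite ler_wpM2l ?ler_norm// subr_ge0.
    by rewrite ler_wpM2r//; lra.
  have e : gap <= (1 - t) * (eta * (nu - mu)).
    move: h; rewrite -subr_ge0 => h; rewrite -subr_ge0 /gap; move: h.
    by move=> h; apply: (le_trans h); rewrite le_eqVlt; apply/orP; left; apply/eqP; ring.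
  move: rhoD e h1 gap0 rho0; rewrite mulrDr mulr1; clear => *; lra.
have S0 : S 0.
  split; first by rewrite lexx ler01.
  by rewrite /nt subr0 mul1r mul0r addr0 rmu lee_fin.
have hS : has_sup S by split; [exists 0|exists (1 - rho)].
pose r := Num.min (2^-1) ((a * y - beta) / (2 * (a0 * I))).
have a0I : 0 < 2 * (a0 * I) by rewrite !mulr_gt0.
have r0 : 0 < r by rewrite lt_min; apply/andP; split; rewrite ?invr_gt0// divr_gt0// subr_gt0.
have r1 : r <= 2^-1 by rewrite ge_min lexx.
have rI' : r * (2 * (a0 * I)) <= a * y - beta by rewrite -ler_pdivlMr// ge_min lexx orbT.
have [ts Sts lts] := sup_adherent (mulr_gt0 r0 rho0) hS.
have ts1 := S_le _ Sts.
have [/andP[ts0 _] rts] := Sts.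
pose t := ts + r * (1 - ts).
have tgt : sup S < t.
  have : r * rho <= r * (1 - ts) by rewrite ler_pM2l//; lra.
  by rewrite /t; lra.
have t0 : 0 <= t by rewrite /t addr_ge0// mulr_ge0 ?ltW//; lra.
have t1 : t <= 1.
  have : r * (1 - ts) <= 1 * (1 - ts) by rewrite ler_wpM2r//; lra.
  by rewrite /t; lra.
have nS : ~ S t by move=> St; have := sup_upper_bound hS St; rewrite leNgt tgt.
have gt : (a0^-1%:E < rate (nt t))%E.
  by rewrite ltNge; apply/negP => le; apply: nS; split => //; rewrite t0.
have [Is rIs /andP[Is0 Isle]] := rate_real rts.
have le1 : (rate (nt t) <= ((1 - r) * Is + r * I)%:E)%E.
  have -> : nt t = (1 - r) * nt ts + r * nu by rewrite /nt /t; ring.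
  by apply: rate_convex => //; rewrite ltW//=; lra.
have [I' rI'' /andP[I'0 I'le]] := rate_real le1.
have le2 : I' <= (1 - t) * Imu + t * I.
  by rewrite -lee_fin -rI''; apply: rate_convex => //; rewrite t0.
have gtI' : a0^-1 < I' by move: gt; rewrite rI'' lte_fin.
have a0I' : 1 < a0 * I'.
  by rewrite -(mulfV (lt0r_neq0 a0_gt0)) ltr_pM2l.
exists (nt t), I'; split => //.
rewrite /hit_exponent (J_eq0 A1) ?lexx ?ltW ?a0_gt0// subr0.
have -> : theta * nt t - psi theta = (1 - t) * Imu + t * y by rewrite /nt /y; ring.
have up : a0 * I' <= 1 + r * (a0 * I).
  have : a0 * I' <= a0 * ((1 - r) * a0^-1 + r * I).
    rewrite ler_pM2l//; apply: (le_trans I'le); rewrite lerD2r ler_wpM2l//; lra.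
  rewrite mulrDr mulrCA mulfV ?gt_eqF//.
  by rewrite mulr1 [a0 * (r * I)]mulrCA; have := r0; lra.
suff : a * y <= a0 * ((1 - t) * Imu + t * y).
  have : r * (a0 * I) < a * y - beta.
    have : 0 < r * (a0 * I) by rewrite !mulr_gt0.
    by move: rI'; rewrite mulrCA mulr_natl mulr2n; lra.
  by move: up; rewrite mulrBr; lra.
have y0 : 0 < y by rewrite -(pmulr_rgt0 _ a_gt0) (lt_trans beta_gt0).
have ay1 : a * y <= 1 by rewrite -aI ler_pM2l.
have [h|h] := leP (a0 * t) a; last first.
  have : a * y <= (a0 * t) * y by rewrite ler_pM2r// ltW.
  have : 0 <= a0 * ((1 - t) * Imu) by apply: (mulr_ge0 (ltW a0_gt0)); apply: (mulr_ge0 _ Imu0); rewrite subr_ge0.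
  by rewrite mulrDr mulrA; lra.
have lowA : 1 - a0 * (t * I) <= a0 * ((1 - t) * Imu).
  have : a0 * a0^-1 <= a0 * ((1 - t) * Imu + t * I).
    by rewrite ler_pM2l// ltW// (lt_le_trans gtI').
  by rewrite mulfV ?gt_eqF// mulrDr; lra.
have key : 0 <= (1 - a0 * t * I) * (1 - a * y).
  apply: mulr_ge0; last by rewrite subr_ge0.
  by rewrite subr_ge0 -aI ler_pM2r.
have e : a0 * t * I * (a * y) = a0 * t * y.
  by rewrite mulrA -[a0 * t * I * a]mulrA [I * a]mulrC aI mulr1.
move: key; rewrite mulrBr mulr1 mulrBl mul1r e => key.
have -> : a0 * ((1 - t) * Imu + t * y) = a0 * ((1 - t) * Imu) + a0 * t * y by ring.
have e2 : a0 * (t * I) = a0 * t * I by ring.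
move: key lowA; rewrite e2; clear; set u := a0 * t * I; set v := a * y; set w := a0 * t * y.
by set z := a0 * _; clearbody u v w z; lra.
Qed.

(** A point of the curve with value above beta, moved so as to have a0 <= a and
    strict inequalities, which leave room for the errors of the asymptotic
    estimates. *)
Lemma power_point_bonferroni : (beta%:E < bB F0 J theta)%E ->
  exists nu I a, [/\ rate nu = I%:E, a0 <= a, 1 < a * I & 0 < hit_exponent nu I a].
Proof.
move=> /ereal_sup_gt[_ [[nu a] /= [a_gt0 ar] <-]].
have [I rI] : exists I, rate nu = I%:E.
  move: ar; have := rate_ge0 F0 nu; case: (rate nu) => [I _ _|_|//]; first by exists I.
  by rewrite gt0_muley ?lte_fin.
move: ar; rewrite rI -EFinM => -[aI].
have -> : (fH F0 J theta nu a = (a * (theta * nu - psi theta) - J a)%:E)%E.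
  rewrite /fH /gH rI.
  by rewrite -!EFinM -EFinD; congr _%:E; rewrite aI; field.
rewrite lte_fin => bf.
have [aa0|a0a] := ltP a a0.
  have Ja : J a = 0 by rewrite (J_eq0 A1)// !ltW.
  have bf' : beta < a * (theta * nu - psi theta) by move: bf; rewrite Ja subr0.
  have [nu' [I' [h1 h2 h3]]] := segment_point rI a_gt0 aa0 aI bf'.
  by exists nu', I', a0.
have E0 : 0 < hit_exponent nu I a by rewrite /hit_exponent mulrBr aI; lra.
have [b ab Eb] := hit_exponent_right rI a0a E0.
exists nu, I, b; split => //; first by rewrite (le_trans a0a)// ltW.
have I_gt0 : 0 < I by rewrite -(pmulr_rgt0 _ a_gt0) aI.
by rewrite -aI ltr_pM2r.
Qed.

Lemma power_point_rank : (beta%:E < bR F0 J theta)%E ->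
  exists nu I a, [/\ rate nu = I%:E, a0 <= a, 1 < a * I + J a & 0 < hit_exponent nu I a].
Proof.
move=> /ereal_sup_gt[_ [[nu a] /= [a_gt0 ar] <-]].
have [I rI] : exists I, rate nu = I%:E.
  move: ar; rewrite /gR; have := rate_ge0 F0 nu; case: (rate nu) => [I _ _|_|//]; first by exists I.
  by rewrite gt0_muley ?lte_fin.
move: ar; rewrite /gR rI -EFinM -EFinD => -[aI].
have -> : (fR F0 J theta nu a = (a * (theta * nu - psi theta))%:E)%E.
  rewrite /fR /gR rI.
  by rewrite -!EFinM -EFinD; congr _%:E; rewrite aI subrr mulr0 addr0.
rewrite lte_fin => bf.
have [aa0|a0a] := ltP a a0.
  have Ja : J a = 0 by rewrite (J_eq0 A1)// !ltW.
  have aI' : a * I = 1 by rewrite -[RHS]aI Ja addr0.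
  have [nu' [I' [h1 h2 h3]]] := segment_point rI a_gt0 aa0 aI' bf.
  by exists nu', I', a0; rewrite (J_eq0 A1) ?addr0 ?lexx ?ltW ?a0_gt0.
have E0 : 0 < hit_exponent nu I a by rewrite /hit_exponent mulrBr; lra.
have [b ab Eb] := hit_exponent_right rI a0a E0.
exists nu, I, b; split => //; first by rewrite (le_trans a0a)// ltW.
have I0 : 0 <= I by rewrite -lee_fin -rI rate_ge0.
have Jab : J a <= J b by apply: (J_le A1 A2); rewrite ltW.
have aIb : a * I <= b * I by rewrite ler_wpM2r// ltW.
move: I0; rewrite le_eqVlt => /predU1P[I0|I_gt0]; last first.
  have : a * I < b * I by rewrite ltr_pM2r.
  by lra.
have Ja : J a = 1 by rewrite -aI -I0 mulr0 add0r.
have a0a' : a0 < a.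
  rewrite lt_neqAle a0a andbT; apply/eqP => e; move: Ja.
  by rewrite -e (J_eq0 A1) ?lexx ?ltW ?a0_gt0// => /esym/eqP; rewrite oner_eq0.
have /andP[h _] := J_mvt A2 a0a (ltW ab).
have : 0 < derive1 J a * (b - a) by rewrite mulr_gt0 ?subr_gt0// (derive1J_gt0 A1 A2).
lra.
Qed.

End power_points.

(** * Asymptotics of the sample sizes *)

Section scale.
Context {R : realType}.

Lemma near_ln_ge (M : R) : \forall n \near \oo, M <= ln n%:R :> R.
Proof.
have := nbhs_infty_ger (expR M); apply: filterS => n h.
by rewrite -[M]expRK ler_ln ?posrE ?expR_gt0// (lt_le_trans _ h)// expR_gt0.
Qed.

Lemma powR_natE n (x : R) : (0 < n)%N -> n%:R `^ x = expR (x * ln n%:R).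
Proof. by move=> n0; rewrite /powR pnatr_eq0 gtn_eqF. Qed.

Lemma natr_expR n : (0 < n)%N -> n%:R = expR (ln n%:R) :> R.
Proof. by move=> n0; rewrite lnK// posrE ltr0n. Qed.

Lemma truncated_geometric_le (q : R) (m N : nat) : 0 < q < 1 -> (0 < m)%N ->
  \sum_(0 <= k < N) (if (m <= k.+1)%N then q ^+ (k.+1 - m) else 0) <= (1 - q)^-1.
Proof.
move=> /andP[q0 q1] m0; have q1' : 0 < 1 - q by rewrite subr_gt0.
suff -> : \sum_(0 <= k < N) (if (m <= k.+1)%N then q ^+ (k.+1 - m) else 0) =
    (1 - q ^+ (N.+1 - m)) / (1 - q).
  by rewrite ler_pdivrMr// mulVf ?gt_eqF// gerBl exprn_ge0// ltW.
elim: N => [|N IH].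
  by rewrite big_geq//; case: m m0 => // m _; rewrite subSS sub0n expr0 subrr mul0r.
rewrite big_nat_recr//= IH; case: leqP => mN.
  rewrite [in RHS]subSn// exprS -[X in _ + X](mulfK (lt0r_neq0 q1')) -mulrDl.
  by congr (_ / _); ring.
by rewrite addr0 (eqP (ltnW mN)) (eqP mN).
Qed.

End scale.

Section size_asymptotics.
Context {R : realType} (a0 : R) (J : R -> R) (alpha : nat -> nat -> R).
Hypotheses (A1 : J_flat a0 J) (A2 : J_convex a0 J) (A3 : alpha_subexponential a0 alpha).
Local Notation pmf := (size_pmf J alpha).
Local Notation L n := (ln n%:R : R).
Let a0_gt0 := a0_gt0 A1.

Lemma size_pmfE n k : (0 < n)%N ->
  pmf n k = alpha n k * expR (- (J (k%:R / L n) * L n)).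
Proof. by move=> n0; rewrite /size_pmf powR_natE// mulNr. Qed.

Lemma near_size_pmf_pos : \forall n \near \oo, exists2 k, (0 < k)%N & 0 < pmf n k.
Proof.
near=> n.
exists (Num.truncn (a0 * L n)).+1 => //.
have n0 : (0 < n)%N by near: n; exists 1%N.
rewrite size_pmfE// mulr_gt0 ?expR_gt0//.
have h : forall k : nat, (0 < k)%N -> a0 * L n <= k%:R ->
    0 < alpha n k /\ expR (- (1 * k%:R)) <= alpha n k <= expR (1 * k%:R).
  by near: n; apply: alpha_bounds.
by have [] := h (Num.truncn (a0 * L n)).+1 isT (ltW (truncnS_gt _)).
Unshelve. all: by end_near. Qed.

(** For sizes below a0 L, on which alpha is unconstrained, J vanishes and the
    bound by 1 is enough. *)
Lemma near_size_pmf_le (e A : R) : 0 < e -> 0 < A ->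
  \forall n \near \oo, forall k, (0 < k)%N -> pmf n k <= 1 -> k%:R <= A * L n ->
    pmf n k <= expR ((e - J (k%:R / L n)) * L n).
Proof.
move=> e0 A0; have eA : 0 < e / A by rewrite divr_gt0.
near=> n => k k0 p1 kA.
have n0 : (0 < n)%N by near: n; exists 1%N.
have L1 : 1 <= L n by near: n; exact: near_ln_ge.
have L0 : 0 < L n by exact: lt_le_trans L1.
have kp : 0 < k%:R :> R by rewrite ltr0n.
have h : forall k : nat, (0 < k)%N -> a0 * L n <= k%:R ->
    0 < alpha n k /\ expR (- (e / A * k%:R)) <= alpha n k <= expR (e / A * k%:R).
  by near: n; exact: alpha_bounds A3 _ _.
have [ak|ka] := leP (a0 * L n) k%:R.
  have [_ /andP[_ ub]] := h k k0 ak.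
  rewrite size_pmfE// mulrBl expRD ler_pM2r ?expR_gt0//.
  apply: (le_trans ub); rewrite ler_expR.
  by rewrite -mulrA ler_pM2l// mulrC ler_pdivrMr// mulrC.
apply: (le_trans p1); rewrite (J_eq0 A1); last first.
  by rewrite ler_pdivrMr// (ltW ka) andbT divr_ge0// ltW.
by rewrite subr0 -[leLHS]expR0 ler_expR mulr_ge0 ?ltW.
Unshelve. all: by end_near. Qed.

Lemma near_size_pmf_ge (e a : R) : 0 < e -> a0 <= a ->
  \forall n \near \oo, forall k, (0 < k)%N -> a * L n <= k%:R -> k%:R <= a * L n + 1 ->
    expR (- ((e + J a) * L n)) <= pmf n k.
Proof.
move=> e0 a0a.
have a_gt0 : 0 < a := lt_le_trans a0_gt0 a0a.
have dJ : 0 <= derive1 J (a + 1) by apply: (derive1J_ge0 A1 A2); lra.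
pose e1 := e / 2 / (a + 1).
have e10 : 0 < e1 by rewrite !divr_gt0//; lra.
near=> n => k k0 ak ka.
have n0 : (0 < n)%N by near: n; exists 1%N.
have L1 : 1 <= L n by near: n; exact: near_ln_ge.
have L2 : derive1 J (a + 1) / (e / 2) <= L n by near: n; exact: near_ln_ge.
have L0 : 0 < L n by exact: lt_le_trans L1.
have h : forall k : nat, (0 < k)%N -> a0 * L n <= k%:R ->
    0 < alpha n k /\ expR (- (e1 * k%:R)) <= alpha n k <= expR (e1 * k%:R).
  by near: n; exact: alpha_bounds A3 _ _.
have [|_ /andP[lb _]] := h k k0.
  by apply: le_trans ak; rewrite ler_pM2r.
rewrite size_pmfE//; apply: (@le_trans _ _ (expR (- (e1 * k%:R)) * expR (- (J (k%:R / L n) * L n)))); last first.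
  by rewrite ler_pM2r ?expR_gt0.
rewrite -expRD ler_expR -opprD lerN2.
set b := k%:R / L n.
have ab : a <= b by rewrite ler_pdivlMr.
have b1 : b <= a + 1 by rewrite ler_pdivrMr// mulrDl mul1r; lra.
have kE : k%:R = b * L n by rewrite divfK// gt_eqF.
have h1 : e1 * k%:R <= e / 2 * L n.
  apply: (@le_trans _ _ (e1 * ((a + 1) * L n))).
    by rewrite ler_pM2l// kE ler_pM2r.
  by rewrite mulrA divfK// gt_eqF//; lra.
have h2 := J_tangent A1 A2 a_gt0 ab.
have h3 : derive1 J b * (b - a) * L n <= derive1 J (a + 1).
  rewrite -mulrA -[leRHS]mulr1; apply: ler_pM.
  - by apply: (derive1J_ge0 A1 A2); lra.
  - by apply: mulr_ge0; [rewrite subr_ge0|exact: ltW].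
  - by apply: (derive1J_le A1 A2) => //; lra.
  - by rewrite mulrBl -kE; lra.
have h4 : (J b - J a) * L n <= derive1 J (a + 1).
  by apply: le_trans h3; rewrite ler_pM2r.
have h5 : derive1 J (a + 1) <= e / 2 * L n.
  by rewrite mulrC -ler_pdivrMr// divr_gt0.
by rewrite mulrDl; move: h4; rewrite mulrBl; lra.
Unshelve. all: by end_near. Qed.

(** J lies above its tangent at A, so beyond A L the mass function decreases
    geometrically. *)
Lemma near_size_tail_le (e A : R) : 0 < e -> a0 < A ->
  \forall n \near \oo, (forall k, (0 < k)%N -> 0 <= pmf n k) -> forall m, A * L n <= m%:R ->
  (\sum_(k <oo) (if (m <= k.+1)%N then pmf n k.+1 else 0)%:E <=
    (expR ((e - J A) * L n))%:E)%E.
Proof.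
move=> e0 aA.
have A0 : 0 < A := lt_trans a0_gt0 aA.
have s0 : 0 < derive1 J A by exact: (derive1J_gt0 A1 A2).
set s := derive1 J A in s0.
pose e1 := Num.min (s / 2) (e / 2 / A).
have e10 : 0 < e1 by rewrite lt_min !divr_gt0.
have e1s : e1 <= s / 2 by rewrite ge_min lexx.
have e1A : e1 * A <= e / 2 by rewrite -ler_pdivlMr// ge_min lexx orbT.
pose q := expR (- (s / 2)).
have q01 : 0 < q < 1 by rewrite expR_gt0 expR_lt1 oppr_lt0 divr_gt0.
have q1' : 0 < 1 - q by case/andP: q01; rewrite subr_gt0.
near=> n => pmf0 m Am.
have n0 : (0 < n)%N by near: n; exists 1%N.
have L1 : 1 <= L n by near: n; exact: near_ln_ge.
have L2 : - ln (1 - q) / (e / 2) <= L n by near: n; exact: near_ln_ge.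
have L0 : 0 < L n by exact: lt_le_trans L1.
have h : forall k : nat, (0 < k)%N -> a0 * L n <= k%:R ->
    0 < alpha n k /\ expR (- (e1 * k%:R)) <= alpha n k <= expR (e1 * k%:R).
  by near: n; exact: alpha_bounds A3 _ _.
have m0 : (0 < m)%N by rewrite -(ltr0n R); apply: lt_le_trans Am; rewrite mulr_gt0.
have bound k : (0 < k)%N -> (m <= k)%N ->
    pmf n k <= expR ((e / 2 - J A) * L n) * q ^+ (k - m).
  move=> k0 mk.
  have mk' : (m%:R <= k%:R :> R) by rewrite ler_nat.
  have Ak := le_trans Am mk'.
  have [|_ /andP[_ ub]] := h k k0.
    by apply: le_trans Ak; rewrite ler_pM2r// ltW.
  rewrite size_pmfE//.
  apply: (@le_trans _ _ (expR (e1 * k%:R) * expR (- (J (k%:R / L n) * L n)))).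
    by rewrite ler_pM2r ?expR_gt0.
  rewrite -expRD /q -expRM_natl -expRD ler_expR.
  set b := k%:R / L n.
  have Ab : A <= b by rewrite ler_pdivlMr.
  have kE : k%:R = b * L n by rewrite divfK// gt_eqF.
  have /andP[h2 _] := J_mvt A2 (ltW aA) Ab.
  have h3 : s * (k%:R - A * L n) <= (J b - J A) * L n.
    by rewrite kE -mulrBl mulrA ler_pM2r.
  have h4 : e1 * (k%:R - A * L n) <= s / 2 * (k%:R - A * L n).
    by rewrite ler_wpM2r// subr_ge0.
  have h5 : e1 * A * L n <= e / 2 * L n by rewrite ler_pM2r.
  have h6 : s / 2 * (k%:R - m%:R) <= s / 2 * (k%:R - A * L n).
    by rewrite ler_pM2l ?divr_gt0//; lra.
  rewrite natrB//.
  move: h3 h4 h5 h6; rewrite !mulrBr !mulrBl !mulrA.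
  clear; set u := e1 * _; set v := _ * L n; lra.
have c0 : 0 <= expR ((e / 2 - J A) * L n) by rewrite expR_ge0.
apply: lime_le.
  apply: is_cvg_nneseries => k _ _; case: ifP => // _; rewrite lee_fin pmf0//.
apply: nearW => N; rewrite sumEFin lee_fin.
apply: (@le_trans _ _ (expR ((e / 2 - J A) * L n) *
   \sum_(0 <= k < N) (if (m <= k.+1)%N then q ^+ (k.+1 - m) else 0))).
  rewrite mulr_sumr; apply: ler_sum => k _; case: ifP => mk; last by rewrite mulr0.
  exact: bound.
apply: (@le_trans _ _ (expR ((e / 2 - J A) * L n) * (1 - q)^-1)).
  by rewrite ler_wpM2l// truncated_geometric_le.
have -> : (e - J A) * L n = (e / 2 - J A) * L n + e / 2 * L n by field.
rewrite expRD ler_pM2l ?expR_gt0//.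
rewrite -[leLHS]lnK ?posrE ?invr_gt0// ler_expR lnV ?posrE//.
by rewrite mulrC -ler_pdivrMr// divr_gt0.
Unshelve. all: by end_near. Qed.

End size_asymptotics.

(** * Detection at a single sample size *)

Section detection.
Context {R : realType} (F0 : probability (measurableTypeR R) R) (theta a0 : R)
  (J : R -> R) (alpha : nat -> nat -> R) (beta : R).
Hypothesis Ttheta : Theta F0 theta.
Hypotheses (A1 : J_flat a0 J) (A2 : J_convex a0 J) (A3 : alpha_subexponential a0 alpha).
Local Notation pmf := (size_pmf J alpha).
Local Notation L n := (ln n%:R : R).
Local Notation psi := (psi F0).
Local Notation rate := (rate F0).
Local Notation hit_exponent := (hit_exponent F0 theta J beta).
Let a0_gt0 := a0_gt0 A1.

(** By cramer and alt_pvalue_ge, at k close to a L an alternative sample has a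
    p-value below n ^ (- (q + dl)) with probability about
    exp (- k (I - (theta nu - psi theta))), since q < a I. The number of such
    samples has expectation n ^ (hit_exponent - o(1)), which tends to infinity. *)
Lemma near_hit nu I a q : rate nu = I%:E -> a0 <= a -> 0 < q -> q < a * I ->
  0 < hit_exponent nu I a ->
  exists2 dl, 0 < dl & forall e, 0 < e -> \forall n \near \oo,
    exists k, [/\ (0 < k)%N, a * L n <= k%:R
      & expR (- (n%:R * (pmf n k *
          (n%:R `^ (- beta) * alt_power Ttheta k (expR (- ((q + dl) * L n))))))) <= e].
Proof.
move=> rI a0a q0 qaI; set E := hit_exponent _ _ _ => E0.
have a_gt0 : 0 < a := lt_le_trans a0_gt0 a0a.
have [s Ts gap0] : exists2 s, Theta F0 s & q / a < s * nu - psi s.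
  by apply: rate_gt; rewrite rI lte_fin ltr_pdivrMr// mulrC.
pose x0 := s * nu - psi s.
pose gap := a * x0 - q.
have gap_gt0 : 0 < gap by rewrite subr_gt0 mulrC -ltr_pdivrMr.
pose dl := gap / 3.
have dl0 : 0 < dl by rewrite divr_gt0.
have as0 : 0 < a * `|s| + 1 by rewrite ltr_wpDl// mulr_ge0// ltW.
have at0 : 0 < a * `|theta| + 1 by rewrite ltr_wpDl// mulr_ge0// ltW.
(* the half-width r of the window costs at most dl in the exponent of the p-value
   and E / 4 in that of the probability of a hit *)
pose r := Num.min (gap / 3 / (a * `|s| + 1)) (E / 4 / (a * `|theta| + 1)).
have r0 : 0 < r by rewrite lt_min !divr_gt0.
have rs : a * `|s| * r <= dl.
  apply: (@le_trans _ _ (r * (a * `|s| + 1))).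
    by rewrite mulrDr mulr1 [r * _]mulrC lerDl ltW.
  by rewrite -ler_pdivlMr// ge_min lexx.
have rt : a * `|theta| * r <= E / 4.
  apply: (@le_trans _ _ (r * (a * `|theta| + 1))).
    by rewrite mulrDr mulr1 [r * _]mulrC lerDl ltW.
  by rewrite -ler_pdivlMr// ge_min lexx orbT.
pose x := x0 - `|s| * r.
have ax : q + 2 * dl <= a * x.
  have -> : a * x = a * x0 - a * `|s| * r by rewrite /x; ring.
  have : gap = 3 * dl by rewrite /dl mulrC divfK.
  by rewrite /gap; move: rs; clear; lra.
have x_gt0 : 0 < x.
  by rewrite -(pmulr_rgt0 _ a_gt0) (lt_le_trans _ ax)// addr_gt0// mulr_gt0.
pose e1 := E / 4 / a.
have e10 : 0 < e1 by rewrite !divr_gt0.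
have ae1 : a * e1 = E / 4 by rewrite mulrC divfK// gt_eqF.
pose kap := I - (theta * nu - psi theta).
have kap0 : 0 <= kap by rewrite subr_ge0; exact: (rate_fin_le rI Ttheta).
pose D := kap + `|theta| * r + e1.
have D0 : 0 <= D by apply: addr_ge0; [apply: addr_ge0 => //; rewrite mulr_ge0// ltW|exact: ltW].
have E4 : 0 < E / 4 by rewrite divr_gt0.
have rI' : (rate nu <= I%:E)%E by rewrite rI.
have [N _ HN] := cramer r0 e10 rI'.
exists dl => // e e_gt0; near=> n.
have n0 : (0 < n)%N by near: n; exists 1%N.
have L1 : 1 <= L n by near: n; exact: near_ln_ge.
have L0 : 0 < L n by exact: lt_le_trans L1.
have LN : N%:R / a <= L n by near: n; exact: near_ln_ge.
have L2 : ln 2 / dl <= L n by near: n; exact: near_ln_ge.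
have L3 : (D - ln e) / (E / 4) <= L n by near: n; exact: near_ln_ge.
pose k := (Num.truncn (a * L n)).+1.
have aL0 : 0 <= a * L n by rewrite mulr_ge0 ?ltW.
have ak : a * L n <= k%:R by rewrite ltW// truncnS_gt.
have ka : k%:R <= a * L n + 1.
  by rewrite /k -natr1 lerD2r; have /andP[] := truncn_itv aL0.
exists k; split => //.
set t := expR (- ((q + dl) * L n)).
have hpm : forall k, (0 < k)%N -> a * L n <= k%:R -> k%:R <= a * L n + 1 ->
    expR (- ((E / 4 + J a) * L n)) <= pmf n k.
  by near: n; exact: (near_size_pmf_ge A1 A2 A3 E4 a0a).
have pm : expR (- ((E / 4 + J a) * L n)) <= pmf n k by exact: hpm.
have Nk : (N <= k)%N.
  by rewrite -(ler_nat R) (le_trans _ ak)// mulrC -ler_pdivrMr.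
have small : 2 * expR (- (k%:R * x)) <= t.
  have h1 : a * L n * x <= k%:R * x by rewrite ler_pM2r.
  have h2 : (q + 2 * dl) * L n <= a * L n * x by rewrite mulrAC ler_pM2r.
  have h3 : ln 2 <= dl * L n by rewrite mulrC -ler_pdivrMr.
  rewrite -[X in X * _]lnK ?posrE// -expRD /t ler_expR.
  move: h2; rewrite (_ : (q + 2 * dl) * L n = q * L n + 2 * (dl * L n)); last by ring.
  rewrite (_ : (q + dl) * L n = q * L n + dl * L n); last by ring.
  by move: h1 h3; clear; set u := dl * _; set v := q * _; set z := a * _ * _; set y := k%:R * x; lra.
have pw : expR (- (k%:R * D)) <= alt_power Ttheta k t.
  rewrite -lee_fin -alt_powerE.
  apply: le_trans (alt_pvalue_ge Ttheta Ts (small : 2 * expR (- (k%:R * (s * nu - psi s - `|s| * r))) <= t)).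
  have -> : - (k%:R * D) = k%:R * (theta * nu - psi theta - `|theta| * r) + - (k%:R * (I + e1)).
    by rewrite /D /kap; ring.
  by rewrite expRD EFinM lee_pmul2l ?lte_fin ?expR_gt0//; exact: HN.
have nE : n%:R = expR (L n) by rewrite -natr_expR.
set X := n%:R * _.
have XE : expR (E / 4 * L n - D) <= X.
  apply: (@le_trans _ _ (expR (L n) * (expR (- ((E / 4 + J a) * L n)) *
      (expR (- beta * L n) * expR (- (k%:R * D)))))).
    rewrite -!expRD ler_expR.
    have h1 : k%:R * D <= (a * L n + 1) * D by rewrite ler_wpM2r.
    have h2 : (a * `|theta| * r) * L n <= E / 4 * L n by rewrite ler_pM2r.
    have h3 : (a * L n + 1) * D = a * kap * L n + (a * `|theta| * r) * L n + a * e1 * L n + D.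
      by rewrite /D; ring.
    have h4 : E = 1 - beta - J a - a * kap by [].
    have h5 : E * L n = L n - beta * L n - J a * L n - a * kap * L n by rewrite h4; ring.
    move: h1; rewrite h3 ae1 => h1.
    have h6 : E / 4 * L n = E * L n / 4 by rewrite mulrAC.
    have h7 : (E / 4 + J a) * L n = E * L n / 4 + J a * L n by rewrite mulrDl h6.
    rewrite h7 mulNr h6; rewrite h6 in h1 h2; move: h1 h2 h5; clear.
    set u := E * L n; set v := k%:R * D; set w := a * `|theta| * r * L n.
    set z := a * kap * L n; set y := beta * L n; set p := J a * L n; lra.
  rewrite /X -natr_expR// ler_wpM2l// powR_natE//.
  by apply: ler_pM => //; rewrite ?mulr_ge0 ?expR_ge0// ler_wpM2l ?expR_ge0.
have h : D - ln e <= E / 4 * L n by rewrite mulrC -ler_pdivrMr.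
rewrite -[leRHS]lnK ?posrE// ler_expR lerNl.
apply: le_trans XE; apply: le_trans (expR_ge1Dx _); lra.
Unshelve. all: by end_near. Qed.

End detection.

(** * The two weights *)

Section pmf_nonnegative.
Context {R : realType} (F0 : probability (measurableTypeR R) R) (theta : R).
Hypothesis Ttheta : Theta F0 theta.
Local Notation mR := (measurableTypeR R).

Lemma mixture_setT eps k : 0 <= eps <= 1 -> mixture F0 theta eps k setT = 1%E.
Proof.
move=> e01; have := mixture_prodE Ttheta e01 k measurableT measurableT.
by rewrite setXTT mix_law_setT probability_setT mule1.
Qed.

(** The product formula for the size k at one index and a size of positive mass
    at all others. *)
Lemma sample_pmf_ge0 (pmf : nat -> R) (eps : R) (n : nat) d (Om : measurableType d)
    (P : probability Om R) (K : 'I_n -> Om -> nat) (Y V : 'I_n -> Om -> mR) :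
  sample F0 theta pmf eps P K Y V -> 0 <= eps <= 1 -> (0 < n)%N ->
  (exists2 k, (0 < k)%N & 0 < pmf k) -> forall k, (0 < k)%N -> 0 <= pmf k.
Proof.
move=> [_ _ _ _ prodE] e01 n_gt0 [k0 k0_gt0 pk0] k k_gt0.
have := prodE (fun i => if i == Ordinal n_gt0 then k else k0) (fun=> setT) (fun=> setT).
move=> /(_ _ (fun=> measurableT) (fun=> measurableT)) h.
have {}h := h (fun i => if i == Ordinal n_gt0 as b return (0 < if b then k else k0)%N then k_gt0 else k0_gt0).
have : (0 <= \prod_(i < n) (pmf (if i == Ordinal n_gt0 then k else k0))%:E)%E.
  have e : (\prod_(i < n) (pmf (if i == Ordinal n_gt0 then k else k0))%:E)%E =
    P [set w | forall i, [/\ K i w = if i == Ordinal n_gt0 then k else k0, setT (Y i w) & setT (V i w)]].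
    rewrite h; apply: eq_bigr => i _.
    by rewrite mixture_setT// probability_setT !mule1.
  by rewrite e measure_ge0.
rewrite prodEFin lee_fin (bigD1 (Ordinal n_gt0))//=.
rewrite (eq_bigr (fun=> pmf k0)); last by move=> i /negbTE ->.
by rewrite pmulr_lge0// prodr_gt0.
Qed.

End pmf_nonnegative.

Section weights.
Variable n : nat.

Definition unit_weight (kv : {ffun 'I_n -> nat}) (i : 'I_n) : nat := 1.

Definition rank_weight (kv : {ffun 'I_n -> nat}) (i : 'I_n) : nat :=
  #|[set j | (kv i <= kv j)%N]%SET|.

Lemma unit_weight_gt0 kv i : (0 < unit_weight kv i)%N. Proof. by []. Qed.

Lemma rank_weight_gt0 kv i : (0 < rank_weight kv i)%N.
Proof. by apply/card_gt0P; exists i; rewrite inE. Qed.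

Lemma rank_weight_le kv i : (rank_weight kv i <= n)%N.
Proof. by rewrite -[leqRHS](card_ord n) max_card. Qed.

Context {R : realType} (F0 : probability (measurableTypeR R) R)
  d (Om : measurableType d).
Variables (K : 'I_n -> Om -> nat) (Y V : 'I_n -> Om -> measurableTypeR R).

Lemma bonferroniE : bonferroni F0 K Y V = weighted_min F0 K Y V unit_weight.
Proof.
by apply/funext => w; apply: eq_bigr => i _; rewrite /unit_weight mul1r.
Qed.

Lemma rank_adjustedE : rank_adjusted F0 K Y V = weighted_min F0 K Y V rank_weight.
Proof.
apply/funext => w; apply: eq_bigr => i _; congr ((_%:R * _)%:E).
by apply: eq_card => j; rewrite !inE !ffunE.
Qed.

End weights.

Section harmonic.
Context {R : realType}.

(** Each inverse 1 / m is at most ln m - ln (m - 1). *)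
Lemma harmonic_le (n : nat) : (0 < n)%N ->
  \sum_(1 <= m < n.+1) (m%:R)^-1 <= 1 + ln n%:R :> R.
Proof.
case: n => // n _; elim: n => [|n IH]; first by rewrite big_nat1 invr1 ln1 addr0.
rewrite big_nat_recr//=; apply: (le_trans (lerD IH (lexx _))).
rewrite -addrA lerD2l.
have n2 : 0 < n.+2%:R :> R by rewrite ltr0n.
have n1 : 0 < n.+1%:R :> R by rewrite ltr0n.
have h : ln (1 + - (n.+2%:R)^-1) <= - (n.+2%:R)^-1 :> R.
  by apply: le_ln1Dx; rewrite ltrN2 invf_lt1// ltr1n.
have e : 1 + - (n.+2%:R)^-1 = n.+1%:R / n.+2%:R :> R.
  by rewrite -[n.+2]addn1 natrD; field; rewrite -natr1 in n2; rewrite gt_eqF.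
rewrite e ln_div ?posrE// in h; rewrite -lerBrDr; move: h; rewrite lerBlDr; set a := ln _; set b := ln _; set c := _^-1.
by rewrite addrC.
Qed.

(** Induction on the set: the rank within A of an index of smallest size is the
    cardinality of A, and its removal does not increase the other ranks. *)
Lemma rank_harmonic_set (n : nat) (kv : 'I_n -> nat) (A : {set 'I_n}) :
  \sum_(i in A) ((#|[set j in A | (kv i <= kv j)%N]|)%:R)^-1 <=
  \sum_(1 <= m < #|A|.+1) (m%:R)^-1 :> R.
Proof.
move: {2}#|A| (erefl #|A|) => m; elim: m A => [|m IH] A cA.
  by rewrite (cards0_eq cA) !big_set0 cards0 big_geq.
have /card_gt0P[i0 i0A] : (0 < #|A|)%N by rewrite cA.
pose i1 := [arg min_(i < i0 in A) kv i].
have [i1A i1min] : i1 \in A /\ forall j, j \in A -> (kv i1 <= kv j)%N.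
  by rewrite /i1; case: arg_minnP.
have cA1 : #|A :\ i1| = m.
  by have := cardsD1 i1 A; rewrite i1A cA add1n => -[].
rewrite (bigD1 i1)//= cA big_nat_recr//= [leRHS]addrC lerD//.
  rewrite (_ : [set _ in A | _] = A) ?cA//.
  by apply/setP => j; rewrite inE; case: (boolP (j \in A)) => // jA; rewrite i1min.
have := IH _ cA1; rewrite cA1 => h; apply: le_trans h.
rewrite [leRHS](eq_bigl (fun i => (i \in A) && (i != i1))); last first.
  by move=> i; rewrite !inE andbC.
apply: ler_sum => i /andP[iA ii1].
rewrite lef_pV2 ?posrE ?ltr0n ?ler_nat.
- by apply/subset_leq_card/fintype.subsetP => j; rewrite !inE => /andP[/andP[_ ->] ->].
- by apply/card_gt0P; exists i; rewrite inE iA leqnn.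
- by apply/card_gt0P; exists i; rewrite !inE iA ii1 leqnn.
Qed.

Lemma rank_harmonic (n : nat) (kv : {ffun 'I_n -> nat}) : (0 < n)%N ->
  \sum_(i < n) ((rank_weight kv i)%:R)^-1 <= 1 + ln n%:R :> R.
Proof.
move=> n0; apply: le_trans (harmonic_le n0).
have := rank_harmonic_set kv [set: 'I_n]%SET; rewrite cardsT card_ord.
apply: le_trans; rewrite le_eqVlt; apply/orP; left; apply/eqP.
apply: eq_big => [i|i _]; first by rewrite inE.
by congr (_%:R^-1); apply: eq_card => j; rewrite !inE.
Qed.

End harmonic.

Section risk_limits.
Context {R : realType}.

Lemma miss_le (x : R) (n : nat) : x <= 1 -> (1 - x) ^+ n <= expR (- (n%:R * x)).
Proof.
move=> x1; rewrite -mulrN expRM_natl lerXn2r ?nnegrE ?subr_ge0 ?expR_ge0//.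
exact: expR_ge1Dx.
Qed.

Lemma cvg_to0 (u : nat -> \bar R) : (forall n, 0 <= u n)%E ->
  (forall e : R, 0 < e -> \forall n \near \oo, (u n <= e%:E)%E) -> u @ \oo --> 0%E.
Proof.
move=> u0 ue; apply/fine_cvgP.
have fin n e : (u n <= e%:E)%E -> u n \is a fin_num.
  by move=> h; rewrite ge0_fin_numE// (le_lt_trans h)// ltry.
split; first by apply: filterS (ue 1 ltr01) => n; exact: fin.
apply/cvgrPdist_le => e e0; apply: filterS (ue e e0) => n h /=.
by rewrite sub0r normrN ger0_norm ?fine_ge0// -lee_fin fineK// (fin _ _ h).
Qed.

Lemma cvg_to1 (u : nat -> \bar R) : (\forall n \near \oo, u n <= 1)%E ->
  (forall e : R, 0 < e -> \forall n \near \oo, ((1 - e)%:E <= u n)%E) -> u @ \oo --> 1%E.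
Proof.
move=> u1 ue; apply/fine_cvgP.
have fin n e : (u n <= 1)%E -> ((1 - e)%:E <= u n)%E -> u n \is a fin_num.
  move=> h1 h2; rewrite fin_numE; apply/andP; split.
    by apply/eqP => h; move: h2; rewrite h.
  by apply/eqP => h; move: h1; rewrite h.
split.
  by apply: filterS2 u1 (ue 1 ltr01) => n; exact: fin.
apply/cvgrPdist_le => e e0; apply: filterS2 u1 (ue e e0) => n h1 h2 /=.
have f := fin _ _ h1 h2; move: h1 h2; rewrite -(fineK f) !lee_fin => h1 h2.
by rewrite ler_norml; apply/andP; split; lra.
Qed.

End risk_limits.

(** * Powerful tests *)

Section rank_overflow.
Context {R : realType} d (Om : measurableType d) (P : probability Om R) (n : nat).
Variable K : 'I_n -> Om -> nat.
Hypothesis mK : forall i, measurable_fun setT (K i).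
Hypothesis K_gt0 : forall i w, (0 < K i w)%N.

Definition tail_count (k : nat) (kv : {ffun 'I_n -> nat}) : R :=
  \sum_(i < n) (k <= kv i)%N%:R.

Lemma measurable_tail_count_gt k (B : R) :
  measurable [set w | B < tail_count k (Kvec K w)].
Proof.
have := measurable_fun_Kvec mK (tail_count k) measurableT (measurable_itv `]B, +oo[).
by rewrite setTI; congr measurable; apply/seteqP; split => w /=; rewrite in_itv/= andbT.
Qed.

(** Markov's inequality for the number of sizes at least k. *)
Lemma tail_count_overflow k (B tau : R) : 0 < B ->
  (forall i, P [set w | (k <= K i w)%N] <= tau%:E)%E ->
  (P [set w | (B < tail_count k (Kvec K w))%R] <= (n%:R * tau / B)%:E)%E.
Proof.
move=> B0 Htau; set bad := [set w | _].
have mbad : measurable bad by exact: measurable_tail_count_gt.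
have mE i : measurable [set w | (k <= K i w)%N].
  by have := mK i measurableT (Y := [set m | (k <= m)%N]) Logic.I; rewrite setTI.
have h1 : (B%:E * P bad <= \int[P]_w (\sum_(i < n) (1 * (k <= K i w)%N%:R)%:E))%E.
  have -> : (B%:E * P bad = \int[P]_w (B%:E * (\1_bad w)%:E))%E.
    rewrite ge0_integralZl ?lee_fin ?(ltW B0)//; last first.
      by apply/measurable_EFinP; exact: measurable_indic.
    by rewrite integral_indic// setIT.
  apply: ge0_le_integral => //.
  - by move=> w _; rewrite mule_ge0// lee_fin// ltW.
  - by apply/measurable_EFinP; apply: measurable_realfun.measurable_funM => //; exact: measurable_indic.
  - have := measurable_fun_Kvec mK (tail_count k) => /measurable_EFinP.
    congr measurable_fun; apply/funext => w.
    by rewrite sumEFin; congr _%:E; apply: eq_bigr => i _; rewrite mul1r ffunE.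
  move=> w _; rewrite indicE sumEFin -EFinM lee_fin; case: (boolP (w \in bad)) => [|_].
    rewrite inE /bad/= mulr1 => /ltW; congr (_ <= _).
    by apply: eq_bigr => i _; rewrite mul1r ffunE.
  by rewrite mulr0; apply: sumr_ge0 => i _; rewrite mulr_ge0.
rewrite EFinM lee_pdivlMr// muleC; apply: (le_trans h1).
rewrite ge0_integral_sum//; last first.
- move=> i; apply/measurable_EFinP; apply: measurable_realfun.measurable_funM => //.
  have := measurable_fun_Kvec mK (fun kv => (k <= kv i)%N%:R : R).
  by congr measurable_fun; apply/funext => w; rewrite ffunE.
apply: (@le_trans _ _ (\sum_(i < n) tau%:E)%E).
  apply: lee_sum => i _.
  by rewrite (integral_count P mK (fun m => (k <= m)%N) i ler01) mul1e.
by rewrite sumEFin sumr_const card_ord mulr_natl.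
Qed.

Lemma rank_weight_le_tail (kv : {ffun 'I_n -> nat}) i :
  (rank_weight kv i)%:R = tail_count (kv i) kv.
Proof.
rewrite /tail_count -natr_sum; congr _%:R.
rewrite /rank_weight -sum1_card big_mkcond /=; apply: eq_bigr => j _.
by rewrite inE; case: leqP.
Qed.

End rank_overflow.

Section asymptotic_tests.
Context {R : realType} (F0 : probability (measurableTypeR R) R)
    (a0 : R) (J : R -> R) (alpha : nat -> nat -> R) (beta theta : R)
    (d : nat -> measure_display) (Om : forall n, measurableType (d n))
    (P0 P1 : forall n, probability (Om n) R)
    (K : forall n, 'I_n -> Om n -> nat)
    (Y V : forall n, 'I_n -> Om n -> measurableTypeR R).
Hypotheses (beta01 : 0 < beta < 1)
    (A1 : J_flat a0 J) (A2 : J_convex a0 J) (A3 : alpha_subexponential a0 alpha)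
    (Ttheta : Theta F0 theta)
    (dpsi : psi_derivable F0 theta)
    (a0_le : (a0%:E * rate F0 (mean F0 theta) <= 1)%E)
    (H0 : forall n, sample F0 theta (size_pmf J alpha n) 0 (P0 n)
                      (@K n) (@Y n) (@V n))
    (H1 : forall n, sample F0 theta (size_pmf J alpha n) (n%:R `^ (- beta))
                      (P1 n) (@K n) (@Y n) (@V n)).
Local Notation pmf := (size_pmf J alpha).
Local Notation L n := (ln n%:R : R).
Local Notation eps n := (n%:R `^ (- beta) : R).
Local Notation regular n := ([/\ (0 < n)%N, 0 <= eps n <= 1,
  forall k, (0 < k)%N -> 0 <= pmf n k & exists2 k, (0 < k)%N & 0 < pmf n k]).
Let a0_gt0 := a0_gt0 A1.
Let beta_gt0 : 0 < beta. Proof. by case/andP: beta01. Qed.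
Let zero01 : 0 <= (0 : R) <= 1. Proof. by rewrite lexx ler01. Qed.

Lemma eps01 n : (0 < n)%N -> 0 <= eps n <= 1.
Proof.
move=> n0; rewrite powR_ge0 powR_natE// -[leRHS]expR0 ler_expR mulNr oppr_le0.
by rewrite mulr_ge0 ?(ltW beta_gt0)// ln_ge0// ler1n.
Qed.

Lemma near_regular : \forall n \near \oo, regular n.
Proof.
near=> n; have n0 : (0 < n)%N by near: n; exists 1%N.
have pos : exists2 k, (0 < k)%N & 0 < pmf n k by near: n; exact: near_size_pmf_pos A3.
by split => //; [exact: eps01|exact: (sample_pmf_ge0 Ttheta (H0 n) zero01 n0 pos)].
Unshelve. all: by end_near. Qed.

(** At A = a0 the bound holds because J a0 = 0. *)
Lemma near_tail_prob e A : 0 < e -> a0 <= A -> \forall n \near \oo, forall i m,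
  A * L n <= m%:R ->
  (P0 n [set w | (m <= K i w)%N] <= (expR ((e - J A) * L n))%:E)%E /\
  (P1 n [set w | (m <= K i w)%N] <= (expR ((e - J A) * L n))%:E)%E.
Proof.
move=> e0; rewrite le_eqVlt => /predU1P[aA|aA].
  near=> n => i m _.
  have L0 : 0 <= L n by near: n; exact: near_ln_ge.
  have h (P : probability (Om n) R) : (P [set w | (m <= K i w)%N] <= (expR ((e - J A) * L n))%:E)%E.
    apply: (@le_trans _ _ 1%E).
      apply: probability_le1.
      have mKi : measurable_fun setT (@K n i) := sample_mK (H0 n) i.
      by have := mKi measurableT [set k | (m <= k)%N] Logic.I; rewrite setTI.
    rewrite -aA (J_eq0 A1) ?lexx ?(ltW a0_gt0)// subr0 lee_fin -[leLHS]expR0 ler_expR.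
    by rewrite mulr_ge0// ltW.
  by split; exact: h.
near=> n => i m Am.
have [n0 e01 p0 pos] : regular n.
  by near: n; exact: near_regular.
rewrite (size_tail_prob Ttheta (H0 n) zero01 p0 pos n0).
rewrite (size_tail_prob Ttheta (H1 n) e01 p0 pos n0).
have h : (forall k, (0 < k)%N -> 0 <= pmf n k) -> forall m, A * L n <= m%:R ->
  (\sum_(k <oo) (if (m <= k.+1)%N then pmf n k.+1 else 0)%:E <=
    (expR ((e - J A) * L n))%:E)%E.
  by near: n; exact: (near_size_tail_le A1 A2 A3 e0 aA).
by have := h p0 m Am.
Unshelve. all: by end_near. Qed.

Section powerful.

Lemma miss_pmf_le n k t : regular n ->
  (0 < k)%N ->
  (1 - pmf n k * (eps n * alt_power Ttheta k t)) ^+ n <=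
    expR (- (n%:R * (pmf n k * (eps n * alt_power Ttheta k t)))).
Proof.
move=> [n0 /andP[e0 e1] p0 pos] k0; apply: miss_le.
have p1 : pmf n k <= 1 by exact: (pmf_le1 Ttheta (H0 n) zero01 p0 pos n0 k0).
rewrite -[leRHS]mulr1 ler_pM ?p0// ?mulr_ge0 ?alt_power_ge0//.
by rewrite -[leRHS]mulr1 ler_pM ?alt_power_ge0 ?alt_power_le1.
Qed.

Lemma near_expR_small (c e : R) : 0 < c -> 0 < e ->
  \forall n \near \oo, expR (- (c * L n)) <= e.
Proof.
move=> c0 e0; near=> n.
have h : - ln e / c <= L n by near: n; exact: near_ln_ge.
by rewrite -[leRHS]lnK ?posrE// ler_expR lerNl mulrC -ler_pdivrMr.
Unshelve. all: by end_near. Qed.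

Lemma near_expR_linear (c e : R) : 0 < c -> 0 < e ->
  \forall n \near \oo, expR (- (c * L n)) * (1 + L n) <= e.
Proof.
move=> c0 e0; have g0 : 0 < e * (c / 2) ^+ 2 by rewrite mulr_gt0 ?exprn_gt0 ?divr_gt0.
near=> n.
have x1 : 1 <= L n by near: n; exact: near_ln_ge.
have x2 : 2 / (e * (c / 2) ^+ 2) <= L n by near: n; exact: near_ln_ge.
rewrite expRN mulrC ler_pdivrMr ?expR_gt0//; move: x1 x2; set x := L n => x1 x2.
rewrite ler_pdivrMr// in x2.
have x0 : 0 <= x by rewrite (le_trans ler01).
have y0 : 0 <= c / 2 * x by rewrite mulr_ge0// ltW// divr_gt0.
have h1 : (c / 2 * x) ^+ 2 <= expR (c * x).
  have -> : c * x = 2%:R * (c / 2 * x) by rewrite mulrA mulrCA divff ?mulr1.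
  rewrite expRM_natl lerXn2r ?nnegrE ?expR_ge0//.
  by apply: le_trans (expR_ge1Dx _); rewrite lerDr.
apply: (@le_trans _ _ (e * (c / 2 * x) ^+ 2)); last by rewrite ler_pM2l.
have -> : e * (c / 2 * x) ^+ 2 = x * (e * (c / 2) ^+ 2) * x by rewrite exprMn; ring.
apply: (@le_trans _ _ (2 * x)); first by rewrite mulr_natl mulr2n lerD2r.
by rewrite ler_wpM2r.
Unshelve. all: by end_near. Qed.

(** With the threshold n ^ (- (1 + dl)) the union bound gives n ^ (- dl) under the
    null, and near_hit with q = 1 gives detection under the alternative. *)
Lemma bonferroni_powerful : (beta%:E < bB F0 J theta)%E ->
  asymptotically_powerful P0 P1 (fun n => bonferroni F0 (@K n) (@Y n) (@V n)).
Proof.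
move=> /(power_point_bonferroni Ttheta dpsi A1 A2 a0_le beta_gt0).
move=> [nu [I [a [rI a0a aI E0]]]].
have [dl dl0 hit] := near_hit Ttheta A1 A2 A3 rI a0a ltr01 aI E0.
apply: cvg_to0 => [n|e e0]; first by rewrite bonferroniE; exact: risk_ge0.
have e2 : 0 < e / 2 by rewrite divr_gt0.
near=> n.
have good : regular n.
  by near: n; exact: near_regular.
have [n0 e01 p0 pos] := good.
have [k [k0 _ hk]] : exists k, [/\ (0 < k)%N, a * L n <= k%:R
      & expR (- (n%:R * (pmf n k *
          (eps n * alt_power Ttheta k (expR (- ((1 + dl) * L n))))))) <= e / 2].
  by near: n; exact: hit.
have b0 : expR (- (dl * L n)) <= e / 2 by near: n; exact: near_expR_small.
set t := expR (- ((1 + dl) * L n)) in hk.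
have W0 := @unit_weight_gt0 n.
rewrite bonferroniE; apply: (@le_trans _ _ (e / 2 + e / 2)%:E); last by rewrite -splitr.
apply: (@risk_le _ _ _ _ _ _ _ _ _ _ _ t).
  apply: (null_reject_le Ttheta (H0 n) p0 pos W0); first exact: expR_ge0.
  move=> kv; apply: le_trans b0.
  rewrite (eq_bigr (fun=> t)); last by move=> i _; rewrite divr1.
  have -> : \sum_(i < n) t = expR (L n) * t by rewrite sumr_const card_ord -natr_expR// mulr_natl.
  rewrite -expRD ler_expR.
  by rewrite mulrDl mul1r opprD addNKr.
apply: le_trans (alt_accept_le Ttheta (H0 n) (H1 n) e01 p0 pos n0 W0 k0 measurable0 (c := t) (t := t) _) _.
  by move=> w i _ _; rewrite mul1r.
rewrite measure0 add0e lee_fin; apply: le_trans hk.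
exact: miss_pmf_le.
Unshelve. all: by end_near. Qed.

(** The threshold is n ^ (- r) with dl = 3 r. The sum of the inverse ranks is
    only logarithmic under the null. Under the alternative at most
    B = n ^ (1 - J a + 2 r) observations have size at least k, except with
    probability n ^ (- r); a p-value below n ^ (- r) / B = n ^ (- (1 - J a + dl))
    at the size k of near_hit then leads to rejection. *)
Lemma rank_powerful : (beta%:E < bR F0 J theta)%E ->
  asymptotically_powerful P0 P1 (fun n => rank_adjusted F0 (@K n) (@Y n) (@V n)).
Proof.
move=> /(power_point_rank Ttheta dpsi A1 A2 a0_le beta_gt0).
move=> [nu [I [a [rI a0a aI E0]]]].
have kap0 := alt_rate_ge0 Ttheta rI.
have a_gt0 : 0 < a := lt_le_trans a0_gt0 a0a.
have q0 : 0 < 1 - J a.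
  have : 0 <= a * (I - (theta * nu - psi F0 theta)) by rewrite mulr_ge0// ltW.
  by move: E0; rewrite /hit_exponent; have := beta_gt0; set x := a * _; lra.
have qI : 1 - J a < a * I by rewrite ltrBlDr.
have [dl dl0 hit] := near_hit Ttheta A1 A2 A3 rI a0a q0 qI E0.
apply: cvg_to0 => [n|e e0]; first by rewrite rank_adjustedE; exact: risk_ge0.
have e3 : 0 < e / 3 by rewrite divr_gt0.
(* one third of dl for the threshold, one for the number of large sizes, and one
   for the tail probability of the sizes *)
pose r := dl / 3; have r0 : 0 < r by rewrite divr_gt0.
have dlE : dl = 3 * r by rewrite mulrC divfK.
near=> n.
have good : regular n.
  by near: n; exact: near_regular.
have [n0 e01 p0 pos] := good.
have L1 : 1 <= L n by near: n; exact: near_ln_ge.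
have [k [k0 ak hk]] : exists k, [/\ (0 < k)%N, a * L n <= k%:R
      & expR (- (n%:R * (pmf n k *
          (eps n * alt_power Ttheta k (expR (- ((1 - J a + dl) * L n))))))) <= e / 3].
  by near: n; exact: hit.
have tl : forall i m, a * L n <= m%:R ->
  (P0 n [set w | (m <= K i w)%N] <= (expR ((r - J a) * L n))%:E)%E /\
  (P1 n [set w | (m <= K i w)%N] <= (expR ((r - J a) * L n))%:E)%E.
  by near: n; exact: near_tail_prob.
have small1 : expR (- (r * L n)) <= e / 3 by near: n; exact: near_expR_small.
have small2 : expR (- (r * L n)) * (1 + L n) <= e / 3.
  by near: n; exact: near_expR_linear.
set t := expR (- ((1 - J a + dl) * L n)) in hk.
pose c := expR (- (r * L n)).
pose B := expR ((1 - J a + 2 * r) * L n).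
have ctB : B * t = c.
  by rewrite /B /t /c -expRD dlE; congr expR; ring.
have B0 : 0 < B by exact: expR_gt0.
have W0 := @rank_weight_gt0 n.
rewrite rank_adjustedE; apply: (@le_trans _ _ (e / 3 + (e / 3 + e / 3))%:E); last first.
  by rewrite lee_fin; lra.
apply: (@risk_le _ _ _ _ _ _ _ _ _ _ _ c).
  apply: (null_reject_le Ttheta (H0 n) p0 pos W0); first exact: expR_ge0.
  move=> kv; apply: le_trans small2.
  by rewrite -mulr_sumr ler_wpM2l ?expR_ge0// rank_harmonic.
pose bad := [set w | B < tail_count k (Kvec (@K n) w)].
have mbad : measurable bad := measurable_tail_count_gt (sample_mK (H1 n)) k B.
apply: le_trans (alt_accept_le Ttheta (H0 n) (H1 n) e01 p0 pos n0 W0 k0 mbad (c := c) (t := t) _) _.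
  move=> w i nb Kk pt; rewrite -ctB.
  have : (rank_weight (Kvec (@K n) w) i)%:R <= B.
    by rewrite rank_weight_le_tail ffunE Kk leNgt; apply/negP.
  move=> WB; apply: (@le_trans _ _ ((rank_weight (Kvec (@K n) w) i)%:R * t)).
    by rewrite ler_wpM2l.
  by rewrite ler_wpM2r// expR_ge0.
rewrite EFinD leeD//; last first.
  by rewrite lee_fin; apply: le_trans hk; exact: miss_pmf_le.
have := tail_count_overflow (sample_mK (H1 n)) B0 (fun i => (tl i k ak).2).
move=> /le_trans; apply; rewrite lee_fin; apply: le_trans small1.
have -> : n%:R * expR ((r - J a) * L n) / B = expR (L n) * expR ((r - J a) * L n) / B.
  by rewrite -natr_expR.
rewrite -expRN -!expRD ler_expR.
by rewrite le_eqVlt; apply/orP; left; apply/eqP; ring.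
Unshelve. all: by end_near. Qed.

End powerful.

End asymptotic_tests.

(** * Powerless tests *)

Section powerless.
Context {R : realType} (F0 : probability (measurableTypeR R) R)
    (a0 : R) (J : R -> R) (alpha : nat -> nat -> R) (beta theta : R)
    (d : nat -> measure_display) (Om : forall n, measurableType (d n))
    (P0 P1 : forall n, probability (Om n) R)
    (K : forall n, 'I_n -> Om n -> nat)
    (Y V : forall n, 'I_n -> Om n -> measurableTypeR R).
Hypotheses (beta01 : 0 < beta < 1)
    (A1 : J_flat a0 J) (A2 : J_convex a0 J) (A3 : alpha_subexponential a0 alpha)
    (Ttheta : Theta F0 theta) (theta_neq0 : theta != 0)
    (dpsi : psi_derivable F0 theta)
    (a0_le : (a0%:E * rate F0 (mean F0 theta) <= 1)%E)
    (H0 : forall n, sample F0 theta (size_pmf J alpha n) 0 (P0 n)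
                      (@K n) (@Y n) (@V n))
    (H1 : forall n, sample F0 theta (size_pmf J alpha n) (n%:R `^ (- beta))
                      (P1 n) (@K n) (@Y n) (@V n)).
Local Notation pmf := (size_pmf J alpha).
Local Notation L n := (ln n%:R : R).
Local Notation eps n := (n%:R `^ (- beta) : R).
Local Notation regular n := ([/\ (0 < n)%N, 0 <= eps n <= 1,
  forall k, (0 < k)%N -> 0 <= pmf n k & exists2 k, (0 < k)%N & 0 < pmf n k]).
Let a0_gt0 := a0_gt0 A1.
Let zero01 : 0 <= (0 : R) <= 1. Proof. by rewrite lexx ler01. Qed.

Section from_counts.
Variables (W : forall n, {ffun 'I_n -> nat} -> 'I_n -> nat) (c : nat -> R)
  (A gam : R) (C C' : nat -> nat -> R).
Hypothesis W_gt0 : forall n (kv : {ffun 'I_n -> nat}) i, (0 < W kv i)%N.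
Hypothesis c_gt0 : forall n, 0 < c n.
Hypothesis gam_gt0 : 0 < gam.
Hypothesis gam_le1 : gam <= 1.
Hypothesis cW : \forall n \near \oo, forall (kv : {ffun 'I_n -> nat}) i,
  expR ((gam - 1) * L n) <= c n / (W kv i)%:R.
Hypothesis a0A : a0 <= A.
Hypothesis JA : 2 <= J A.
Hypothesis C_ge0 : forall n k, 0 <= C n k.
Hypothesis C'_ge0 : forall n k, 0 <= C' n k.
Hypothesis countC : \forall n \near \oo, forall k, (0 < k)%N -> k%:R <= A * L n ->
  n%:R * pmf n k * C n k + C' n k <= 2 * expR ((beta - gam) * L n).
Hypothesis detC : \forall n \near \oo, forall kv : {ffun 'I_n -> nat}, (forall i, (0 < kv i)%N) ->
  expected_detections Ttheta (@W n) (c n) kv <=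
    \sum_(i < n) \sum_(1 <= k < (Num.truncn (A * L n)).+1) C n k * (kv i == k)%:R +
    \sum_(1 <= k < (Num.truncn (A * L n)).+1) C' n k +
    \sum_(i < n) (Num.truncn (A * L n) < kv i)%N%:R.

(** Each weighted p-value is below c n with probability of order at least
    n ^ (gam - 1), hence some of the n are. *)
Lemma near_null_accept e : 0 < e -> \forall n \near \oo,
  (P0 n (accept F0 (@K n) (@Y n) (@V n) (@W n) (c n)) <= e%:E)%E.
Proof.
move=> e0; near=> n.
have [n0 e01 p0 pos] : regular n.
  by near: n; exact: (near_regular beta01 A3 Ttheta H0).
have L0 : 0 <= L n by near: n; exact: near_ln_ge.
have cWn : forall (kv : {ffun 'I_n -> nat}) i, expR ((gam - 1) * L n) <= c n / (W kv i)%:R.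
  by near: n; exact: cW.
have small : expR (- (gam / 2 * L n)) <= e.
  by near: n; apply: near_expR_small => //; rewrite divr_gt0.
apply: (null_accept_le Ttheta (H0 n) p0 pos (@W_gt0 n)) => //; first exact: ltW.
move=> kv; apply: le_trans small.
pose x := expR ((gam - 1) * L n).
have x1 : x <= 1.
  by rewrite /x -[leRHS]expR0 ler_expR mulr_le0_ge0// subr_le0.
apply: (@le_trans _ _ (\prod_(i < n) expR (- (x / 2)))).
  apply: ler_prod => i _; apply/andP; split.
    have : Num.min 1 (c n / (W kv i)%:R) <= 1 by rewrite ge_min lexx.
    lra.
  have : x <= Num.min 1 (c n / (W kv i)%:R) by rewrite le_min x1 cWn.
  have := expR_ge1Dx (- (x / 2)); lra.
rewrite prodr_const card_ord -expRM_natl ler_expR mulrN lerN2.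
have -> : n%:R * (x / 2) = expR (gam * L n) / 2.
  have -> : n%:R * (x / 2) = expR (L n) * x / 2 by rewrite -natr_expR// mulrA.
  by rewrite /x -expRD; congr (expR _ / 2); ring.
have := expR_ge1Dx (gam * L n); have := mulr_ge0 (ltW gam_gt0) L0.
by rewrite mulrAC; set y := gam * L n; lra.
Unshelve. all: by end_near. Qed.

(** Sizes above A L are too rare to contribute, as J A >= 2; the at most A L
    other ones contribute at most 2 n ^ (- gam) each. *)
Lemma near_detections e : 0 < e -> \forall n \near \oo,
  (\int[P0 n]_w (eps n * expected_detections Ttheta (@W n) (c n) (Kvec (@K n) w))%:E <= e%:E)%E.
Proof.
move=> e0; have A_gt0 : 0 < A := lt_le_trans a0_gt0 a0A.
have e2 : 0 < e / 2 by rewrite divr_gt0.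
have eA : 0 < e / 2 / (2 * A) by rewrite !divr_gt0// mulr_gt0.
near=> n.
have [n0 e01 p0 pos] : regular n.
  by near: n; exact: (near_regular beta01 A3 Ttheta H0).
have L0 : 0 <= L n by near: n; exact: near_ln_ge.
have tl : forall i m, A * L n <= m%:R ->
  (P0 n [set w | (m <= K i w)%N] <= (expR ((2^-1 - J A) * L n))%:E)%E /\
  (P1 n [set w | (m <= K i w)%N] <= (expR ((2^-1 - J A) * L n))%:E)%E.
  by near: n; apply: (near_tail_prob beta01 A1 A2 A3 Ttheta H0 H1).
have hC : forall k, (0 < k)%N -> k%:R <= A * L n ->
  n%:R * pmf n k * C n k + C' n k <= 2 * expR ((beta - gam) * L n) by near: n; exact: countC.
have hD : forall kv : {ffun 'I_n -> nat}, (forall i, (0 < kv i)%N) ->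
  expected_detections Ttheta (@W n) (c n) kv <=
    \sum_(i < n) \sum_(1 <= k < (Num.truncn (A * L n)).+1) C n k * (kv i == k)%:R +
    \sum_(1 <= k < (Num.truncn (A * L n)).+1) C' n k +
    \sum_(i < n) (Num.truncn (A * L n) < kv i)%N%:R by near: n; exact: detC.
have small1 : expR (- (gam * L n)) * (1 + L n) <= e / 2 / (2 * A).
  by near: n; exact: near_expR_linear.
have small2 : expR (- (2^-1 * L n)) <= e / 2.
  by near: n; apply: near_expR_small => //; rewrite invr_gt0.
set m0 := Num.truncn (A * L n) in hD.
have AL0 : 0 <= A * L n by rewrite mulr_ge0// ltW.
have m0A : m0%:R <= A * L n by have /andP[] := truncn_itv AL0.
have /andP[eps0 _] := e01.
pose tau := expR ((2^-1 - J A) * L n).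
apply: (@le_trans _ _ (eps n * (\sum_(1 <= k < m0.+1) (n%:R * pmf n k * C n k + C' n k) + n%:R * tau))%:E).
  apply: (integral_counts_le (sample_mK (H0 n)) (sample_K_gt0 (H0 n)) eps0 _ (C_ge0 n) (C'_ge0 n)) => //.
  - by move=> kv; apply: sumr_ge0 => i _; exact: alt_power_ge0.
  - by move=> i k k0; exact: (size_prob Ttheta (H0 n) zero01 p0 pos n0 i k0).
  - by move=> i; have [] := tl i m0.+1 (ltW (truncnS_gt _)).
rewrite lee_fin.
have S : \sum_(1 <= k < m0.+1) (n%:R * pmf n k * C n k + C' n k) <=
    2 * A * (1 + L n) * expR ((beta - gam) * L n).
  apply: (@le_trans _ _ (\sum_(1 <= k < m0.+1) (2 * expR ((beta - gam) * L n)))).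
    rewrite big_nat_cond [leRHS]big_nat_cond; apply: ler_sum => k /andP[/andP[k1 km] _].
    by apply: hC => //; apply: le_trans m0A; rewrite ler_nat.
  have -> : \sum_(1 <= k < m0.+1) (2 * expR ((beta - gam) * L n)) =
      m0%:R * (2 * expR ((beta - gam) * L n)) by rewrite sumr_const_nat subn1 [RHS]mulr_natl.
  have h : m0%:R <= A * (1 + L n) by rewrite (le_trans m0A)// ler_pM2l// lerDr.
  have := @ler_wpM2r _ (2 * expR ((beta - gam) * L n)) _ _ _ h.
  rewrite mulr_ge0 ?expR_ge0// => /(_ isT) /le_trans; apply.
  by rewrite le_eqVlt; apply/orP; left; apply/eqP; ring.
have T : n%:R * tau <= expR ((2^-1 - 1) * L n).
  have -> : n%:R * tau = expR (L n) * tau by rewrite -natr_expR.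
  rewrite /tau -expRD ler_expR.
  have : 2 * L n <= J A * L n by rewrite ler_wpM2r.
  by rewrite !mulrBl mul1r; set y := J A * L n; set z := 2^-1 * L n; lra.
have epsE : eps n = expR (- (beta * L n)) by rewrite powR_natE// mulNr.
rewrite mulrDr [e](splitr e) lerD//.
  apply: (@le_trans _ _ (eps n * (2 * A * (1 + L n) * expR ((beta - gam) * L n)))).
    by rewrite ler_wpM2l.
  rewrite epsE (_ : expR _ * _ = 2 * A * (expR (- (gam * L n)) * (1 + L n))).
    by rewrite mulrC -ler_pdivlMr// mulr_gt0.
  rewrite mulrBl expRD expRN; field; rewrite gt_eqF ?expR_gt0//.
apply: le_trans small2.
apply: (@le_trans _ _ (1 * expR ((2^-1 - 1) * L n))).
  by have /andP[_ e1] := e01; rewrite ler_pM// mulr_ge0// expR_ge0.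
by rewrite mul1r ler_expR le_eqVlt; apply/orP; left; apply/eqP; field.
Unshelve. all: by end_near. Qed.

Lemma powerless_of_counts : 
  (fun n => risk (P0 n) (P1 n) (weighted_min F0 (@K n) (@Y n) (@V n) (@W n))) @ \oo --> 1%E.
Proof.
apply: cvg_to1 => [|e e0].
  near=> n.
  have [n0 e01 p0 pos] : regular n.
    by near: n; exact: (near_regular beta01 A3 Ttheta H0).
  exact: (risk_le1 Ttheta _ (H0 n) p0 pos (@W_gt0 n)).
have e2 : 0 < e / 2 by rewrite divr_gt0.
near=> n.
have [n0 e01 p0 pos] : regular n.
  by near: n; exact: (near_regular beta01 A3 Ttheta H0).
rewrite [e]splitr.
apply: (risk_ge (Ttheta := Ttheta) (H0 n) (H1 n) e01 p0 pos (@W_gt0 n) (c0 := c n)); try exact: ltW.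
  by near: n; exact: near_null_accept.
by near: n; exact: near_detections.
Unshelve. all: by end_near. Qed.

End from_counts.

Lemma lt_real_between (x : \bar R) (b : R) : (x < b%:E)%E ->
  exists2 b', b' < b & (x < b'%:E)%E.
Proof.
case: x => [r| |] //; last by move=> _; exists (b - 1); rewrite ?ltNyr//; lra.
by rewrite lte_fin => rb; exists ((r + b) / 2); rewrite ?lte_fin; lra.
Qed.

Lemma sum_delta (C : nat -> R) m0 k : (0 < k)%N -> (k <= m0)%N ->
  \sum_(1 <= j < m0.+1) C j * (k == j)%:R = C k.
Proof.
move=> k0 km; rewrite (bigD1_seq k)/= ?iota_uniq ?mem_index_iota ?k0 ?ltnS//.
rewrite eqxx mulr1 big1 ?addr0// => j jk.
by rewrite eq_sym (negbTE jk) mulr0.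
Qed.

Lemma alt_power_le k t l : 0 < l <= 1 -> Theta F0 (theta / l) -> 0 < t ->
  alt_power Ttheta k t <= expR ((1 - l) * ln t + k%:R * cumulant_gap F0 theta l).
Proof.
by move=> l01 Tl t0; rewrite -lee_fin -alt_powerE; exact: alt_pvalue_le.
Qed.

(** The threshold is n ^ (gam - 1). At the size a L the bound of alt_pvalue_le is
    used with the l that bonferroni_exponent assigns to a. *)
Lemma bonferroni_powerless : curve_reaches_peak F0 J theta ->
  (bB F0 J theta < beta%:E)%E ->
  asymptotically_powerless P0 P1 (fun n => bonferroni F0 (@K n) (@Y n) (@V n)).
Proof.
move=> peak /lt_real_between[b' bb' Bb'].
have /choice[lf Hlf] : forall a, exists l, 0 < a ->
    [/\ 0 < l <= 1, Theta F0 (theta / l) & l + a * cumulant_gap F0 theta l - J a < b'].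
  move=> a; have [a0'|a0'] := ltP 0 a; last by exists 1.
  have [l Hl] := bonferroni_exponent Ttheta theta_neq0 dpsi A1 A2 peak Bb' a0'.
  by exists l.
have [A aA JA] := J_unbounded A1 A2 2.
have A_gt0 : 0 < A := lt_trans a0_gt0 aA.
pose gam := Num.min ((beta - b') / 3) 1.
have gam0 : 0 < gam by rewrite lt_min ltr01 divr_gt0// subr_gt0.
have gam1 : gam <= 1 by rewrite ge_min lexx orbT.
have gamb : b' + 2 * gam <= beta - gam.
  have : gam <= (beta - b') / 3 by rewrite ge_min lexx.
  by lra.
pose l n k := lf (k%:R / L n).
pose C n (k : nat) := expR ((1 - l n k) * ((gam - 1) * L n) + k%:R * cumulant_gap F0 theta (l n k)).
rewrite /asymptotically_powerless.
rewrite (_ : (fun n => _) = (fun n => risk (P0 n) (P1 n)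
  (weighted_min F0 (@K n) (@Y n) (@V n) (@unit_weight n)))); last first.
  by apply/funext => n; rewrite bonferroniE.
apply: (@powerless_of_counts _ (fun n => expR ((gam - 1) * L n)) A gam C (fun _ _ => 0)) => //.
- by move=> n; exact: expR_gt0.
- by apply: nearW => n kv i; rewrite divr1.
- exact: ltW.
- exact: JA.
- by move=> n k; exact: expR_ge0.
- near=> n => k k0 kA; rewrite addr0.
  have [n0 e01 p0 pos] : regular n.
    by near: n; exact: (near_regular beta01 A3 Ttheta H0).
  have L1 : 1 <= L n by near: n; exact: near_ln_ge.
  have L0 : 0 < L n by exact: lt_le_trans L1.
  have hp : forall k, (0 < k)%N -> pmf n k <= 1 -> k%:R <= A * L n ->
      pmf n k <= expR ((gam - J (k%:R / L n)) * L n).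
    by near: n; exact: (near_size_pmf_le A1 A3 gam0 A_gt0).
  have {}hp := hp k k0 (pmf_le1 Ttheta (H0 n) zero01 p0 pos n0 k0) kA.
  pose a := k%:R / L n; have a_gt0 : 0 < a by rewrite divr_gt0// ltr0n.
  have kE : k%:R = a * L n by rewrite divfK// gt_eqF.
  have [/andP[l0 l1] _ Hl] := Hlf a a_gt0.
  apply: (@le_trans _ _ (expR ((beta - gam) * L n))); last first.
    by rewrite ler_peMl ?expR_ge0// ler1n.
  apply: (@le_trans _ _ (expR (L n) * expR ((gam - J a) * L n) * C n k)).
    by rewrite ler_wpM2r ?expR_ge0// -natr_expR// ler_wpM2l.
  rewrite /C /l -/a {1}kE -!expRD ler_expR.
  have -> : L n + (gam - J a) * L n + ((1 - lf a) * ((gam - 1) * L n) + a * L n * cumulant_gap F0 theta (lf a)) =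
     (lf a + a * cumulant_gap F0 theta (lf a) - J a + gam + (1 - lf a) * gam) * L n by ring.
  rewrite ler_pM2r//.
  have : (1 - lf a) * gam <= 1 * gam by rewrite ler_pM2r//; move: l0; lra.
  by move: Hl gamb; set x := _ * cumulant_gap _ _ _; set y := (1 - lf a) * gam; lra.
near=> n => kv kv0; set m0 := Num.truncn _.
have L1 : 1 <= L n by near: n; exact: near_ln_ge.
have L0 : 0 < L n by exact: lt_le_trans L1.
rewrite [X in _ + X + _]big1// addr0 -big_split/=; apply: ler_sum => i _.
have [mk|km] := ltnP m0 (kv i).
  rewrite (le_trans (alt_power_le1 _ _ _))// lerDr; apply: sumr_ge0 => k _.
  by rewrite mulr_ge0// expR_ge0.
rewrite addr0 sum_delta//.
have a_gt0 : 0 < (kv i)%:R / L n by rewrite divr_gt0// ltr0n.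
have [l01 Tl _] := Hlf _ a_gt0.
apply: le_trans (alt_power_le _ l01 Tl _) _; first by rewrite divr1 expR_gt0.
by rewrite divr1 expRK.
Unshelve. all: by end_near. Qed.

(** The threshold is n ^ gam. An observation of size k has rank at least M k, the
    number of observations of that size, so together these contribute at most
    c ^ (1 - l) exp (k cumulant_gap l) (M k) ^ l, with the l that rank_exponent
    assigns to a. The last power is at most z ^ l + z ^ (l - 1) M k, where
    z = n ^ (1 - J a + gam) slightly exceeds the expectation of M k. *)
Lemma rank_powerless : (bR F0 J theta < beta%:E)%E ->
  asymptotically_powerless P0 P1 (fun n => rank_adjusted F0 (@K n) (@Y n) (@V n)).
Proof.
move=> /lt_real_between[b' bb' Bb'].
have /choice[lf Hlf] : forall a, exists l, 0 < a ->
    [/\ 0 < l <= 1, Theta F0 (theta / l) & l * (1 - J a) + a * cumulant_gap F0 theta l < b'].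
  move=> a; have [a0'|a0'] := ltP 0 a; last by exists 1.
  have [l Hl] := rank_exponent Ttheta theta_neq0 dpsi A1 A2 Bb' a0'.
  by exists l.
have [A aA JA] := J_unbounded A1 A2 2.
have A_gt0 : 0 < A := lt_trans a0_gt0 aA.
pose gam := Num.min ((beta - b') / 3) 1.
have gam0 : 0 < gam by rewrite lt_min ltr01 divr_gt0// subr_gt0.
have gam1 : gam <= 1 by rewrite ge_min lexx orbT.
have gamb : b' + 2 * gam <= beta - gam.
  have : gam <= (beta - b') / 3 by rewrite ge_min lexx.
  by lra.
pose l n k := lf (k%:R / L n).
pose z n k := (1 - J (k%:R / L n) + gam) * L n.
pose G n (k : nat) := (1 - l n k) * (gam * L n) + k%:R * cumulant_gap F0 theta (l n k).
pose C n (k : nat) := expR (G n k + (l n k - 1) * z n k).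
pose C' n (k : nat) := expR (G n k + l n k * z n k).
rewrite /asymptotically_powerless.
rewrite (_ : (fun n => _) = (fun n => risk (P0 n) (P1 n)
  (weighted_min F0 (@K n) (@Y n) (@V n) (@rank_weight n)))); last first.
  by apply/funext => n; rewrite rank_adjustedE.
apply: (@powerless_of_counts _ (fun n => expR (gam * L n)) A gam C C') => //.
- by move=> n; exact: rank_weight_gt0.
- by move=> n; exact: expR_gt0.
- near=> n => kv i; have n0 : (0 < n)%N by near: n; exists 1%N.
  rewrite mulrBl mul1r expRD expRN -natr_expR// ler_wpM2l ?expR_ge0//.
  by rewrite lef_pV2 ?posrE ?ltr0n ?rank_weight_gt0// ler_nat rank_weight_le.
- exact: ltW.
- exact: JA.
- by move=> n k; exact: expR_ge0.
- by move=> n k; exact: expR_ge0.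
- near=> n => k k0 kA.
  have [n0 e01 p0 pos] : regular n.
    by near: n; exact: (near_regular beta01 A3 Ttheta H0).
  have L1 : 1 <= L n by near: n; exact: near_ln_ge.
  have L0 : 0 < L n by exact: lt_le_trans L1.
  have hp : forall k, (0 < k)%N -> pmf n k <= 1 -> k%:R <= A * L n ->
      pmf n k <= expR ((gam - J (k%:R / L n)) * L n).
    by near: n; exact: (near_size_pmf_le A1 A3 gam0 A_gt0).
  have {}hp := hp k k0 (pmf_le1 Ttheta (H0 n) zero01 p0 pos n0 k0) kA.
  pose a := k%:R / L n; have a_gt0 : 0 < a by rewrite divr_gt0// ltr0n.
  have kE : k%:R = a * L n by rewrite divfK// gt_eqF.
  have [/andP[l0 l1] _ Hl] := Hlf a a_gt0.
  have C'E : C' n k = expR ((lf a * (1 - J a) + a * cumulant_gap F0 theta (lf a) + gam) * L n).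
    by rewrite /C' /G /z /l -/a {1}kE; congr expR; ring.
  have C'le : C' n k <= expR ((beta - gam) * L n).
    rewrite C'E ler_expR ler_pM2r//.
    have := gam0; move: Hl gamb; set x := _ * cumulant_gap _ _ _; set y := lf a * (_ - _); lra.
  rewrite [leRHS]mulr_natl mulr2n lerD//; apply: le_trans C'le.
  apply: (@le_trans _ _ (expR (L n) * expR ((gam - J a) * L n) * C n k)).
    by rewrite ler_wpM2r ?expR_ge0// -natr_expR// ler_wpM2l.
  rewrite /C /C' -!expRD ler_expR le_eqVlt; apply/orP; left; apply/eqP.
  by rewrite /z -/a; ring.
near=> n => kv kv0; set m0 := Num.truncn _.
have n0 : (0 < n)%N by near: n; exists 1%N.
have L1 : 1 <= L n by near: n; exact: near_ln_ge.
have L0 : 0 < L n by exact: lt_le_trans L1.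
pose M (k : nat) : R := \sum_(i < n) (kv i == k)%:R.
have M_ge1 i : 1 <= M (kv i).
  by rewrite /M (bigD1 i)//= eqxx lerDl; apply: sumr_ge0.
have M_le i : M (kv i) <= (rank_weight kv i)%:R.
  rewrite rank_weight_le_tail /tail_count; apply: ler_sum => j _.
  by rewrite ler_nat; case: eqP => // ->; rewrite leqnn.
pose D k := expR (G n k - (1 - l n k) * ln (M k)).
have D_ge i : alt_power Ttheta (kv i) (expR (gam * L n) / (rank_weight kv i)%:R) <= D (kv i).
  have M0 : 0 < M (kv i) := lt_le_trans ltr01 (M_ge1 i).
  have a_gt0 : 0 < (kv i)%:R / L n by rewrite divr_gt0// ltr0n.
  have [l01 Tl _] := Hlf _ a_gt0.
  apply: (@le_trans _ _ (alt_power Ttheta (kv i) (expR (gam * L n) / M (kv i)))).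
    apply: le_alt_power; rewrite ler_wpM2l ?expR_ge0// lef_pV2 ?posrE//.
    by rewrite ltr0n rank_weight_gt0.
  apply: le_trans (alt_power_le _ l01 Tl _) _; first by rewrite divr_gt0// expR_gt0.
  rewrite ler_expR ln_div ?posrE ?expR_gt0// expRK le_eqVlt; apply/orP; left; apply/eqP.
  by rewrite /G /l; ring.
have MD k : (0 < k)%N -> M k * D k <= C n k * M k + C' n k.
  move=> k0.
  have a_gt0 : 0 < k%:R / L n by rewrite divr_gt0// ltr0n.
  have [/andP[l0 l1] _ _] := Hlf _ a_gt0; rewrite -/(l n k) in l0 l1.
  have [Mk0|M0] := leP (M k) 0.
    have -> : M k = 0 by apply/eqP; rewrite eq_le Mk0; apply: sumr_ge0.
    by rewrite mul0r mulr0 add0r expR_ge0.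
  have [h|h] := leP (ln (M k)) (z n k).
    apply: (@le_trans _ _ (C' n k)); last by rewrite lerDr mulr_ge0 ?expR_ge0// ltW.
    rewrite -[X in X * _]lnK ?posrE// -expRD ler_expR.
    have : l n k * ln (M k) <= l n k * z n k by rewrite ler_pM2l.
    by rewrite mulrBl mul1r; set x := _ * ln _; lra.
  apply: (@le_trans _ _ (C n k * M k)); last by rewrite lerDl expR_ge0.
  rewrite mulrC ler_pM2r// ler_expR lerD2l.
  rewrite -mulNr opprB ler_wnM2l ?subr_le0// ltW//.
rewrite /expected_detections.
apply: (@le_trans _ _ (\sum_(i < n) (\sum_(1 <= k < m0.+1) D k * (kv i == k)%:R +
     (m0 < kv i)%N%:R))).
  apply: ler_sum => i _.
  have [mk|km] := ltnP m0 (kv i).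
    rewrite (le_trans (alt_power_le1 _ _ _))// lerDr; apply: sumr_ge0 => k _.
    by rewrite mulr_ge0// expR_ge0.
  by rewrite addr0 sum_delta.
rewrite big_split/= lerD2r exchange_big/= [X in _ <= X + _]exchange_big/= -big_split/=.
rewrite big_nat_cond [leRHS]big_nat_cond; apply: ler_sum => k /andP[/andP[k1 _] _].
by rewrite -!mulr_sumr -/(M k) mulrC MD.
Unshelve. all: by end_near. Qed.

End powerless.

Theorem theorem4 (R : realType) (F0 : probability (measurableTypeR R) R)
    (a0 : R) (J : R -> R) (alpha : nat -> nat -> R) (beta theta : R)
    (d : nat -> measure_display) (Om : forall n, measurableType (d n))
    (P0 P1 : forall n, probability (Om n) R)
    (K : forall n, 'I_n -> Om n -> nat)
    (Y V : forall n, 'I_n -> Om n -> measurableTypeR R)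
    (beta01 : 0 < beta < 1)
    (A1 : J_flat a0 J) (A2 : J_convex a0 J) (A3 : alpha_subexponential a0 alpha)
    (theta_in : Theta F0 theta) (theta_neq0 : theta != 0)
    (dpsi : psi_derivable F0 theta)
    (a0_le : (a0%:E * rate F0 (mean F0 theta) <= 1)%E)
    (H0 : forall n, sample F0 theta (size_pmf J alpha n) 0 (P0 n)
                      (@K n) (@Y n) (@V n))
    (H1 : forall n, sample F0 theta (size_pmf J alpha n) (n%:R `^ (- beta))
                      (P1 n) (@K n) (@Y n) (@V n)) :
  [/\ curve_reaches_peak F0 J theta -> (bB F0 J theta < beta%:E)%E ->
        asymptotically_powerless P0 P1
          (fun n => bonferroni F0 (@K n) (@Y n) (@V n)),
      (beta%:E < bB F0 J theta)%E ->
        asymptotically_powerful P0 P1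
          (fun n => bonferroni F0 (@K n) (@Y n) (@V n)),
      (bR F0 J theta < beta%:E)%E ->
        asymptotically_powerless P0 P1
          (fun n => rank_adjusted F0 (@K n) (@Y n) (@V n))
    & (beta%:E < bR F0 J theta)%E ->
        asymptotically_powerful P0 P1
          (fun n => rank_adjusted F0 (@K n) (@Y n) (@V n))].
Proof.
split.
- exact: (bonferroni_powerless beta01 A1 A2 A3 theta_in theta_neq0 dpsi H0 H1).
- exact: (bonferroni_powerful beta01 A1 A2 A3 theta_in dpsi a0_le H0 H1).
- exact: (rank_powerless beta01 A1 A2 A3 theta_in theta_neq0 dpsi H0 H1).
- exact: (rank_powerful beta01 A1 A2 A3 theta_in dpsi a0_le H0 H1).
Qed.
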